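(* Let $\mathbb{F}=\mathbb{C}$ or $\mathbb{R}$, let $\mathbf{f}:\Omega\subset\mathbb{F}^m\to\mathbb{F}^n$ be a smooth mapping on an open domain $\Omega$, with Jacobian $J(\mathbf{x})$ at $\mathbf{x}\in\Omega$, let $\mathbf{x}_*\in\Omega$ be a semiregular zero of $\mathbf{f}$, and let $r=\mathrm{rank}(J(\mathbf{x}_* ))$. Then for every open neighborhood $\Omega_1$ of $\mathbf{x}_*$ there is a neighborhood $\Omega_0$ of $\mathbf{x}_*$ such that, from every initial iterate $\mathbf{x}_0\in\Omega_0$, the rank-$r$ Newton's iteration $$\mathbf{x}_{k+1}=\mathbf{x}_k-J_{\mathrm{rank}\text{-}r}(\mathbf{x}_k)^\dagger\,\mathbf{f}(\mathbf{x}_k),\qquad k=0,1,2,\ldots$$ converges quadratically to a semiregular zero $\hat{\mathbf{x}}\in\Omega_1$ of $\mathbf{f}$ in the same branch as $\mathbf{x}_*$.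
   Context: Smooth mapping: $\mathbf{f}:\Omega\to\mathbb{F}^n$ with $\Omega\subset\mathbb{F}^m$ open is smooth if it has continuous derivatives of second order (case $\mathbb{F}=\mathbb{R}$) or is holomorphic (case $\mathbb{F}=\mathbb{C}$). There is no restriction on the relative sizes of $m$ and $n$. Rank-$r$ projection: for a matrix $A$ with singular values $\sigma_1(A)\ge\sigma_2(A)\ge\cdots$ and corresponding left and right singular vectors $\mathbf{u}_j,\mathbf{v}_j$, $A_{\mathrm{rank}\text{-}r}:=\sum_{j=1}^r\sigma_j(A)\,\mathbf{u}_j\mathbf{v}_j^{\mathsf H}$ (it does not depend on the choice of singular vectors when $\sigma_r(A)>\sigma_{r+1}(A)$). $J_{\mathrm{rank}\text{-}r}(\mathbf{x})$ is the rank-$r$ projection of $J(\mathbf{x})$, and $\dagger$ denotes the Moore-Penrose inverse, so $J_{\mathrm{rank}\text{-}r}(\mathbf{x})^\dagger=(J_{\mathrm{rank}\text{-}r}(\mathbf{x}))^\dagger$. Zero: $\mathbf{x}_*$ is a zero of $\mathbf{f}$ if $\mathbf{f}(\mathbf{x}_* )=\mathbf{0}$; $\mathbf{f}^{-1}(\mathbf{0})$ is the set of all zeros. A zero is isolated if it is the only zero in some open neighborhood of it. Dimension of a zero: let $\mathbf{x}_*$ be a zero of $\mathbf{f}$. If there is an open neighborhood $\Delta\subset\Omega$ of $\mathbf{x}_*$ in $\mathbb{F}^m$ such that $\Delta\cap\mathbf{f}^{-1}(\mathbf{0})=\phi(\Lambda)$, where $\phi$ is a differentiable injective mapping defined on a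 connected open set $\Lambda$ in $\mathbb{F}^k$ for a certain $k>0$, with $\phi(\mathbf{z}_* )=\mathbf{x}_*$ for some $\mathbf{z}_*\in\Lambda$ and Jacobian $\phi_{\mathbf{z}}(\mathbf{z}_* )$ of rank $k$, then the dimension of $\mathbf{x}_*$ as a zero of $\mathbf{f}$ is $\dim_{\mathbf{f}}(\mathbf{x}_* ):=k$. An isolated zero has dimension $0$. Otherwise the dimension is not defined. Semiregular zero: a zero $\mathbf{x}_*$ is semiregular if $\dim_{\mathbf{f}}(\mathbf{x}_* )$ is well-defined and equal to the nullity of $J(\mathbf{x}_* )$, i.e. $\dim_{\mathbf{f}}(\mathbf{x}_* )+\mathrm{rank}(J(\mathbf{x}_* ))=m$. Same branch: with $\phi,\Lambda,\mathbf{z}_*,k$ as in the definition of the dimension of $\mathbf{x}_*$ and $\Lambda_*\subset\Lambda$ an open neighborhood of $\mathbf{z}_*$ on which $\mathrm{rank}(\phi_{\mathbf{z}}(\mathbf{z}))\equiv k$, every $\mathbf{x}\in\phi(\Lambda_* )$ is in the same branch of zeros as $\mathbf{x}_*$; and if $\tilde{\mathbf{x}}$ is in the same branch as $\mathbf{x}_*$, then every zero in the same branch as $\tilde{\mathbf{x}}$ is in the same branch as $\mathbf{x}_*$. An isolated zero is in the same branch only as itself. Quadratic convergence: a sequence $\{\mathbf{x}_k\}$ converges quadratically to $\hat{\mathbf{x}}$ if there is a constant $h$ with $0<h<1$ such that $\|\mathbf{x}_k-\hat{\mathbf{x}}\|_2\le\frac{1}{1-h}\,h^{2^k}$ for all $k\ge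 0$. Convergence of the iteration includes that all iterates remain in the domain $\Omega$. *)

(* Defs.v *)
From HB Require Import structures.
From mathcomp Require Import all_boot all_order all_algebra.
From mathcomp Require Import complex.
From mathcomp Require Import all_classical all_reals topology normedtype derive.

Set Implicit Arguments.
Unset Strict Implicit.
Unset Printing Implicit Defensive.

Import Order.TTheory GRing.Theory Num.Theory.
Import numFieldNormedType.Exports.

Local Open Scope classical_set_scope.
Local Open Scope ring_scope.

Inductive field_kind := RealKind | ComplexKind.

(* The topology and the derivatives below are those of the numFieldType, so
   over R[i] differentiability is complex differentiability. *)
Definition field_of (R : realType) (k : field_kind) : numFieldType :=
  match k with
  | RealKind => R : numFieldType
  | ComplexKind => R[i] : numFieldType
  end.

Section Scalars.
Variables (R : realType) (k : field_kind).

Definition of_real : R -> field_of R k :=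
  match k return R -> field_of R k with
  | RealKind => fun a => a
  | ComplexKind => fun a => (a%:C)%C
  end.

Definition conjugate : field_of R k -> field_of R k :=
  match k return field_of R k -> field_of R k with
  | RealKind => fun a => a
  | ComplexKind => fun z => (z^*)%C
  end.

Definition modulus : field_of R k -> R :=
  match k return field_of R k -> R with
  | RealKind => fun a => `|a|
  | ComplexKind => fun z => Num.sqrt (complex.Re z ^+ 2 + complex.Im z ^+ 2)
  end.

Local Notation F := (field_of R k).

Definition norm2 (m : nat) (x : 'cV[F]_m) : R :=
  Num.sqrt (\sum_(i < m) modulus (x i 0) ^+ 2).

Definition adjoint (m n : nat) (A : 'M[F]_(m, n)) : 'M[F]_(n, m) :=
  (map_mx conjugate A)^T.

(* Reduced singular value decomposition A = U diag(s) V^H: the columns of U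
   and V are orthonormal and there are min(n, m) singular values. *)
Definition is_svd (n m : nat) (A : 'M[F]_(n, m)) (U : 'M[F]_(n, minn n m))
    (s : 'rV[R]_(minn n m)) (V : 'M[F]_(m, minn n m)) : Prop :=
  [/\ adjoint U *m U = 1%:M,
      adjoint V *m V = 1%:M,
      forall j, 0 <= s 0 j,
      forall i j : 'I_(minn n m), (i <= j)%N -> s 0 j <= s 0 i &
      A = U *m diag_mx (map_mx of_real s) *m adjoint V].

(* The singular vectors are arbitrary but fixed; the value does not depend on
   them when the r-th and (r+1)-st singular values of A differ. *)
Definition rank_proj (n m r : nat) (A : 'M[F]_(n, m)) : 'M[F]_(n, m) :=
  xget 0 [set B | exists U s V, is_svd A U s V /\
    B = \sum_(j < minn n m | (j < r)%N)
          of_real (s 0 j) *: (col j U *m adjoint (col j V))].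

(* The Penrose equations, which have exactly one solution X. *)
Definition is_mpinv (n m : nat) (A : 'M[F]_(n, m)) (X : 'M[F]_(m, n)) : Prop :=
  [/\ A *m X *m A = A,
      X *m A *m X = X,
      adjoint (A *m X) = A *m X &
      adjoint (X *m A) = X *m A].

Definition mpinv (n m : nat) (A : 'M[F]_(n, m)) : 'M[F]_(m, n) :=
  xget 0 [set X | is_mpinv A X].

(* Unlike the row-vector jacobian of derive.v, this is the usual n x m matrix
   of the partial derivatives of f_i with respect to x_j. *)
Definition jacobian_mx (m n : nat) (f : 'cV[F]_m -> 'cV[F]_n) (x : 'cV[F]_m) :
    'M[F]_(n, m) :=
  \matrix_(i < n, j < m) ('D_(delta_mx j 0) f x) i 0.

Definition smooth (m n : nat) (Omega : set 'cV[F]_m)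
    (f : 'cV[F]_m -> 'cV[F]_n) : Prop :=
  match k with
  | RealKind => forall x, Omega x ->
      [/\ differentiable f x,
          differentiable (jacobian_mx f) x &
          forall v, {for x, continuous ('D_v (jacobian_mx f))}]
  | ComplexKind => forall x, Omega x -> differentiable f x
  end.

Definition zeros (m n : nat) (Omega : set 'cV[F]_m)
    (f : 'cV[F]_m -> 'cV[F]_n) : set 'cV[F]_m :=
  [set x | Omega x /\ f x = 0].

Section Zeros.
Variables (m n : nat) (Omega : set 'cV[F]_m) (f : 'cV[F]_m -> 'cV[F]_n).

Definition isolated_zero (x : 'cV[F]_m) : Prop :=
  exists2 U, open_nbhs x U & U `&` zeros Omega f = [set x].

Record zero_chart (x : 'cV[F]_m) (d : nat) (phi : 'cV[F]_d -> 'cV[F]_m)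
    (Lambda : set 'cV[F]_d) (z : 'cV[F]_d) : Prop := ZeroChart {
  zero_chart_dim : (0 < d)%N;
  zero_chart_image : exists Delta : set 'cV[F]_m,
    [/\ open_nbhs x Delta, Delta `<=` Omega &
        Delta `&` zeros Omega f = phi @` Lambda];
  zero_chart_open : open Lambda;
  zero_chart_connected : connected Lambda;
  zero_chart_diff : forall u, Lambda u -> differentiable phi u;
  zero_chart_inj : forall u v, Lambda u -> Lambda v -> phi u = phi v -> u = v;
  zero_chart_mem : Lambda z;
  zero_chart_base : phi z = x;
  zero_chart_rank : \rank (jacobian_mx phi z) = d }.

Definition zero_dim (x : 'cV[F]_m) (d : nat) : Prop :=
  (d = 0%N /\ isolated_zero x) \/
  (exists phi Lambda z, @zero_chart x d phi Lambda z).

Definition semiregular_zero (x : 'cV[F]_m) : Prop :=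
  zeros Omega f x /\
  exists2 d, zero_dim x d & (d + \rank (jacobian_mx f x))%N = m.

Inductive same_branch (x : 'cV[F]_m) : 'cV[F]_m -> Prop :=
| same_branch_isolated : isolated_zero x -> same_branch x x
| same_branch_chart d (phi : 'cV[F]_d -> 'cV[F]_m) Lambda z Lambda0 y :
    zero_chart x phi Lambda z ->
    open_nbhs z Lambda0 -> Lambda0 `<=` Lambda ->
    (forall u, Lambda0 u -> \rank (jacobian_mx phi u) = d) ->
    (phi @` Lambda0) y -> same_branch x y
| same_branch_trans y w :
    same_branch x y -> same_branch y w -> same_branch x w.

Fixpoint newton_iter (r : nat) (x0 : 'cV[F]_m) (i : nat) : 'cV[F]_m :=
  if i is i'.+1 then
    let x := newton_iter r x0 i' in
    x - mpinv (rank_proj r (jacobian_mx f x)) *m f x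
  else x0.

End Zeros.

Definition converges_quadratically (m : nat) (u : nat -> 'cV[F]_m)
    (l : 'cV[F]_m) : Prop :=
  exists2 h : R, 0 < h < 1 &
    forall i, norm2 (u i - l) <= 1 / (1 - h) * h ^+ (2 ^ i)%N.

End Scalars.

(* Main.v *)
(* With J = J(xs), choose coordinates (z, w) near xs in which J only sees w. The
   implicit function theorem parametrizes the zeros of r independent combinations
   of the equations by a graph w = psi(z); semiregularity forces this graph to
   consist of zeros of f, so the graph is the branch of xs, the rank of the
   Jacobian is r along it, and |x - y| <= K |f(x)| for the foot y of x on it.
   As J(x) is O(|x - y|)-close to the rank r matrix J(y), its (r+1)-st singular
   value is of that order while the r-th one is bounded below, so that a Newton
   step satisfies |x' - x| <= K |f(x)| and |f(x')| <= K |f(x)|^2, which gives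
   quadratic convergence.
   The Lipschitz continuity of a holomorphic Jacobian comes from Goursat's
   subdivision argument, run on Riemann sums. *)
From HB Require Import structures.
Require Import Defs.
From mathcomp Require Import all_boot all_order all_algebra perm.
From mathcomp Require Import complex ring lra interval_inference.
From mathcomp Require Import all_classical all_reals topology normedtype landau derive.
Set Implicit Arguments.
Unset Strict Implicit.
Unset Printing Implicit Defensive.
Import Order.TTheory GRing.Theory Num.Theory.
Import numFieldNormedType.Exports.
Local Open Scope classical_set_scope.
Local Open Scope ring_scope.

(** * Scalars, the entrywise norm and Jacobians *)

(** The chart in the definition of the dimension is merely differentiable, with full rank known at
    one point. What carries the vanishing of [f] over to the whole graph is that the projection of
    the chart to the z coordinates covers a neighborhood. Over the complex numbers differentiability
    on an open set already gives a Lipschitz Jacobian, and a contraction proves this; over the reals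
    it does not, and surjectivity near a point with invertible derivative becomes a topological
    fact, drawn from the Poincare-Miranda theorem and, behind it, a mod 2 degree computation on a
    cubical grid.

    The Newton matrix G is built from singular vectors that are chosen arbitrarily and may jump with
    x. Two properties of it carry the convergence: G is bounded near [xs], and J - J G J is
    controlled by the distance from J to the matrices of rank at most r.

    Both fields share one development: moduli take values in [R], matrices are measured by the sum
    of the moduli of their entries, and all tolerances are real. *)

Section ScalarTheory.
Context {R : realType} {k : field_kind}.
Local Notation F := (field_of R k).
Local Notation "a %:F" := (@of_real R k a).
Implicit Types (a b : F) (s t : R).

Lemma modulusE a : `|a| = (modulus a)%:F.
Proof. by rewrite /modulus /of_real; case: k a => //= a; rewrite normc_def. Qed.

Lemma of_real_le s t : (s%:F <= t%:F) = (s <= t).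
Proof. by rewrite /of_real; case: k => //=; rewrite lecR. Qed.

Lemma of_real_lt s t : (s%:F < t%:F) = (s < t).
Proof. by rewrite /of_real; case: k => //=; rewrite ltcR. Qed.

Lemma of_real_inj : injective (@of_real R k).
Proof. by move=> s t /eqP; rewrite eq_le !of_real_le -eq_le => /eqP. Qed.

Lemma of_real_subproof : zmod_morphism (@of_real R k) * monoid_morphism (@of_real R k).
Proof.
rewrite /of_real; case: k => //=; split => //.
- exact: (raddfB (real_complex R)).
- by split; [exact: rmorph1 (real_complex R) | exact: rmorphM (real_complex R)].
Qed.

HB.instance Definition _ := GRing.isZmodMorphism.Build R F (@of_real R k) of_real_subproof.1.
HB.instance Definition _ := GRing.isMonoidMorphism.Build R F (@of_real R k) of_real_subproof.2.

Lemma conjugate_subproof : zmod_morphism (@conjugate R k) * monoid_morphism (@conjugate R k).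
Proof.
rewrite /conjugate; case: k => //=; split => //.
- exact: (raddfB (@conjc R)).
- by split; [exact: rmorph1 (@conjc R) | exact: rmorphM (@conjc R)].
Qed.

HB.instance Definition _ := GRing.isZmodMorphism.Build F F (@conjugate R k) conjugate_subproof.1.
HB.instance Definition _ := GRing.isMonoidMorphism.Build F F (@conjugate R k) conjugate_subproof.2.

Lemma conjugateK : involutive (@conjugate R k).
Proof. by rewrite /conjugate; case: k => //=; exact: conjcK. Qed.

Lemma conjugate_of_real s : conjugate s%:F = s%:F.
Proof. by rewrite /conjugate /of_real; case: k => //=; exact: conjc_real. Qed.

Lemma mul_conjugate a : a * conjugate a = (modulus a ^+ 2)%:F.
Proof.
rewrite rmorphXn /= -modulusE /conjugate; case: k a => /= a.
  by rewrite real_normK ?num_real// expr2.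
by rewrite sqr_normc.
Qed.

Lemma modulus_ge0 a : 0 <= modulus a.
Proof. by rewrite -of_real_le -modulusE rmorph0. Qed.

Lemma modulus_eq0 a : (modulus a == 0) = (a == 0).
Proof. by rewrite -[RHS]normr_eq0 modulusE -(inj_eq of_real_inj) rmorph0. Qed.

Lemma modulus0 : modulus (0 : F) = 0.
Proof. by apply/eqP; rewrite modulus_eq0. Qed.

Lemma modulusM a b : modulus (a * b) = modulus a * modulus b.
Proof. by apply: of_real_inj; rewrite rmorphM/= -!modulusE normrM. Qed.

Lemma modulusD a b : modulus (a + b) <= modulus a + modulus b.
Proof. by rewrite -of_real_le rmorphD/= -!modulusE ler_normD. Qed.

Lemma modulusN a : modulus (- a) = modulus a.
Proof. by apply: of_real_inj; rewrite -!modulusE normrN. Qed.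

Lemma modulus_of_real s : modulus s%:F = `|s|.
Proof.
rewrite /modulus /of_real; case: k => //=.
by rewrite expr0n addr0 sqrtr_sqr.
Qed.

Lemma modulus1 : modulus (1 : F) = 1.
Proof. by rewrite -(rmorph1 (@of_real R k)) modulus_of_real normr1. Qed.

Lemma modulus_conjugate a : modulus (conjugate a) = modulus a.
Proof.
apply/eqP; rewrite -(@eqrXn2 _ 2) ?modulus_ge0//; apply/eqP.
by apply: of_real_inj; rewrite -!mul_conjugate conjugateK mulrC.
Qed.

Lemma modulusV a : modulus a^-1 = (modulus a)^-1.
Proof. by apply: of_real_inj; rewrite fmorphV/= -!modulusE normfV. Qed.

Lemma modulus_sum (I : Type) (r : seq I) (P : pred I) (f : I -> F) :
  modulus (\sum_(i <- r | P i) f i) <= \sum_(i <- r | P i) modulus (f i).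
Proof.
elim/big_rec2: _ => [|i y x _ h]; first by rewrite modulus0.
by rewrite (le_trans (modulusD _ _))// lerD2l.
Qed.

End ScalarTheory.

Section Norm1.
Context {R : realType} {k : field_kind}.
Local Notation F := (field_of R k).
Local Notation "a %:F" := (@of_real R k a).

(** Submultiplicative for all shapes with no dimensional constant, unlike the max norm of the
    library, and real-valued over both fields. It dominates [norm2], so convergence bounds
    transfer. *)
Definition nrm (m n : nat) (A : 'M[F]_(m, n)) : R :=
  \sum_(i < m) \sum_(j < n) modulus (A i j).

Lemma nrm_ge0 m n (A : 'M[F]_(m, n)) : 0 <= nrm A.
Proof. by do 2!(apply: sumr_ge0 => ? _); exact: modulus_ge0. Qed.
Hint Resolve nrm_ge0 : core.

Lemma modulus_le_nrm m n (A : 'M[F]_(m, n)) i j : modulus (A i j) <= nrm A.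
Proof.
rewrite /nrm (bigD1 i)//= (bigD1 j)//= -addrA lerDl addr_ge0//.
  by apply: sumr_ge0 => ? _; exact: modulus_ge0.
by do 2!(apply: sumr_ge0 => ? _); exact: modulus_ge0.
Qed.

Lemma nrm_eq0 m n (A : 'M[F]_(m, n)) : nrm A = 0 -> A = 0.
Proof.
move=> A0; apply/matrixP => i j; rewrite mxE; apply/eqP.
by rewrite -modulus_eq0 eq_le modulus_ge0 -A0 modulus_le_nrm.
Qed.

Lemma nrm0 m n : nrm (0 : 'M[F]_(m, n)) = 0.
Proof. by rewrite /nrm !big1// => i _; rewrite big1// => j _; rewrite mxE modulus0. Qed.

Lemma nrmN m n (A : 'M[F]_(m, n)) : nrm (- A) = nrm A.
Proof. by do 2!apply: eq_bigr => ? _; rewrite mxE modulusN. Qed.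

Lemma nrmBC m n (A B : 'M[F]_(m, n)) : nrm (A - B) = nrm (B - A).
Proof. by rewrite -nrmN opprB. Qed.

Lemma nrmD m n (A B : 'M[F]_(m, n)) : nrm (A + B) <= nrm A + nrm B.
Proof.
rewrite /nrm -big_split/=; apply: ler_sum => i _.
by rewrite -big_split/=; apply: ler_sum => j _; rewrite mxE modulusD.
Qed.

Lemma nrmB m n (A B : 'M[F]_(m, n)) : nrm (A - B) <= nrm A + nrm B.
Proof. by rewrite (le_trans (nrmD _ _))// nrmN. Qed.

Lemma nrm_triangle m n (A B C : 'M[F]_(m, n)) : nrm (A - C) <= nrm (A - B) + nrm (B - C).
Proof. by rewrite (le_trans _ (nrmD _ _))// addrA subrK. Qed.

Lemma nrmZ m n a (A : 'M[F]_(m, n)) : nrm (a *: A) = modulus a * nrm A.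
Proof.
rewrite /nrm mulr_sumr; apply: eq_bigr => i _; rewrite mulr_sumr.
by apply: eq_bigr => j _; rewrite mxE modulusM.
Qed.

Lemma nrmM m n p (A : 'M[F]_(m, n)) (B : 'M[F]_(n, p)) :
  nrm (A *m B) <= nrm A * nrm B.
Proof.
rewrite {2}/nrm mulr_suml; apply: ler_sum => i _.
rewrite mulr_suml (@le_trans _ _ (\sum_j \sum_l modulus (A i l) * modulus (B l j)))//.
  apply: ler_sum => j _; rewrite mxE (le_trans (modulus_sum _ _ _))//.
  by apply: ler_sum => l _; rewrite modulusM.
rewrite exchange_big/=; apply: ler_sum => l _.
rewrite -mulr_sumr ler_wpM2l ?modulus_ge0//.
by rewrite /nrm (bigD1 l)//= lerDl; do 2!(apply: sumr_ge0 => ? _); exact: modulus_ge0.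
Qed.

Lemma nrm_entry_le m n (A : 'M[F]_(m, n)) e :
  (forall i j, modulus (A i j) <= e) -> nrm A <= (m * n)%:R * e.
Proof.
move=> h; rewrite (@le_trans _ _ (\sum_(i < m) \sum_(j < n) e))//.
  by apply: ler_sum => i _; apply: ler_sum.
by rewrite !sumr_const !card_ord -mulrnA mulr_natl mulnC.
Qed.

Lemma norm2_le_nrm m (x : 'cV[F]_m) : norm2 x <= nrm x.
Proof.
rewrite /norm2 -[leRHS]ger0_norm ?nrm_ge0// -sqrtr_sqr ler_wsqrtr//.
rewrite expr2 {1}/nrm mulr_suml; apply: ler_sum => i _.
by rewrite big_ord1 expr2 ler_wpM2l ?modulus_ge0// modulus_le_nrm.
Qed.

Lemma norm_le_nrm m n (A : 'M[F]_(m, n)) : `|A| <= (nrm A)%:F.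
Proof.
have [A0|/mx_norm_neq0[i A0]] := eqVneq (mx_norm A) 0; rewrite /Num.norm/= A0.
  by rewrite -(rmorph0 (@of_real R k)) of_real_le.
by rewrite modulusE of_real_le modulus_le_nrm.
Qed.

Lemma nrm_le_norm m n (A : 'M[F]_(m, n)) : (nrm A)%:F <= (m * n)%:R * `|A|.
Proof.
have hA i j : `|A i j| <= `|A|.
  have : (`|A i j|%:nng <= \big[Order.max/0%:nng]_ij `|A ij.1 ij.2|%:nng).
    by apply/bigmax_geP; right; exists (i, j).
  by rewrite -num_le.
rewrite /nrm rmorph_sum/=.
rewrite (@le_trans _ _ (\sum_(i < m) \sum_(j < n) `|A|))//.
  apply: ler_sum => i _; rewrite rmorph_sum/=; apply: ler_sum => j _.
  by rewrite -modulusE.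
by rewrite !sumr_const !card_ord -mulrnA mulr_natl mulnC.
Qed.

End Norm1.
#[global] Hint Extern 0 (is_true (0 <= nrm _)) => exact: nrm_ge0 : core.
#[global] Hint Extern 0 (is_true (0 <= modulus _)) => exact: modulus_ge0 : core.

(** * Neighborhoods and derivatives in terms of [nrm] *)

Section Bridge.
Context {R : realType} {k : field_kind}.
Local Notation F := (field_of R k).
Local Notation "a %:F" := (@of_real R k a).

Lemma of_real_modulus_gt0 (a : F) : 0 < a -> a = (modulus a)%:F.
Proof. by move=> a0; rewrite -modulusE gtr0_norm. Qed.

Lemma modulus_gt0 (a : F) : (0 < modulus a) = (a != 0).
Proof. by rewrite lt_def modulus_eq0 modulus_ge0 andbT. Qed.

Lemma nbhs_nrmP m n (x : 'M[F]_(m, n)) (U : set 'M[F]_(m, n)) :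
  nbhs x U <-> exists2 e : R, 0 < e & forall y, nrm (y - x) < e -> U y.
Proof.
split.
  move/nbhs_normP => -[e /= e0 eU]; exists (modulus e).
    by rewrite modulus_gt0 gt_eqF.
  move=> y xy; apply: eU => /=.
  by rewrite (le_lt_trans (norm_le_nrm _))// nrmBC (of_real_modulus_gt0 e0) of_real_lt.
move=> [e e0 eU]; rewrite -nbhs_nbhs_norm.
(* The number of entries compares [nrm] with the max norm; the successor keeps the divisor non-zero
   for empty matrices. *)
have d0 : 0 < e / (m * n).+1%:R by rewrite divr_gt0.
exists (e / (m * n).+1%:R)%:F; first by rewrite /= -(rmorph0 (@of_real R k)) of_real_lt.
move=> y /= xy; apply: eU.
have /le_lt_trans : (nrm (y - x))%:F <= ((m * n).+1%:R)%:F * `|x - y|.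
  rewrite (le_trans (nrm_le_norm _))// distrC rmorph_nat ler_wpM2r//.
  by rewrite ler_nat.
move=> /(_ e%:F); rewrite of_real_lt; apply.
have c0 : 0 < ((m * n).+1%:R)%:F by rewrite -(rmorph0 (@of_real R k)) of_real_lt.
rewrite -(ltr_pM2l c0) in xy; rewrite (lt_le_trans xy)//.
by rewrite -rmorphM/= mulrCA divff ?mulr1// pnatr_eq0.
Qed.

Lemma nbhs_nrm m n (x : 'M[F]_(m, n)) (e : R) : 0 < e ->
  nbhs x [set y | nrm (y - x) < e].
Proof. by move=> e0; apply/nbhs_nrmP; exists e. Qed.

Lemma openP_nrm m n (U : set 'M[F]_(m, n)) :
  open U <-> forall x, U x -> exists2 e : R, 0 < e & forall y, nrm (y - x) < e -> U y.
Proof.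
rewrite openE; split => [oU x /oU /nbhs_nrmP//|h x Ux].
by apply/nbhs_nrmP; exact: h.
Qed.

(** Frechet differentiability with real tolerances, so that estimates over both fields are the same
    inequalities in [R]. The weak inequality of the conclusion admits h = 0. *)
Definition has_jac m n (f : 'cV[F]_m -> 'cV[F]_n) (x : 'cV[F]_m) (L : 'M[F]_(n, m)) :=
  forall e : R, 0 < e -> exists2 d : R, 0 < d &
    forall h, nrm h < d -> nrm (f (x + h) - f x - L *m h) <= e * nrm h.

Lemma nrm_o m n p (g : 'M[F]_(p, 1) -> 'M[F]_(m, n)) :
  (forall e : F, 0 < e -> \forall h \near (0 : 'M[F]_(p, 1)), `|g h| <= e * `|h|) <->
  forall e : R, 0 < e -> exists2 d : R, 0 < d &
    forall h, nrm h < d -> nrm (g h) <= e * nrm h.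
Proof.
split=> [go e e0|go e e0].
  have c0 : 0 < (m * n).+1%:R :> R by [].
  have e'0 : 0 < (e / (m * n).+1%:R)%:F.
    by rewrite -(rmorph0 (@of_real R k)) of_real_lt divr_gt0.
  have /nbhs_nrmP[d d0 hd] := go _ e'0; exists d => // h hh.
  have := hd h; rewrite subr0 => /(_ hh) /= gh.
  rewrite -(@of_real_le _ k) (le_trans (nrm_le_norm _))//.
  rewrite (@le_trans _ _ (((m * n).+1%:R)%:F * ((e / (m * n).+1%:R)%:F * `|h|)))//.
    rewrite rmorph_nat; apply: ler_pM => //.
    by rewrite ler_nat.
  rewrite mulrA -rmorphM/= mulrCA divff ?mulr1 ?pnatr_eq0// rmorphM/=.
  by rewrite ler_wpM2l ?norm_le_nrm// -(rmorph0 (@of_real R k)) of_real_le ltW.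
have c0 : 0 < (p * 1).+1%:R :> R by [].
have e'0 : 0 < modulus e / (p * 1).+1%:R by rewrite divr_gt0// modulus_gt0 gt_eqF.
have [d d0 hd] := go _ e'0; apply/nbhs_nrmP; exists d => // h; rewrite subr0 => /hd gh.
rewrite /= (le_trans (norm_le_nrm _))//.
rewrite (@le_trans _ _ (modulus e / (p * 1).+1%:R * nrm h)%:F) ?of_real_le//.
rewrite rmorphM/= (@le_trans _ _ ((modulus e / (p * 1).+1%:R)%:F * (((p * 1).+1%:R)%:F * `|h|)))//.
  rewrite ler_wpM2l//; first by rewrite -(rmorph0 (@of_real R k)) of_real_le ltW.
  by rewrite (le_trans (nrm_le_norm _))// rmorph_nat ler_wpM2r// ler_nat.
by rewrite mulrA -rmorphM/= divfK ?pnatr_eq0// -of_real_modulus_gt0.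
Qed.

Lemma nrm_continuous m n p q (f : 'M[F]_(m, n) -> 'M[F]_(p, q)) x :
  {for x, continuous f} <-> forall e : R, 0 < e -> exists2 d : R, 0 < d &
    forall y, nrm (y - x) < d -> nrm (f y - f x) < e.
Proof.
split=> [cf e e0|h U /= /nbhs_nrmP[e /h[d d0 hd] eU]].
  by have /nbhs_nrmP := cf _ (nbhs_nrm (f x) e0).
by apply/nbhs_nrmP; exists d => // y /hd; apply: eU.
Qed.

Lemma mulmx_continuous m n p (A : 'M[F]_(m, n)) :
  continuous (mulmx A : 'M[F]_(n, p) -> 'M[F]_(m, p)).
Proof.
move=> x; apply/nrm_continuous => e e0.
have c0 : 0 < nrm A + 1 by rewrite ltr_wpDl ?nrm_ge0.
exists (e / (nrm A + 1)); first by rewrite divr_gt0.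
move=> y yx; rewrite -mulmxBr (le_lt_trans (nrmM _ _))//.
rewrite (@le_lt_trans _ _ ((nrm A + 1) * nrm (y - x)))//.
  by rewrite ler_wpM2r// lerDl.
by rewrite mulrC -ltr_pdivlMr.
Qed.

Lemma linear_col_delta m n p (g : {linear 'cV[F]_m -> 'M[F]_(n, p)}) v :
  g v = \sum_j v j 0 *: g (delta_mx j 0).
Proof.
rewrite [in LHS](matrix_sum_delta v) linear_sum; apply: eq_bigr => i _.
by rewrite big_ord1 linearZ.
Qed.

Lemma diff_jacobian m n (f : 'cV[F]_m -> 'cV[F]_n) x v : differentiable f x ->
  'd f x v = jacobian_mx f x *m v.
Proof.
move=> df; rewrite linear_col_delta; apply/matrixP => i j.
rewrite summxE !mxE; apply: eq_bigr => l _.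
by rewrite !mxE deriveE// (ord1 j) mulrC.
Qed.

Lemma differentiable_has_jac m n (f : 'cV[F]_m -> 'cV[F]_n) x :
  differentiable f x -> has_jac f x (jacobian_mx f x).
Proof.
move=> df; have /eqaddoP/nrm_o := diff_locally df.
move=> h e /h[d d0 hd]; exists d => // v /hd; rewrite -diff_jacobian//.
by rewrite !fctE/= opprD addrA (addrC v).
Qed.

Lemma has_jac_differentiable m n (f : 'cV[F]_m -> 'cV[F]_n) x L :
  has_jac f x L -> differentiable f x /\ jacobian_mx f x = L.
Proof.
move=> hf; pose g : {linear 'cV[F]_m -> 'cV[F]_n} := mulmx L.
have cg : continuous g by exact: mulmx_continuous.
have o e : 0 < e -> exists2 d : R, 0 < d &
    forall h, nrm h < d -> nrm ((f \o shift x - (cst (f x) + g)) h) <= e * nrm h.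
  move=> /hf[d d0 hd]; exists d => // h /hd.
  by rewrite !fctE/= opprD addrA (addrC h).
have dfg : 'd f x = g :> (_ -> _).
  by apply: (diff_unique cg); apply/eqaddoP/nrm_o.
have df : differentiable f x.
  by apply/diff_locallyP; rewrite dfg; split => //; apply/eqaddoP/nrm_o.
split=> //; apply/matrixP => i j; rewrite mxE deriveE// dfg /= /g/=.
by rewrite -colE mxE.
Qed.

Lemma has_jac_unique m n (f : 'cV[F]_m -> 'cV[F]_n) x L L' :
  has_jac f x L -> has_jac f x L' -> L = L'.
Proof. by move=> /has_jac_differentiable[_ <-] /has_jac_differentiable[_ <-]. Qed.

Lemma has_jac_continuous m n (f : 'cV[F]_m -> 'cV[F]_n) x L : has_jac f x L ->
  forall e : R, 0 < e -> exists2 d : R, 0 < d &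
    forall y, nrm (y - x) < d -> nrm (f y - f x) < e.
Proof.
move=> /has_jac_differentiable[/differentiable_continuous cf _].
exact/nrm_continuous.
Qed.

End Bridge.

Section RealParts.
Context {R : realType} {k : field_kind}.
Local Notation F := (field_of R k).
Local Notation "a %:F" := (@of_real R k a).

(** Suprema and the mean value theorem require real values; a scalar is controlled by its two parts
    at the cost of a factor 2. *)
Definition rpart : F -> R :=
  match k return field_of R k -> R with
  | RealKind => fun a => a
  | ComplexKind => fun z => complex.Re z
  end.

Definition ipart : F -> R :=
  match k return field_of R k -> R with
  | RealKind => fun=> 0
  | ComplexKind => fun z => complex.Im z
  end.

Lemma rpartB a b : rpart (a - b) = rpart a - rpart b.
Proof. by rewrite /rpart; case: k a b => //= -[? ?] [? ?]. Qed.

Lemma ipartB a b : ipart (a - b) = ipart a - ipart b.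
Proof. by rewrite /ipart; case: k a b => //= [_ _|[? ?] [? ?]//]; rewrite subr0. Qed.

Lemma rpartZ s a : rpart (s%:F * a) = s * rpart a.
Proof. by rewrite /rpart /of_real; case: k a => //= -[? ?] /=; rewrite mul0r subr0. Qed.

Lemma ipartZ s a : ipart (s%:F * a) = s * ipart a.
Proof.
by rewrite /ipart /of_real; case: k a => //= [_|[? ?] /=]; rewrite ?mulr0// mul0r addr0.
Qed.

Lemma rpart_le a : `|rpart a| <= modulus a.
Proof.
rewrite /rpart /modulus; case: k a => //= -[x y] /=.
by rewrite -sqrtr_sqr ler_wsqrtr// lerDl sqr_ge0.
Qed.

Lemma ipart_le a : `|ipart a| <= modulus a.
Proof.
rewrite /ipart /modulus; case: k a => //= [a|[x y]] /=; first by rewrite normr0.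
by rewrite -sqrtr_sqr ler_wsqrtr// lerDr sqr_ge0.
Qed.

Lemma modulus_le_parts a : modulus a <= `|rpart a| + `|ipart a|.
Proof.
rewrite /ipart /rpart /modulus; case: k a => //= [a|[x y]] /=.
  by rewrite normr0 addr0.
rewrite -[leRHS]ger0_norm ?addr_ge0// -sqrtr_sqr ler_wsqrtr//.
by rewrite sqrrD !real_normK ?num_real// lerD2r lerDl mulrn_wge0// mulr_ge0.
Qed.

End RealParts.

(** * Completeness and contractions *)

Section Completeness.
Context {R : realType}.

(** The hypothesis says that the intervals with centre [u n] and radius [b n] decrease, so the
    supremum of their left ends lies in all of them. The telescoping form of the bound yields the
    error of every term without summing a series. *)
Lemma nested_intervals (u b : nat -> R) : (forall n, 0 <= b n) ->
  (forall n, `|u n.+1 - u n| <= b n - b n.+1) ->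
  exists l, forall n, `|u n - l| <= b n.
Proof.
move=> b0 ub.
have lo n d : u n - b n <= u (n + d)%N - b (n + d)%N.
  elim: d => [|d /le_trans]; first by rewrite addn0.
  apply; rewrite addnS; have := ub (n + d)%N; rewrite ler_norml => /andP[h _]; lra.
have hi n d : u (n + d)%N + b (n + d)%N <= u n + b n.
  elim: d => [|d]; first by rewrite addn0.
  apply: le_trans; rewrite addnS; have := ub (n + d)%N; rewrite ler_norml => /andP[_ h]; lra.
have lohi i j : u i - b i <= u j + b j.
  have [/subnKC ij|/ltnW/subnKC ji] := leqP i j.
    by have := lo i (j - i)%N; rewrite ij => /le_trans; apply; have := b0 j; lra.
  have := hi j (i - j)%N; rewrite ji; apply: le_trans; have := b0 i; lra.
pose S := [set u i - b i | i in [set: nat]].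
have S0 : S !=set0 by exists (u 0%N - b 0%N); exists 0%N.
have Sub j : ubound S (u j + b j) by move=> _ [i _ <-]; exact: lohi.
exists (sup S) => n; rewrite ler_distlC; apply/andP; split.
  by apply: ub_le_sup; [exists (u 0%N + b 0%N); exact: Sub|exists n].
exact: ge_sup.
Qed.

Context {k : field_kind}.
Local Notation F := (field_of R k).

Lemma scalar_complete (u : nat -> F) (b : nat -> R) : (forall n, 0 <= b n) ->
  (forall n, modulus (u n.+1 - u n) <= b n - b n.+1) ->
  exists l, forall n, modulus (u n - l) <= 2 * b n.
Proof.
move=> b0 ub.
have [x xl] : exists x, forall n, `|rpart (u n) - x| <= b n.
  by apply: nested_intervals => // n; rewrite -rpartB (le_trans (rpart_le _)).
have [y yl] : exists x, forall n, `|ipart (u n) - x| <= b n.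
  by apply: nested_intervals => // n; rewrite -ipartB (le_trans (ipart_le _)).
suff [l hl] : exists l : F, forall n, `|rpart (u n - l)| <= b n /\ `|ipart (u n - l)| <= b n.
  exists l => n; rewrite (le_trans (modulus_le_parts _))//.
  by have [? ?] := hl n; lra.
move: u xl yl {ub}; rewrite /rpart /ipart; case: k => /= u xl yl.
  by exists x => n; split => //; rewrite normr0.
exists (x +i* y)%C => n; have := xl n; have := yl n.
by case: (u n).
Qed.

Lemma mx_complete p q (u : nat -> 'M[F]_(p, q)) (b : nat -> R) : (forall n, 0 <= b n) ->
  (forall n, nrm (u n.+1 - u n) <= b n - b n.+1) ->
  exists l, forall n, nrm (u n - l) <= (p * q * 2)%:R * b n.
Proof.
move=> b0 ub.
have /choice[l hl] i : exists l, forall j n, modulus (u n i j - l j) <= 2 * b n.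
  have /choice[l hl] j : exists l, forall n, modulus (u n i j - l) <= 2 * b n.
    apply: scalar_complete => // n; rewrite (le_trans _ (ub n))//.
    by have := modulus_le_nrm (u n.+1 - u n) i j; rewrite !mxE.
  by exists l.
exists (\matrix_(i, j) l i j) => n.
by rewrite natrM -mulrA; apply: nrm_entry_le => i j; rewrite !mxE.
Qed.

Lemma half_power_small (c e : R) : 0 <= c -> 0 < e -> exists n, c * 2^-1 ^+ n < e.
Proof.
move=> c0 e0; exists (Num.bound (c / e)).
have h : c / e < 2 ^+ Num.bound (c / e).
  rewrite (lt_le_trans (archi_boundP _)) ?divr_ge0 ?(ltW e0)//.
  by rewrite -natrX ler_nat ltnW// ltn_expl.
by rewrite exprVn ltr_pdivrMr ?exprn_gt0// mulrC -ltr_pdivrMr.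
Qed.

(* Only the size [2 * nrm (T 0)] matters: it keeps the iterates, and their
   limit, in the ball where [T] is a contraction. *)
Lemma contraction_fixpoint p (T : 'cV[F]_p -> 'cV[F]_p) (rho : R) :
  (forall w w', nrm w < rho -> nrm w' < rho -> nrm (T w - T w') <= 2^-1 * nrm (w - w')) ->
  2 * nrm (T 0) < rho -> exists w, [/\ nrm w <= 2 * nrm (T 0) & T w = w].
Proof.
move=> ctr T0; pose u n := iter n T 0.
set M := nrm (T 0) in T0 *.
(* The partial sums of M (1 + 1/2 + 1/4 + ...) are 2 M - 2 M 2^-n, so every iterate stays below 2 M
   < rho, where [T] contracts. *)
have u_n n : nrm (u n) <= 2 * M - 2 * M * 2^-1 ^+ n /\
    nrm (u n.+1 - u n) <= M * 2^-1 ^+ n.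
  elim: n => [|n [IH1 IH2]].
    by rewrite /u/= nrm0 subr0 expr0 !mulr1 subrr.
  have M0 : 0 <= M by exact: nrm_ge0.
  have p0 : 0 <= (2^-1 : R) ^+ n by rewrite exprn_ge0.
  have Mp0 : 0 <= M * (2^-1 : R) ^+ n by rewrite mulr_ge0.
  have un1 : nrm (u n.+1) <= 2 * M - 2 * M * 2^-1 ^+ n.+1.
    rewrite -[u n.+1](subrK (u n)) (le_trans (nrmD _ _))//.
    rewrite exprS; lra.
  split=> //; rewrite (le_trans (ctr _ _ _ _))// ?exprS; last lra.
    rewrite (le_lt_trans un1)//; rewrite exprS; lra.
  rewrite (le_lt_trans IH1)//; lra.
have M0 : 0 <= M by exact: nrm_ge0.
have p0 n : 0 <= (2^-1 : R) ^+ n by rewrite exprn_ge0.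
have Mp0 n : 0 <= M * (2^-1 : R) ^+ n by rewrite mulr_ge0.
have [w hw] : exists l, forall n, nrm (u n - l) <= (p * 1 * 2)%:R * (2 * M * 2^-1 ^+ n).
  apply: mx_complete => n; first by rewrite -mulrA mulr_ge0.
  by have [_] := u_n n; rewrite exprS; lra.
set D := (p * 1 * 2)%:R in hw.
have D0 : 0 <= D * (2 * M) by rewrite mulr_ge0// mulr_ge0.
have wM : nrm w <= 2 * M.
  apply/ler_addgt0Pr => e e0; have [n hn] := half_power_small D0 e0.
  rewrite -[w](subrK (u n)) (le_trans (nrmD _ _))// addrC lerD//.
    by have [h _] := u_n n; rewrite (le_trans h)//; have := Mp0 n; lra.
  by rewrite nrmBC (le_trans (hw n))// mulrA ltW.
exists w; split=> //; apply/eqP; rewrite -subr_eq0; apply/eqP/nrm_eq0/eqP.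
rewrite eq_le nrm_ge0 andbT; apply/ler_addgt0Pr => e e0; rewrite add0r.
have [n hn] := half_power_small D0 e0.
have un_lt : nrm (u n) < rho.
  by have [h _] := u_n n; rewrite (le_lt_trans h)//; have := Mp0 n; lra.
rewrite (le_trans (nrm_triangle _ (u n.+1) _))//.
have h1 := ctr w (u n) (le_lt_trans wM T0) un_lt.
have h2 := hw n; have h3 := hw n.+1.
rewrite nrmBC in h2; rewrite exprS -[u n.+1]/(T (u n)) in h3.
lra.
Qed.

End Completeness.

(** * Cauchy's estimate *)

Section Goursat.
Context {R : realType} {k : field_kind}.
Local Notation F := (field_of R k).
Local Notation "a %:F" := (@of_real R k a).
(** A square root of -1 is a parameter, so that no case analysis on [k] is needed inside the
    section; it is instantiated by the imaginary unit. *)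
Variable ii : F.
Hypothesis ii2 : ii * ii = -1.

Lemma modulus_ii : modulus ii = 1.
Proof.
apply/eqP; rewrite -(@eqrXn2 _ 2) ?modulus_ge0// expr1n expr2 -modulusM ii2.
by rewrite modulusN modulus1.
Qed.

Lemma conjugate_ii : conjugate ii = - ii.
Proof.
have ii0 : ii != 0 by rewrite -modulus_eq0 modulus_ii oner_eq0.
apply: (mulfI ii0); rewrite mul_conjugate modulus_ii expr1n rmorph1.
by rewrite mulrN ii2 opprK.
Qed.

Lemma modulus_rect (x t : R) : modulus (x%:F + ii * t%:F) ^+ 2 = x ^+ 2 + t ^+ 2.
Proof.
apply: (@of_real_inj R k); rewrite -mul_conjugate rmorphD rmorphM/= !conjugate_of_real.
rewrite conjugate_ii rmorphD/= !rmorphXn/=.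
rewrite [LHS](_ : _ = x%:F ^+ 2 - (ii * ii) * t%:F ^+ 2); last by ring.
by rewrite ii2; ring.
Qed.

Lemma modulus_rect_ge (x t : R) : `|x| <= modulus (x%:F + ii * t%:F) /\
  `|t| <= modulus (x%:F + ii * t%:F).
Proof.
have h := modulus_rect x t.
by split; rewrite -[leRHS]ger0_norm// -ler_sqr ?nnegrE// !real_normK ?num_real// h;
  rewrite ?lerDl ?lerDr sqr_ge0.
Qed.

Lemma modulus_rect_le (x t : R) : modulus (x%:F + ii * t%:F) <= `|x| + `|t|.
Proof. by rewrite (le_trans (modulusD _ _))// modulusM modulus_ii mul1r !modulus_of_real. Qed.

Lemma rect_neq0 (x t : R) : (x != 0) || (t != 0) -> x%:F + ii * t%:F != 0.
Proof.
move=> xt; rewrite -modulus_eq0; apply/negP => /eqP m0.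
have [] := modulus_rect_ge x t; rewrite m0 !normr_le0 => /eqP x0 /eqP t0.
by rewrite x0 t0 eqxx in xt.
Qed.

(** Up to the factor mu, the one-point Riemann sum of g dz counterclockwise around a cell: bottom +
    i right - top - i left, each side sampled at its lower or left end. *)
Definition cell (g : F -> F) (p : F) (mu : R) :=
  ii * (g (p + mu%:F) - g p) - (g (p + ii * mu%:F) - g p).

(* A Riemann sum, with step mu, of the contour integral of g dz around the
   square of side N mu with lower left corner a. *)
Definition contour (g : F -> F) (a : F) (mu : R) (N : nat) :=
  mu%:F * \sum_(i < N) \sum_(j < N)
    cell g (a + (i%:R * mu)%:F + ii * (j%:R * mu)%:F) mu.

Lemma big_ord_mul (V : nmodType) (p N : nat) (f : nat -> V) :
  \sum_(i < p * N) f i = \sum_(q < p) \sum_(i < N) f (q * N + i)%N.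
Proof.
elim: p => [|p IH]; first by rewrite mul0n !big_ord0.
rewrite big_ord_recr/= -IH mulSn addnC -(big_mkord xpredT f) (@big_cat_nat _ _ _ (p * N))//=; last first.
  exact: leq_addr.
rewrite big_mkord; congr (_ + _).
by rewrite -{1}[(p * N)%N]add0n big_addn addKn big_mkord; apply: eq_bigr => i _; rewrite addnC.
Qed.

(** The sum is defined cell by cell, so subdivision is a mere regrouping; the cancellation of
    interior edges is left to [contour_boundary]. *)
Lemma contour_subdivide g a mu p N : contour g a mu (p * N) =
  \sum_(u < p) \sum_(v < p)
    contour g (a + ((u * N)%:R * mu)%:F + ii * ((v * N)%:R * mu)%:F) mu N.
Proof.
rewrite /contour.
under [RHS]eq_bigr do rewrite -mulr_sumr.
rewrite -mulr_sumr; congr (_ * _).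
rewrite (big_ord_mul p N (fun i => \sum_(j < p * N)
  cell g (a + (i%:R * mu)%:F + ii * (j%:R * mu)%:F) mu)).
apply: eq_bigr => u _; rewrite [RHS]exchange_big/=; apply: eq_bigr => i _.
rewrite (big_ord_mul p N (fun j =>
  cell g (a + ((u * N + i)%:R * mu)%:F + ii * (j%:R * mu)%:F) mu)).
apply: eq_bigr => v _; apply: eq_bigr => j _; congr (cell _ _ _).
by rewrite !natrD !mulrDl !rmorphD/= mulrDr; ring.
Qed.

(** Interior edges telescope, along rows for the vertical sides and along columns for the horizontal
    ones. *)
Lemma contour_boundary g a mu N : contour g a mu N =
  mu%:F * (ii * (\sum_(j < N) (g (a + (N%:R * mu)%:F + ii * (j%:R * mu)%:F) -
                               g (a + ii * (j%:R * mu)%:F))) -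
           \sum_(i < N) (g (a + (i%:R * mu)%:F + ii * (N%:R * mu)%:F) -
                         g (a + (i%:R * mu)%:F))).
Proof.
rewrite /contour /cell; congr (_ * _).
under eq_bigr do rewrite sumrB.
rewrite sumrB; congr (_ - _).
  rewrite exchange_big/= mulr_sumr; apply: eq_bigr => j _.
  rewrite -mulr_sumr; congr (_ * _).
  rewrite -(big_mkord xpredT (fun i => g (a + (i%:R * mu)%:F + ii * (j%:R * mu)%:F + mu%:F) -
      g (a + (i%:R * mu)%:F + ii * (j%:R * mu)%:F))).
  rewrite (@telescope_sumr_eq _ 0 N (fun i => g (a + (i%:R * mu)%:F + ii * (j%:R * mu)%:F)))//.
    by rewrite mul0r rmorph0 addr0.
  move=> i _; congr (g _ - _).
  by rewrite -natr1 mulrDl mul1r rmorphD/=; ring.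
apply: eq_bigr => i _.
rewrite -(big_mkord xpredT (fun j => g (a + (i%:R * mu)%:F + ii * (j%:R * mu)%:F + ii * mu%:F) -
    g (a + (i%:R * mu)%:F + ii * (j%:R * mu)%:F))).
rewrite (@telescope_sumr_eq _ 0 N (fun j => g (a + (i%:R * mu)%:F + ii * (j%:R * mu)%:F)))//.
  by rewrite mul0r rmorph0 mulr0 addr0.
move=> j _; congr (g _ - _).
by rewrite -natr1 mulrDl mul1r rmorphD/=; ring.
Qed.

Lemma contourB g1 g2 a mu N :
  contour (fun z => g1 z - g2 z) a mu N = contour g1 a mu N - contour g2 a mu N.
Proof.
rewrite /contour -mulrBr -sumrB; congr (_ * _); apply: eq_bigr => i _.
by rewrite -sumrB; apply: eq_bigr => j _; rewrite /cell; ring.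
Qed.

Lemma contourZ c g a mu N : contour (fun z => c * g z) a mu N = c * contour g a mu N.
Proof.
rewrite /contour [RHS]mulrCA; congr (_ * _); rewrite mulr_sumr; apply: eq_bigr => i _.
by rewrite mulr_sumr; apply: eq_bigr => j _; rewrite /cell; ring.
Qed.

(** Exact, with no discretization error: on each cell the increments of z are mu and i mu, and i (d
    mu) - d (i mu) = 0. *)
Lemma contour_affine c d z0 a mu N : contour (fun z => c + d * (z - z0)) a mu N = 0.
Proof.
rewrite /contour big1 ?mulr0// => i _; rewrite big1// => j _; rewrite /cell.
by ring.
Qed.

Lemma eq_contour g1 g2 a mu N : g1 =1 g2 -> contour g1 a mu N = contour g2 a mu N.
Proof. by move=> /funext ->. Qed.

Definition on_square (h x t : R) :=
  [/\ 0 <= x <= h, 0 <= t <= h & [|| x == 0, x == h, t == 0 | t == h]].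

Lemma contour_le g a mu N M : 0 <= mu ->
  (forall x t, on_square (N%:R * mu) x t -> modulus (g (a + x%:F + ii * t%:F)) <= M) ->
  modulus (contour g a mu N) <= 4 * (N%:R * mu) * M.
Proof.
move=> mu0 gM; set h := N%:R * mu in gM *.
have h0 : 0 <= h by rewrite mulr_ge0.
have jh (j : 'I_N) : 0 <= j%:R * mu <= h.
  by rewrite mulr_ge0//= ler_wpM2r// ler_nat ltnW.
have sumM (f : 'I_N -> F) : (forall i, modulus (f i) <= M + M) ->
    modulus (\sum_i f i) <= N%:R * (M + M).
  move=> fM; rewrite (le_trans (modulus_sum _ _ _))//.
  rewrite (@le_trans _ _ (\sum_(i < N) (M + M)))//; first exact: ler_sum.
  by rewrite sumr_const card_ord mulr_natl.
have lM x t : on_square h x t -> modulus (g (a + x%:F + ii * t%:F)) <= M by exact: gM.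
have ge1 (t : R) : g (a + ii * t%:F) = g (a + 0%:F + ii * t%:F) by rewrite rmorph0 addr0.
have ge2 (x : R) : g (a + x%:F) = g (a + x%:F + ii * 0%:F) by rewrite rmorph0 mulr0 addr0.
rewrite contour_boundary modulusM modulus_of_real (ger0_norm mu0).
set X := \sum_(j < N) _; set Y := \sum_(i < N) _.
have XM : modulus X <= N%:R * (M + M).
  apply: sumM => j; rewrite (le_trans (modulusD _ _))// modulusN lerD//.
    by apply: lM; split; rewrite ?jh ?lexx ?h0 ?eqxx ?orbT.
  by rewrite ge1; apply: lM; split; rewrite ?jh ?lexx ?h0 ?eqxx ?orbT.
have YM : modulus Y <= N%:R * (M + M).
  apply: sumM => j; rewrite (le_trans (modulusD _ _))// modulusN lerD//.
    by apply: lM; split; rewrite ?jh ?lexx ?h0 ?eqxx ?orbT.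
  by rewrite ge2; apply: lM; split; rewrite ?jh ?lexx ?h0 ?eqxx ?orbT.
rewrite [leRHS](_ : _ = mu * (N%:R * (M + M) + N%:R * (M + M))); last by rewrite /h; ring.
rewrite ler_wpM2l// (le_trans (modulusD _ _))// modulusN modulusM modulus_ii mul1r.
exact: lerD.
Qed.

Definition cdiff (g : F -> F) (z d : F) := forall e : R, 0 < e ->
  exists2 r : R, 0 < r & forall w, modulus (w - z) < r ->
    modulus (g w - g z - d * (w - z)) <= e * modulus (w - z).

(* Subdividing by 3 leaves a central square, which isolates the singularity of
   1 / z in Cauchy's estimate. *)
Definition small_contour g a (h e : R) :=
  exists L0, forall L, (L0 <= L)%N -> modulus (contour g a (h / 3 ^+ L) (3 ^ L)) <= e.

Lemma small_contour_subdivide g a h (e : 'I_3 -> 'I_3 -> R) :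
  (forall u v : 'I_3, small_contour g (a + (u%:R * (h / 3))%:F + ii * (v%:R * (h / 3))%:F) (h / 3) (e u v)) ->
  small_contour g a h (\sum_(u < 3) \sum_(v < 3) e u v).
Proof.
move=> sm.
have /choice[L hL] : forall u : 'I_3, exists L : 'I_3 -> nat, forall v l, (L v <= l)%N ->
    modulus (contour g (a + (u%:R * (h / 3))%:F + ii * (v%:R * (h / 3))%:F)
      (h / 3 / 3 ^+ l) (3 ^ l)) <= e u v.
  by move=> u; have /choice[L hL] := sm u; exists L.
(* One level of refinement is spent on the subdivision itself, hence the successor. *)
exists (\max_u \max_v L u v).+1 => -[//|l]; rewrite ltnS => ml.
rewrite expnS contour_subdivide (le_trans (modulus_sum _ _ _))//.
apply: ler_sum => u _; rewrite (le_trans (modulus_sum _ _ _))//.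
apply: ler_sum => v _; have := hL u v l.
have -> : (L u v <= l)%N.
  by rewrite (leq_trans (leq_trans (@leq_bigmax _ (L u) v) (@leq_bigmax _ (fun u => \max_v L u v) u))).
move=> /(_ isT); have -> : h / 3 ^+ l.+1 = h / 3 / 3 ^+ l.
  by rewrite exprS invfM mulrA.
have e3 w : w%:R * (h / 3) = (w * 3 ^ l)%:R * (h / 3 / 3 ^+ l).
  by rewrite natrM natrX -mulrA [3 ^+ l * _]mulrC divfK// expf_neq0// pnatr_eq0.
by rewrite -!e3.
Qed.

(** Subtracting the affine part at z0 does not change the contour sum and leaves at most e/8 * 2 h'
    on the boundary of a square of side h' containing z0; the perimeter 4 h' then gives e h'^2. *)
Lemma goursat_local g e z0 d : 0 < e -> cdiff g z0 d ->
  exists2 r, 0 < r & forall a' h', 0 < h' -> 2 * h' < r ->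
    (exists x t, [/\ 0 <= x <= h', 0 <= t <= h' & z0 = a' + x%:F + ii * t%:F]) ->
    small_contour g a' h' (e * h' ^+ 2).
Proof.
move=> e0 /(_ (e / 8))[|r r0 hr]; first by rewrite divr_gt0.
exists r => // a' h' h'0 h'r [x0 [t0 [xh th z0E]]]; exists 0%N => L _.
have mu0 : 0 <= h' / 3 ^+ L by rewrite divr_ge0 ?exprn_ge0// ltW.
have -> : contour g a' (h' / 3 ^+ L) (3 ^ L) =
    contour (fun z => g z - (g z0 + d * (z - z0))) a' (h' / 3 ^+ L) (3 ^ L).
  by rewrite contourB contour_affine subr0.
have muE : (3 ^ L)%:R * (h' / 3 ^+ L) = h'.
  by rewrite natrX mulrCA divff ?mulr1// expf_neq0// pnatr_eq0.
rewrite (le_trans (@contour_le _ _ _ _ (e / 8 * (2 * h')) mu0 _))//; last first.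
  by rewrite muE; lra.
rewrite muE => x t [xh' th' _].
have dz : modulus (a' + x%:F + ii * t%:F - z0) <= 2 * h'.
  rewrite z0E [X in modulus X](_ : _ = (x - x0)%:F + ii * (t - t0)%:F); last first.
    by rewrite !rmorphB/=; ring.
  rewrite (le_trans (modulus_rect_le _ _))// [2 * h']mulr_natl mulr2n lerD// ler_norml;
    by apply/andP; split; lra.
rewrite opprD addrA (le_trans (hr _ _)) ?(le_lt_trans dz)//.
by rewrite ler_wpM2l// divr_ge0// ltW.
Qed.

(** The tolerance is proportional to the area, so a square violating it contains, among its nine
    parts, another one that does. Nested bad squares shrink to a point, where [goursat_local]
    contradicts their badness. *)
Lemma goursat g a h e : 0 < h -> 0 < e ->
  (forall x t, 0 <= x <= h -> 0 <= t <= h ->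
     exists d, cdiff g (a + x%:F + ii * t%:F) d) ->
  small_contour g a h (e * h ^+ 2).
Proof.
move=> h0 e0 dg; apply: contrapT => bad0.
pose H n := h / 3 ^+ n.
have H0 n : 0 < H n by rewrite /H divr_gt0 ?exprn_gt0.
have HS n : H n.+1 = H n / 3 by rewrite /H exprS invfM mulrAC mulrA.
pose bad n (p : R * R) := ~ small_contour g (a + p.1%:F + ii * p.2%:F) (H n) (e * H n ^+ 2).
have step n p : bad n p -> exists uv : 'I_3 * 'I_3,
    bad n.+1 (p.1 + uv.1%:R * H n.+1, p.2 + uv.2%:R * H n.+1).
  move=> badp; apply: contrapT => /forallNP good; apply: badp.
  have -> : e * H n ^+ 2 = \sum_(u < 3) \sum_(v < 3) (e * H n.+1 ^+ 2).
    by rewrite !sumr_const !card_ord HS; rewrite -mulrnA -mulr_natl; field.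
  apply: small_contour_subdivide => u v.
  have /contrapT := good (u, v); rewrite /= -HS.
  congr (small_contour _ _ _ _).
  by rewrite !rmorphD/=; ring.
(* The level is stored with the corner because badness depends on it, while the choice principle
   works with a single type of states. *)
pose X := {np : nat * (R * R) | bad np.1 np.2}.
have [f [f0 fS]] : exists f : nat -> X, (sval (f 0%N)) = (0%N, (0, 0)) /\
    forall n, exists uv : 'I_3 * 'I_3, sval (f n.+1) =
      ((sval (f n)).1.+1, ((sval (f n)).2.1 + uv.1%:R * H (sval (f n)).1.+1,
                           (sval (f n)).2.2 + uv.2%:R * H (sval (f n)).1.+1)).
  have x0 : bad 0%N (0, 0).
    by rewrite /bad /H /= expr0 divr1 rmorph0 mulr0 !addr0.
  have := @dependent_choice X (fun x y => exists uv : 'I_3 * 'I_3, sval y =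
      ((sval x).1.+1, ((sval x).2.1 + uv.1%:R * H (sval x).1.+1,
                           (sval x).2.2 + uv.2%:R * H (sval x).1.+1))).
  move=> /(_ _ (exist _ (0%N, (0, 0)) x0))[|f [f0 fS]].
    move=> [[n p] /= badp]; apply: cid; have [uv buv] := step n p badp.
    by exists (exist _ (n.+1, (p.1 + uv.1%:R * H n.+1, p.2 + uv.2%:R * H n.+1)) buv), uv.
  by exists f; rewrite f0.
have f1 n : (sval (f n)).1 = n.
  by elim: n => [|n IH]; [rewrite f0|have [uv ->] := fS n; rewrite /= IH].
pose s n := (sval (f n)).2.1; pose t n := (sval (f n)).2.2.
have sS n : exists u : 'I_3, s n.+1 = s n + u%:R * H n.+1.
  by have [uv fSn] := fS n; exists uv.1; rewrite /s fSn /= f1.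
have tS n : exists u : 'I_3, t n.+1 = t n + u%:R * H n.+1.
  by have [uv fSn] := fS n; exists uv.2; rewrite /t fSn /= f1.
(* A coordinate of the corner advances by 0, 1 or 2 thirds of the side; the centres [x n + H n / 2]
   with radii [H n / 2] therefore give nested intervals. *)
have lim (x : nat -> R) : x 0%N = 0 -> (forall n, exists u : 'I_3, x n.+1 = x n + u%:R * H n.+1) ->
    exists l, forall n, 0 <= l - x n <= H n.
  move=> x0 xS; have [||l hl] := @nested_intervals _ (fun n => x n + H n / 2) (fun n => H n / 2).
  - by move=> n; rewrite divr_ge0// ltW.
  - move=> n; have [[u u3] ->] := xS n; rewrite ler_norml /= HS.
    have := H0 n; move: (H n) => y y0.
    by case: u u3 => [|[|[|//]]] _ /=; apply/andP; split; lra.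
  - exists l => n; have := hl n; rewrite ler_norml => /andP[? ?].
    by apply/andP; split; lra.
have [sl hs] := lim s (congr1 (fun z => z.2.1) f0) sS.
have [tl ht] := lim t (congr1 (fun z => z.2.2) f0) tS.
have H00 : H 0%N = h by rewrite /H expr0 divr1.
have [||d hd] := dg sl tl.
- by have := hs 0%N; rewrite /s f0 H00 subr0.
- by have := ht 0%N; rewrite /t f0 H00 subr0.
have [r r0 hr] := goursat_local e0 hd.
have [n hn] : exists n, 2 * H n < r.
  exists (Num.bound (2 * h / r)); rewrite /H mulrA ltr_pdivrMr ?exprn_gt0//.
  have lt1 : 2 * h / r < (Num.bound (2 * h / r))%:R.
    by apply: archi_boundP; rewrite divr_ge0 ?(ltW r0)// mulr_ge0// ltW.
  rewrite -ltr_pdivrMl// [r^-1 * _]mulrC (lt_le_trans lt1)// -natrX ler_nat ltnW//.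
  exact: ltn_expl.
have := svalP (f n); rewrite /bad f1; apply; apply: hr => //.
exists (sl - s n), (tl - t n); split => //.
by rewrite /s /t !rmorphB/=; ring.
Qed.

(** Gives access to the algebraic rules of [derivable]. *)
Lemma cdiffP g z : (exists d, cdiff g z d) <-> derivable (g : F -> F^o) z 1.
Proof.
split=> [[d hd]|].
  apply/cvg_ex; exists d; apply/cvgrPdist_le => /= e e0.
  have me0 : 0 < modulus e by rewrite modulus_gt0 gt_eqF.
  have [r r0 hr] := hd _ me0.
  have rF0 : 0 < r%:F by rewrite -(rmorph0 (@of_real R k)) of_real_lt.
  near=> w.
  have w0 : w != 0 by near: w; exact: nbhs_dnbhs_neq.
  have wr : modulus w < r.
    rewrite -(@of_real_lt _ k) -modulusE; near: w; exact: dnbhs0_lt.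
  rewrite /= [w *: 1]mulr1 (of_real_modulus_gt0 e0) modulusE of_real_le.
  have := hr (w + z); rewrite addrK => /(_ wr).
  have -> : d - w^-1 *: (g (w + z) - g z) = - (w^-1 * (g (w + z) - g z - d * w)).
    by rewrite mulrBr mulrCA mulVf// mulr1 opprB.
  move=> h; rewrite modulusN modulusM modulusV ler_pdivrMl ?modulus_gt0//.
  by rewrite [leRHS]mulrC.
move=> /derivable_nbhs /eqaddoP h; exists ('D_1 (g : F -> F^o) z) => e e0.
have eF0 : 0 < e%:F by rewrite -(rmorph0 (@of_real R k)) of_real_lt.
have /nbhs_normP[r /= r0 hr] := h _ eF0.
exists (modulus r); first by rewrite modulus_gt0 gt_eqF.
move=> w wz; have := hr (w - z); rewrite /ball_/= sub0r normrN.
rewrite {1}modulusE (of_real_modulus_gt0 r0) of_real_lt => /(_ wz).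
rewrite !fctE/= [(w - z) *: 1]mulr1 subrK !modulusE -rmorphM/= of_real_le.
by rewrite opprD addrA [(w - z) *: _]mulrC.
Unshelve. all: by end_near. Qed.

Lemma cdiff_remainder g d z : z != 0 -> (exists d', cdiff g z d') ->
  exists d', cdiff (fun w => (g w - g 0) / w ^+ 2 - d * w^-1) z d'.
Proof.
move=> z0 /cdiffP dg; apply/cdiffP.
have d1 : derivable (fun w => g w - g 0 : F^o) z 1.
  exact: (@derivableB F F^o F^o g (cst (g 0)) z 1 dg (derivable_cst _ _ _)).
have d2 : derivable (fun w : F^o => w ^+ 2 : F^o) z 1 by exact: exprn_derivable.
have d3 : derivable (fun w : F^o => (w ^+ 2)^-1 : F^o) z 1.
  by apply: (@derivableV F F^o _ z 1 _ d2); rewrite expf_neq0.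
have d4 := @derivableV F F^o id z 1 z0 (@derivable_id F F^o z 1).
have d5 := @derivableM F F^o _ _ z 1 d1 d3.
have d6 := @derivableM F F^o _ _ z 1 (derivable_cst (d : F^o) z 1) d4.
exact: (@derivableB F F^o F^o _ _ z 1 d5 d6).
Qed.

Definition corner (r : R) : F := - r%:F - ii * r%:F.

(** The integral is 2 pi i, and any positive lower bound serves the purpose. Opposite sides pair
    into 1/(r + i y) + 1/(r - i y) = 2 r / (r^2 + y^2), which is real and at least 1 / r because |y|
    <= r; nothing cancels, and the sum is at least 2 (2 r) / r = 4. *)
Lemma contour_inv_ge (r mu : R) (N : nat) : 0 < r -> 0 < mu -> N%:R * mu = 2 * r ->
  4 <= modulus (contour (fun z => z^-1) (corner r) mu N).
Proof.
move=> r0 mu0 Nmu.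
have rF0 : r%:F != 0 :> F by rewrite fmorph_eq0 gt_eqF.
have [f fdef] : exists f : R -> R, forall y, f y = 2 * r / (r ^+ 2 + y ^+ 2) by eexists.
have nz1 y : r%:F + ii * y%:F != 0 by rewrite rect_neq0// gt_eqF.
have nz2 y : r%:F - ii * y%:F != 0.
  by have := nz1 (- y); rewrite rmorphN mulrN.
have fE y : (f y)%:F = (r%:F + ii * y%:F)^-1 + (r%:F - ii * y%:F)^-1.
  rewrite fdef rmorphM fmorphV/= rmorphD/= !rmorphXn/= rmorphM/= rmorph_nat.
  rewrite -[_^-1 in RHS]mul1r -[(_ - _)^-1]mul1r addf_div// !mul1r; congr (_ / _); first by ring.
  by rewrite [RHS](_ : _ = r%:F ^+ 2 - (ii * ii) * y%:F ^+ 2); [rewrite ii2; ring|ring].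
have rN : (N%:R * mu)%:F = 2 * r%:F :> F by rewrite Nmu rmorphM rmorph_nat.
pose y (j : nat) := j%:R * mu - r.
have -> : contour (fun z => z^-1) (corner r) mu N =
    ii * (2 * mu * \sum_(j < N) f (y j))%:F.
  rewrite contour_boundary [RHS](_ : _ = mu%:F * (ii * (\sum_(j < N) (f (y j))%:F) - - \sum_(j < N) ii * (f (y j))%:F)); last first.
    rewrite -mulr_sumr -(rmorph_sum (@of_real R k)); move: (\sum_(j < N) f (y j)) => S.
    by rewrite opprK !rmorphM/= rmorph_nat; ring.
  congr (_ * (ii * _ - _)).
    apply: eq_bigr => j _; rewrite fE /corner rN.
    have -> : - r%:F - ii * r%:F + 2 * r%:F + ii * (j%:R * mu)%:F = r%:F + ii * (y j)%:F.
      by rewrite rmorphB/=; ring.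
    have -> : - r%:F - ii * r%:F + ii * (j%:R * mu)%:F = - (r%:F - ii * (y j)%:F).
      by rewrite rmorphB/=; ring.
    by rewrite invrN opprK.
  rewrite -sumrN; apply: eq_bigr => j _; rewrite fE /corner rN.
  have ii0 : ii != 0 by rewrite -modulus_eq0 modulus_ii oner_eq0.
  have -> : - r%:F - ii * r%:F + (j%:R * mu)%:F + ii * (2 * r%:F) = ii * (r%:F - ii * (y j)%:F).
    rewrite [RHS](_ : _ = ii * r%:F - (ii * ii) * (y j)%:F); last by ring.
    by rewrite ii2 rmorphB/=; ring.
  have -> : - r%:F - ii * r%:F + (j%:R * mu)%:F = - (ii * (r%:F + ii * (y j)%:F)).
    rewrite [RHS](_ : _ = - (ii * r%:F + (ii * ii) * (y j)%:F)); last by ring.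
    by rewrite ii2 rmorphB/=; ring.
  have iiV : ii^-1 = - ii by apply: (mulfI ii0); rewrite mulfV// mulrN ii2 opprK.
  rewrite invrN !invfM iiV.
  by move: (_^-1) (_^-1) => P Q; ring.
rewrite modulusM modulus_ii mul1r modulus_of_real (le_trans _ (ler_norm _))//.
have fge j : (j < N)%N -> r^-1 <= f (y j).
  move=> jN; rewrite fdef ler_pdivlMr; last by rewrite ltr_wpDr ?sqr_ge0 ?exprn_gt0.
  rewrite ler_pdivrMl//.
  have : y j ^+ 2 <= r ^+ 2.
    rewrite -ler_sqr ?nnegrE ?sqr_ge0// -[leLHS]/((_ ^+ 2) ^+ 2) ler_sqr ?nnegrE ?sqr_ge0//.
    rewrite -(real_normK (num_real (y j))) ler_sqr ?nnegrE ?(ltW r0)// ler_norml /y.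
    have : j%:R * mu <= N%:R * mu by rewrite ler_wpM2r ?(ltW mu0)// ler_nat ltnW.
    have : 0 <= j%:R * mu by rewrite mulr_ge0// ltW.
    by rewrite Nmu => ? ?; apply/andP; split; lra.
  by move=> h; rewrite mulrCA -expr2; lra.
have : N%:R * r^-1 <= \sum_(j < N) f (y j).
  rewrite mulr_natl -[X in _ *+ X]card_ord -sumr_const; apply: ler_sum => j _.
  exact: fge.
move=> h; rewrite (@le_trans _ _ (2 * mu * (N%:R * r^-1)))//.
  rewrite [leRHS](_ : _ = 2 * (N%:R * mu) / r); last by ring.
  by rewrite Nmu mulrA mulfK ?gt_eqF// -natrM.
by rewrite ler_wpM2l// mulr_ge0// ltW.
Qed.

Lemma small_contour_le g a h e e' : e <= e' -> small_contour g a h e -> small_contour g a h e'.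
Proof. by move=> ee' [L0 h0]; exists L0 => L /h0 /le_trans; apply. Qed.

(** Of the nine parts only the central one contains 0. Goursat's lemma applies to the other eight,
    each of which is allotted an eighth of the slack e' - e. *)
Lemma small_contour_center g (r e e' : R) : 0 < r -> e < e' ->
  (forall x t, `|x| <= r -> `|t| <= r -> (x != 0) || (t != 0) ->
     exists d, cdiff g (x%:F + ii * t%:F) d) ->
  small_contour g (corner (r / 3)) (2 * (r / 3)) e ->
  small_contour g (corner r) (2 * r) e'.
Proof.
move=> r0 ee' dg sg.
pose E (u v : 'I_3) := if (u == 1 :> nat) && (v == 1 :> nat) then e else (e' - e) / 8.
have -> : e' = \sum_(u < 3) \sum_(v < 3) E u v.
  by rewrite !big_ord_recl !big_ord0 /E /=; field.
have hE : 2 * r / 3 = 2 * (r / 3) by rewrite mulrA.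
apply: small_contour_subdivide => u v; rewrite /E.
case: ifPn => [/andP[/eqP -> /eqP ->]|uv].
  rewrite hE; congr (small_contour _ _ _ _): sg.
  rewrite /corner !mul1r; have -> : 2 * (r / 3) = r - r / 3 by field.
  by rewrite rmorphB/=; ring.
have h0 : 0 < 2 * r / 3 by rewrite divr_gt0// mulr_gt0.
have e0 : 0 < (e' - e) / 8 / (2 * r / 3) ^+ 2.
  by rewrite !divr_gt0 ?exprn_gt0// subr_gt0.
have -> : (e' - e) / 8 = (e' - e) / 8 / (2 * r / 3) ^+ 2 * (2 * r / 3) ^+ 2.
  by rewrite divfK// expf_neq0// gt_eqF.
apply: goursat => // x t x0 t0.
rewrite (_ : corner r + _ + _ + _ + _ = (u%:R * (2 * r / 3) + x - r)%:F + ii * (v%:R * (2 * r / 3) + t - r)%:F); last first.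
  by rewrite /corner !rmorphB !rmorphD/=; ring.
have bnd (w : 'I_3) z : 0 <= z <= 2 * r / 3 ->
    `|w%:R * (2 * r / 3) + z - r| <= r /\ (nat_of_ord w != 1 -> w%:R * (2 * r / 3) + z - r != 0).
  move=> /andP[z0 z1]; rewrite ler_norml; case: w => [[|[|[|//]]] _] /=.
  - by split=> [|_]; [apply/andP; split; lra|rewrite lt_eqF//; lra].
  - by split=> //; apply/andP; split; lra.
  - by split=> [|_]; [apply/andP; split; lra|rewrite gt_eqF//; lra].
have [bx nx] := bnd u x x0; have [bt nt] := bnd v t t0.
apply: dg => //; move: uv; rewrite negb_and => /orP[/nx ->//|/nt ->].
by rewrite orbT.
Qed.

(* The remainder (g z - g 0) / z ^+ 2 - d / z is o(1 / z), so its contour sums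
   vanish in the limit, whereas those of 1 / z do not. *)
Lemma cauchy_estimate g (rho M : R) d : 0 < rho -> cdiff g 0 d ->
  (forall x t, `|x| <= rho -> `|t| <= rho -> exists d', cdiff g (x%:F + ii * t%:F) d') ->
  (forall x t, `|x| <= rho -> `|t| <= rho -> modulus (g (x%:F + ii * t%:F) - g 0) <= M) ->
  modulus d <= 2 * M / rho.
Proof.
move=> rho0 dg0 dg gM; pose q w := (g w - g 0) / w ^+ 2 - d * w^-1.
have dq x t : `|x| <= rho -> `|t| <= rho -> (x != 0) || (t != 0) ->
    exists d', cdiff q (x%:F + ii * t%:F) d'.
  by move=> xr tr xt; apply: cdiff_remainder (dg _ _ xr tr); exact: rect_neq0.
have onsq (r x t : R) : 0 < r -> on_square (2 * r) x t ->
    [/\ `|x - r| <= r, `|t - r| <= r & r <= modulus ((x - r)%:F + ii * (t - r)%:F)].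
  move=> r0 [/andP[x0 x1] /andP[t0 t1] xt]; split.
  - by rewrite ler_norml; apply/andP; split; lra.
  - by rewrite ler_norml; apply/andP; split; lra.
  have [h1 h2] := modulus_rect_ge (x - r) (t - r).
  case/or4P: xt => /eqP xt; [apply: le_trans h1|apply: le_trans h1|apply: le_trans h2|apply: le_trans h2];
    rewrite xt ler_normr; apply/orP; [right|left|right|left]; lra.
have cornerE (r x t : R) : corner r + x%:F + ii * t%:F = (x - r)%:F + ii * (t - r)%:F.
  by rewrite /corner !rmorphB/=; ring.
have NE (r : R) L : (3 ^ L)%:R * (2 * r / 3 ^+ L) = 2 * r.
  by rewrite natrX mulrCA divff ?mulr1// expf_neq0// pnatr_eq0.
pose r j := rho / 3 ^+ j.
have rj0 j : 0 < r j by rewrite /r divr_gt0 ?exprn_gt0.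
have rle j : r j <= rho by rewrite /r ler_pdivrMr ?exprn_gt0// ler_peMr ?(ltW rho0)// exprn_ege1// ler1n.
have small e : 0 < e -> small_contour q (corner rho) (2 * rho) e.
  move=> e0.
  (* On a small square, differentiability at 0 gives |q| <= (e/16) / r_j on the boundary, of length
     8 r_j; the contour sum is thus at most e / 2. *)
  have [j [e1 e10 hj]] : exists j, exists2 e1, e1 < e & small_contour q (corner (r j)) (2 * r j) e1.
    have [|s s0 hs] := dg0 (e / 16); first by rewrite divr_gt0.
    have [j hj] : exists j, 2 * r j < s.
      exists (Num.bound (2 * rho / s)); rewrite /r mulrA ltr_pdivrMr ?exprn_gt0//.
      have lt1 : 2 * rho / s < (Num.bound (2 * rho / s))%:R.
        by apply: archi_boundP; rewrite divr_ge0 ?(ltW s0)// mulr_ge0// ltW.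
      rewrite -ltr_pdivrMl// [s^-1 * _]mulrC (lt_le_trans lt1)// -natrX ler_nat ltnW//.
      exact: ltn_expl.
    exists j, (e / 2); first by lra.
    exists 0%N => L _; rewrite (le_trans (@contour_le _ _ _ _ (e / 16 / r j) _ _))//.
    - by rewrite divr_ge0 ?exprn_ge0// mulr_ge0// ltW.
    - rewrite NE => x t /(onsq _ _ _ (rj0 j))[xr tr rz]; rewrite cornerE.
      move: rz; set z := _ + _ => rz.
      have z0 : z != 0 by rewrite -modulus_eq0 gt_eqF// (lt_le_trans (rj0 j)).
      have zm : 0 < modulus z by rewrite modulus_gt0.
      have zs : modulus (z - 0) < s.
        rewrite subr0 (le_lt_trans (modulus_rect_le _ _))// (le_lt_trans _ hj)//.
        by rewrite [2 * _]mulr_natl mulr2n lerD.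
      have := hs z zs; rewrite subr0 => hz.
      have -> : q z = (g z - g 0 - d * z) / z ^+ 2.
        rewrite /q [RHS]mulrBl; congr (_ - _).
        by rewrite expr2 invfM mulrA mulfK.
      rewrite modulusM modulusV expr2 modulusM ler_pdivrMr ?mulr_gt0//.
      rewrite (le_trans hz)// mulrA ler_wpM2r ?(ltW zm)//.
      by rewrite -[leRHS]mulrA ler_peMr ?divr_ge0 ?(ltW e0)// ler_pdivlMl// mulr1.
    - rewrite NE; have := rj0 j => rj; rewrite [leLHS](_ : _ = e / 2)//.
      by field; rewrite gt_eqF.
  (* Back to the large square, by factors of 3: each enlargement costs as little as desired, and
     moving to the midpoint of e1 and e keeps the tolerance below e. *)
  elim: j e1 e10 hj => [|j IH] e1 e10 hj.
    by move: hj; rewrite /r expr0 divr1; apply: small_contour_le; exact: ltW.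
  apply: (IH ((e1 + e) / 2)); first by lra.
  apply: (@small_contour_center _ _ e1) => //; first by lra.
    by move=> x t xr tr; apply: dq; [exact: le_trans (rle j)|exact: le_trans (rle j)].
  by move: hj; rewrite /r exprS invfM mulrCA [_ / 3]mulrC.
apply/ler_addgt0Pr => e e0.
have [|L0 hL] := small (4 * e); first by rewrite mulr_gt0.
have := hL L0 (leqnn _); set mu := 2 * rho / 3 ^+ L0; set N := (3 ^ L0)%N => h1.
have mu0 : 0 < mu by rewrite /mu divr_gt0 ?exprn_gt0// mulr_gt0.
have h2 : modulus (contour (fun w => (g w - g 0) / w ^+ 2) (corner rho) mu N) <= 8 * M / rho.
  rewrite (le_trans (@contour_le _ _ _ _ (M / rho ^+ 2) (ltW mu0) _))//.
    rewrite NE => x t /(onsq _ _ _ rho0)[xr tr rz]; rewrite cornerE.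
    rewrite modulusM modulusV expr2 modulusM.
    have M0 := gM _ _ xr tr.
    apply: ler_pM => //; first by rewrite invr_ge0 mulr_ge0.
    by rewrite lef_pV2 ?posrE ?exprn_gt0 ?mulr_gt0 ?(lt_le_trans rho0)// expr2 ler_pM ?(ltW rho0).
  by rewrite NE [leLHS](_ : _ = 8 * M / rho)//; field; rewrite gt_eqF.
have h3 := contour_inv_ge rho0 mu0 (NE rho L0).
have : d * contour (fun w => w^-1) (corner rho) mu N =
  contour (fun w => (g w - g 0) / w ^+ 2) (corner rho) mu N - contour q (corner rho) mu N.
  by rewrite -contourZ -contourB; apply: eq_contour => w; rewrite /q opprB addrC subrK.
move=> /(congr1 (@modulus R k)); rewrite modulusM => h4.
have : modulus d * 4 <= 8 * M / rho + 4 * e.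
  rewrite (le_trans (ler_wpM2l _ h3))// h4 (le_trans (modulusD _ _))// modulusN.
  exact: lerD.
by lra.
Qed.

End Goursat.

(** * Lipschitz continuity of the Jacobian *)

Section MeanValue.
Context {R : realType}.

Definition has_slope (phi : R -> R) (t d : R) := forall e : R, 0 < e ->
  exists2 r : R, 0 < r & forall s, `|s - t| < r ->
    `|phi s - phi t - d * (s - t)| <= e * `|s - t|.

Lemma has_slope_is_derive phi t d : has_slope phi t d -> is_derive t 1 phi d.
Proof.
move=> hd.
have cv : (fun h => h^-1 *: ((phi \o shift t) (h *: (1 : R)) - phi t)) @ 0^' --> d.
  apply/cvgrPdist_le => /= e e0; have [r r0 hr] := hd e e0.
  near=> w.
  have w0 : w != 0 by near: w; exact: nbhs_dnbhs_neq.
  have wr : `|w| < r by near: w; exact: dnbhs0_lt.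
  have := hr (w + t); rewrite addrK [w *: 1]mulr1 => /(_ wr) h.
  have -> : d - w^-1 *: (phi (w + t) - phi t) = - (w^-1 * (phi (w + t) - phi t - d * w)).
    by rewrite mulrBr mulrCA mulVf// mulr1 opprB.
  by rewrite normrN normrM normfV ler_pdivrMl ?normr_gt0// [leRHS]mulrC.
by split; [apply/cvg_ex; exists d|exact: cvg_lim].
Unshelve. all: by end_near. Qed.

Lemma mean_value_le phi (d : R -> R) K :
  (forall t, 0 <= t <= 1 -> has_slope phi t (d t)) ->
  (forall t, 0 <= t <= 1 -> `|d t| <= K) -> `|phi 1 - phi 0| <= K.
Proof.
move=> hd dK.
have [|t|t t01 ->] := @MVT_segment R phi d 0 1 ler01.
- by move=> t; rewrite in_itv/= => /andP[t0 t1]; apply/has_slope_is_derive/hd; rewrite !ltW.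
- apply: derivable_within_continuous => s; rewrite in_itv/= => s01.
  by have [] := has_slope_is_derive (hd s s01).
- by rewrite subr0 mulr1; apply: dK; move: t01; rewrite in_itv.
Qed.

Context {k : field_kind}.
Local Notation F := (field_of R k).
Local Notation "a %:F" := (@of_real R k a).

Definition curve_slope p q (G : R -> 'M[F]_(p, q)) (t : R) (D : 'M[F]_(p, q)) :=
  forall e : R, 0 < e -> exists2 r : R, 0 < r & forall s, `|s - t| < r ->
    nrm (G s - G t - (s - t)%:F *: D) <= e * `|s - t|.

(** The real mean value theorem is applied to the real and imaginary parts of each entry; the
    constant counts these parts. *)
Lemma curve_mean_value_le p q (G : R -> 'M[F]_(p, q)) (D : R -> 'M[F]_(p, q)) K :
  (forall t, 0 <= t <= 1 -> curve_slope G t (D t)) ->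
  (forall t, 0 <= t <= 1 -> nrm (D t) <= K) ->
  nrm (G 1 - G 0) <= (p * q * 2)%:R * K.
Proof.
move=> hD DK; rewrite natrM -mulrA; apply: nrm_entry_le => i j.
have part (f : F -> R) : (forall a b, f (a - b) = f a - f b) ->
    (forall s a, f (s%:F * a) = s * f a) -> (forall a, `|f a| <= modulus a) ->
    `|f ((G 1 - G 0) i j)| <= K.
  move=> fB fZ fm; rewrite !mxE fB.
  apply: (@mean_value_le (fun t => f (G t i j)) (fun t => f (D t i j))).
    move=> t t01 e e0; have [r r0 hr] := hD t t01 e e0; exists r => // s /hr h.
    rewrite -fB mulrC -fZ -fB (le_trans (fm _))// (le_trans _ h)//.
    rewrite (le_trans _ (modulus_le_nrm _ i j))//.
    by rewrite !mxE.
  move=> t t01; rewrite (le_trans (fm _))// (le_trans (modulus_le_nrm _ _ _))//.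
  exact: DK.
rewrite (le_trans (modulus_le_parts _))// [2 * K]mulr_natl mulr2n lerD//; apply: part.
- exact: rpartB.
- exact: rpartZ.
- exact: rpart_le.
- exact: ipartB.
- exact: ipartZ.
- exact: ipart_le.
Qed.

Lemma line_curve_slope m p q (f : 'cV[F]_m -> 'M[F]_(p, q)) (L : 'cV[F]_m -> 'M[F]_(p, q)) x v t :
  (forall a w, L (a *: w) = a *: L w) ->
  (forall e : R, 0 < e -> exists2 d : R, 0 < d &
    forall h, nrm h < d -> nrm (f (x + t%:F *: v + h) - f (x + t%:F *: v) - L h) <= e * nrm h) ->
  curve_slope (fun s => f (x + s%:F *: v)) t (L v).
Proof.
move=> LZ hf e e0.
have v0 : 0 < nrm v + 1 by rewrite ltr_wpDl.
have [|d d0 hd] := hf (e / (nrm v + 1)); first by rewrite divr_gt0.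
exists (d / (nrm v + 1)); first by rewrite divr_gt0.
move=> s st; have E : nrm ((s - t)%:F *: v) = `|s - t| * nrm v by rewrite nrmZ modulus_of_real.
have le1 : `|s - t| * nrm v <= `|s - t| * (nrm v + 1) by rewrite ler_wpM2l// lerDl.
have pt : x + t%:F *: v + (s - t)%:F *: v = x + s%:F *: v.
  by rewrite -addrA -scalerDl -rmorphD/= addrCA subrr addr0.
have := hd ((s - t)%:F *: v); rewrite E LZ pt => /(_ _)/le_trans; apply.
  by rewrite (le_lt_trans le1)// -ltr_pdivlMr.
rewrite mulrAC ler_pdivrMr// -[leRHS]mulrA ler_wpM2l ?(ltW e0)//.
Qed.

(** The mean value inequality for t -> f (x + t v) - t B v. The matrix [B] is free: the Jacobian at
    x gives a Taylor remainder, 0 a Lipschitz bound. *)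
Lemma has_jac_mean_value m n (f : 'cV[F]_m -> 'cV[F]_n) (J : 'cV[F]_m -> 'M[F]_(n, m)) x v B K :
  (forall t, 0 <= t <= 1 -> has_jac f (x + t%:F *: v) (J (x + t%:F *: v))) ->
  (forall t, 0 <= t <= 1 -> nrm (J (x + t%:F *: v) - B) <= K) ->
  nrm (f (x + v) - f x - B *m v) <= (n * 2)%:R * (K * nrm v).
Proof.
move=> hJ JK.
have := @curve_mean_value_le n 1 (fun t => f (x + t%:F *: v) - t%:F *: (B *m v))
  (fun t => (J (x + t%:F *: v) - B) *m v) (K * nrm v).
rewrite !rmorph0 !rmorph1 !scale1r !scale0r addr0 subr0 muln1 addrAC; apply.
  move=> t t01 e e0.
  have [|r r0 hr] := @line_curve_slope _ _ _ f (mulmx (J (x + t%:F *: v))) x v t _ (hJ t t01) e e0.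
    by move=> a w; rewrite scalemxAr.
  exists r => // s /hr; congr (nrm _ <= _).
  rewrite mulmxBl; move: (J _ *m v) (B *m v) (f _) (f _) => A1 A2 A3 A4.
  by apply/matrixP => i j; rewrite !mxE rmorphB/=; ring.
move=> t t01; rewrite (le_trans (nrmM _ _))// ler_wpM2r//.
exact: JK.
Qed.

End MeanValue.

Section Smooth.
Context {R : realType}.

(** The form in which the smoothness of [f] is used later, the same over both fields. *)
Definition taylor_ball {k : field_kind} m n (f : 'cV[field_of R k]_m -> 'cV[field_of R k]_n)
    (xs : 'cV[field_of R k]_m) (d C : R) :=
  [/\ forall x, nrm (x - xs) < d -> has_jac f x (jacobian_mx f x),
      forall x y, nrm (x - xs) < d -> nrm (y - xs) < d ->
        nrm (jacobian_mx f y - jacobian_mx f x) <= C * nrm (y - x) &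
      forall x y, nrm (x - xs) < d -> nrm (y - xs) < d ->
        nrm (f y - f x - jacobian_mx f x *m (y - x)) <= C * nrm (y - x) ^+ 2].

Lemma ball_segment {k : field_kind} m (xs x y : 'cV[field_of R k]_m) (d t : R) :
  0 <= t <= 1 -> nrm (x - xs) < d -> nrm (y - xs) < d ->
  nrm (x + (of_real k t) *: (y - x) - xs) < d.
Proof.
move=> /andP[t0 t1] xd yd.
rewrite (_ : x + _ - xs = of_real k (1 - t) *: (x - xs) + of_real k t *: (y - xs)); last first.
  by apply/matrixP => i j; rewrite !mxE rmorphB rmorph1; ring.
rewrite (le_lt_trans (nrmD _ _))// !nrmZ !modulus_of_real !ger0_norm ?subr_ge0//.
have [t0'|t0'] := eqVneq t 0; first by rewrite t0' subr0 mul1r mul0r addr0.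
have tp : 0 < t by rewrite lt_def t0'.
have h1 : (1 - t) * nrm (x - xs) <= (1 - t) * d by rewrite ler_wpM2l ?subr_ge0// ltW.
have h2 : t * nrm (y - xs) < t * d by rewrite ltr_pM2l.
by lra.
Qed.

Lemma taylor_of_lipschitz {k : field_kind} m n (f : 'cV[field_of R k]_m -> 'cV[field_of R k]_n)
    (xs : 'cV[field_of R k]_m) (d C : R) : 0 <= C ->
  (forall x, nrm (x - xs) < d -> has_jac f x (jacobian_mx f x)) ->
  (forall x y, nrm (x - xs) < d -> nrm (y - xs) < d ->
     nrm (jacobian_mx f y - jacobian_mx f x) <= C * nrm (y - x)) ->
  taylor_ball f xs d ((n * 2).+1%:R * C).
Proof.
move=> C0 hJ JC; split => // x y xd yd.
  rewrite (le_trans (JC _ _ xd yd))// ler_wpM2r// ler_peMl// ler1n//.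
have := @has_jac_mean_value R k m n f (jacobian_mx f) x (y - x) (jacobian_mx f x) (C * nrm (y - x)).
have -> : x + (y - x) = y by rewrite addrC subrK.
move=> /(_ _ _)/le_trans; apply.
- by move=> t t01; apply: hJ; exact: ball_segment.
- move=> t t01; rewrite (le_trans (JC _ _ xd (ball_segment t01 xd yd)))//.
  rewrite ler_wpM2l// addrC addKr nrmZ modulus_of_real.
  by move/andP: t01 => [t0 t1]; rewrite ger0_norm// ler_piMl.
- rewrite -[X in _ * X <= _]mulrA -expr2 mulrA ler_wpM2r ?exprn_ge0// ler_wpM2r// ler_nat//.
Qed.

(** By continuity at [xs], the derivatives of the Jacobian along the basis are bounded near [xs] by
    their value there plus 1; the mean value inequality on segments turns this into a Lipschitz
    constant. *)
Lemma real_smooth_lipschitz m n (f : 'cV[field_of R RealKind]_m -> 'cV[field_of R RealKind]_n)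
    Omega xs : open Omega -> smooth Omega f -> Omega xs ->
  exists2 d : R, 0 < d & exists2 C : R, 0 <= C &
    forall x y, nrm (x - xs) < d -> nrm (y - xs) < d ->
     nrm (jacobian_mx f y - jacobian_mx f x) <= C * nrm (y - x).
Proof.
set J := jacobian_mx f.
move=> oO sm Ox.
have [d0 d00 hd0] := (openP_nrm Omega).1 oO xs Ox.
have dJ x : nrm (x - xs) < d0 -> differentiable J x by move=> /hd0 /sm[].
pose e j : 'cV[field_of R RealKind]_m := delta_mx j 0.
have : \forall x \near xs, forall j : 'I_m, nrm ('D_(e j) J x - 'D_(e j) J xs) < 1.
  have hj j : \forall x \near xs, nrm ('D_(e j) J x - 'D_(e j) J xs) < 1.
    by have [_ _ /(_ (e j)) cJ] := sm _ Ox; exact: cJ (nbhs_nrm _ ltr01).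
  exact: (filter_forall _ hj).
move=> /nbhs_nrmP[d1 d10 hd1].
pose C := \sum_j (nrm ('D_(e j) J xs) + 1).
have C0 : 0 <= C by apply: sumr_ge0 => j _; rewrite addr_ge0.
exists (Num.min d0 d1); first by rewrite lt_min d00.
exists ((n * m * 2)%:R * C); first by rewrite mulr_ge0.
move=> x y xd yd; rewrite -mulrA.
pose seg (t : R) := x + (of_real RealKind t) *: (y - x).
have segd t : 0 <= t <= 1 -> nrm (seg t - xs) < Num.min d0 d1 by move=> ?; exact: ball_segment.
have := @curve_mean_value_le R RealKind n m (fun t => J (seg t))
  (fun t => 'd J (seg t) (y - x)) (C * nrm (y - x)).
have -> : seg 1 = y by rewrite /seg rmorph1 scale1r addrC subrK.
have -> : seg 0 = x by rewrite /seg rmorph0 scale0r addr0.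
apply.
  move=> t t01; apply: (line_curve_slope (L := 'd J (seg t))); first by move=> a w; rewrite linearZ.
  have dJt : differentiable J (seg t) by apply: dJ; have := segd t t01; rewrite lt_min => /andP[].
  have /eqaddoP/nrm_o o := diff_locally dJt.
  move=> eps /o[r r0 hr]; exists r => // h /hr.
  by rewrite !fctE/= opprD addrA (addrC h).
move=> t t01; have := segd t t01; rewrite lt_min => /andP[t0 t1].
rewrite linear_col_delta /C mulr_suml.
have sumle (I : finType) (g : I -> 'M[field_of R RealKind]_(n, m)) : nrm (\sum_i g i) <= \sum_i nrm (g i).
  elim/big_ind2: _ => //; first by rewrite nrm0.
  by move=> A a B b Aa Bb; rewrite (le_trans (nrmD _ _))// lerD.
rewrite (le_trans (sumle _ _))//; apply: ler_sum => j _.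
rewrite nrmZ mulrC; apply: ler_pM => //; last exact: modulus_le_nrm.
rewrite -deriveE; last exact: dJ.
have h := hd1 _ t1 j.
have := nrmD ('D_(e j) J (seg t) - 'D_(e j) J xs) ('D_(e j) J xs).
by rewrite subrK => /le_trans; apply; rewrite addrC lerD2l ltW.
Qed.

Lemma has_jac_cdiff {k : field_kind} m n (f : 'cV[field_of R k]_m -> 'cV[field_of R k]_n)
    x v z L i : has_jac f (x + z *: v) L ->
  cdiff (fun w => f (x + w *: v) i 0) z ((L *m v) i 0).
Proof.
move=> hf e e0; have v0 : 0 < nrm v + 1 by rewrite ltr_wpDl.
have [|d d0 hd] := hf (e / (nrm v + 1)); first by rewrite divr_gt0.
exists (d / (nrm v + 1)); first by rewrite divr_gt0.
move=> w wz; have E : nrm ((w - z) *: v) = modulus (w - z) * nrm v by rewrite nrmZ.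
have le1 : modulus (w - z) * nrm v <= modulus (w - z) * (nrm v + 1) by rewrite ler_wpM2l// lerDl.
have pt : x + z *: v + (w - z) *: v = x + w *: v.
  by rewrite -addrA -scalerDl addrCA subrr addr0.
have E2 (A B u : 'cV[field_of R k]_n) a : (A - B - a *: u) i 0 = A i 0 - B i 0 - u i 0 * a.
  by rewrite !mxE (mulrC a).
have := hd ((w - z) *: v); rewrite pt -scalemxAr E => hd'.
rewrite -E2 (le_trans (modulus_le_nrm _ i 0))//; apply: (le_trans (hd' _)).
  by rewrite (le_lt_trans le1)// -ltr_pdivlMr.
by rewrite mulrAC ler_pdivrMr// -[leRHS]mulrA ler_wpM2l ?(ltW e0).
Qed.

Lemma nrm_delta {k : field_kind} m n i j : nrm (delta_mx i j : 'M[field_of R k]_(m, n)) = 1.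
Proof.
rewrite /nrm (bigD1 i)//= (bigD1 j)//= !mxE !eqxx modulus1 !big1 ?addr0// => [i' ii'|j' jj'].
  by rewrite big1// => j' _; rewrite !mxE (negbTE ii') modulus0.
by rewrite !mxE (negbTE jj') andbF modulus0.
Qed.

(** The entry (i, j) of [L] is the complex derivative at 0 of f_i along the complex line x + w e_j.
    Cauchy's estimate is used on the square of half-side r / 4, on which |w| <= r / 2. *)
Lemma jac_bound {k : field_kind} (ii : field_of R k) m n
    (f : 'cV[field_of R k]_m -> 'cV[field_of R k]_n) (x : 'cV[field_of R k]_m) L r M :
  ii * ii = -1 -> 0 < r -> has_jac f x L ->
  (forall y, nrm (y - x) < r -> exists L', has_jac f y L') ->
  (forall y, nrm (y - x) < r -> nrm (f y - f x) <= M) ->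
  nrm L <= (n * m)%:R * (2 * M / (r / 4)).
Proof.
move=> ii2 r0 hL hL' fM; apply: nrm_entry_le => i j.
pose e : 'cV[field_of R k]_m := delta_mx j 0.
have -> : L i j = (L *m e) i 0 by rewrite -colE mxE.
have near s t : `|s| <= r / 4 -> `|t| <= r / 4 ->
    nrm (x + (of_real k s + ii * of_real k t) *: e - x) < r.
  move=> sr tr; rewrite addrC addKr nrmZ nrm_delta mulr1.
  rewrite (le_lt_trans (modulus_rect_le ii2 _ _))//.
  by rewrite (le_lt_trans (lerD sr tr))//; lra.
apply: (@cauchy_estimate _ _ _ ii2 (fun w => f (x + w *: e) i 0)).
- by rewrite divr_gt0.
- by apply: has_jac_cdiff; rewrite scale0r addr0.
- move=> s t sr tr; have [L' h] := hL' _ (near s t sr tr).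
  by exists ((L' *m e) i 0); exact: has_jac_cdiff h.
- move=> s t sr tr; rewrite scale0r addr0.
  have := fM _ (near s t sr tr); apply: le_trans.
  by have := modulus_le_nrm (f (x + (of_real k s + ii * of_real k t) *: e) - f x) i 0; rewrite !mxE.
Qed.

Lemma has_jac_increment {k : field_kind} m n (f : 'cV[field_of R k]_m -> 'cV[field_of R k]_n)
    h z L L' : has_jac f z L -> has_jac f (z + h) L' ->
  has_jac (fun w => f (w + h) - f w) z (L' - L).
Proof.
move=> hL hL' e e0.
have [|a a0 ha] := hL (e / 2); first by rewrite divr_gt0.
have [|b b0 hb] := hL' (e / 2); first by rewrite divr_gt0.
exists (Num.min a b); first by rewrite lt_min a0.
move=> v; rewrite lt_min => /andP[/ha va /hb vb].
rewrite (_ : _ - _ = (f (z + h + v) - f (z + h) - L' *m v) - (f (z + v) - f z - L *m v)); last first.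
  rewrite mulmxBl (addrAC z v h); move: (L *m v) (L' *m v) (f _) (f _) (f _) (f _) => *.
  by apply/matrixP => i j; rewrite !mxE; ring.
by rewrite (le_trans (nrmB _ _))// (splitr e) mulrDl addrC lerD.
Qed.

(** Cauchy's estimate is used twice. It bounds J on the ball of radius r / 2, where f is therefore
    Lipschitz; for h = y - x the increment z -> f (z + h) - f z is then O(|h|), and the estimate
    applied to it bounds its Jacobian at x, which is J y - J x. *)
Lemma holomorphic_lipschitz {k : field_kind} (ii : field_of R k) m n
    (f : 'cV[field_of R k]_m -> 'cV[field_of R k]_n) Omega xs : ii * ii = -1 ->
  open Omega -> (forall x, Omega x -> differentiable f x) -> Omega xs ->
  exists2 d : R, 0 < d & exists2 C : R, 0 <= C &
    forall x y, nrm (x - xs) < d -> nrm (y - xs) < d ->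
     nrm (jacobian_mx f y - jacobian_mx f x) <= C * nrm (y - x).
Proof.
set J := jacobian_mx f.
move=> ii2 oO sm Ox.
have [d0 d00 hd0] := (openP_nrm Omega).1 oO xs Ox.
have hJ0 x : nrm (x - xs) < d0 -> has_jac f x (J x).
  by move=> /hd0 /sm; exact: differentiable_has_jac.
have [|d1 d10 hd1] := @has_jac_continuous _ _ _ _ f xs (J xs) _ 1 ltr01.
  by apply: hJ0; rewrite subrr nrm0.
pose r := Num.min d0 d1.
have r0 : 0 < r by rewrite lt_min d00.
have hJ x : nrm (x - xs) < r -> has_jac f x (J x).
  by rewrite lt_min => /andP[? _]; exact: hJ0.
have f1 x : nrm (x - xs) < r -> nrm (f x - f xs) <= 1.
  by rewrite lt_min => /andP[_ ?]; apply: ltW; exact: hd1.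
have in_ball (x y : 'cV[field_of R k]_m) a b c :
    nrm (x - xs) < a -> nrm (y - x) < b -> a + b <= c -> nrm (y - xs) < c.
  move=> xa yb ab; rewrite (le_lt_trans (nrm_triangle _ x _))//.
  by rewrite (lt_le_trans _ ab)// addrC ltrD.
pose K1 : R := (n * m)%:R * (2 * 2 / (r / 2 / 4)).
have JK1 x : nrm (x - xs) < r / 2 -> nrm (J x) <= K1.
  move=> xr; apply: (jac_bound ii2) => [||y yx|y yx].
  - by rewrite divr_gt0.
  - by apply: hJ; rewrite (lt_trans xr)//; lra.
  - by exists (J y); apply: hJ; apply: in_ball xr yx _; lra.
  - rewrite (le_trans (nrm_triangle _ (f xs) _))// [nrm (f xs - _)]nrmBC.
    have := f1 y; have := f1 x; move=> /(_ _) h1 /(_ _) h2.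
    have : nrm (f x - f xs) <= 1 by apply: h1; lra.
    have : nrm (f y - f xs) <= 1 by apply: h2; apply: in_ball xr yx _; lra.
    by lra.
pose K2 : R := (n * 2)%:R * K1.
have K10 : 0 <= K1 by rewrite /K1 !(mulr_ge0, divr_ge0, invr_ge0)// ltW.
have K20 : 0 <= K2 by rewrite mulr_ge0.
have fK2 x y : nrm (x - xs) < r / 2 -> nrm (y - xs) < r / 2 ->
    nrm (f y - f x) <= K2 * nrm (y - x).
  move=> xr yr.
  have := @has_jac_mean_value R k m n f J x (y - x) 0 K1.
  have -> : x + (y - x) = y by rewrite addrC subrK.
  rewrite mul0mx subr0 /K2 -mulrA; apply.
    move=> t t01; have := ball_segment t01 xr yr => h.
    by apply: hJ; rewrite (lt_trans h)//; lra.
  by move=> t t01; rewrite subr0; apply: JK1; exact: ball_segment.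
exists (r / 4); first by rewrite divr_gt0.
exists ((n * m)%:R * (2 * (2 * K2) / (r / 4 / 4))).
  by rewrite !(mulr_ge0, divr_ge0, invr_ge0)// ltW.
move=> x y xr yr.
rewrite (_ : _ * nrm (y - x) = (n * m)%:R * (2 * (2 * K2 * nrm (y - x)) / (r / 4 / 4))); last by ring.
pose h := y - x.
have zh (z : 'cV[field_of R k]_m) : nrm (z - x) < r / 4 ->
    nrm (z - xs) < r / 2 /\ nrm (z + h - xs) < r / 2.
  move=> zx; split; first by apply: in_ball xr zx _; lra.
  apply: (@in_ball y _ (r / 4) (r / 4)) => //; last by lra.
  by rewrite (_ : _ - y = z - x)// /h; apply/matrixP => i j; rewrite !mxE; ring.
have hjh z : nrm (z - x) < r / 4 -> has_jac (fun z => f (z + h) - f z) z (J (z + h) - J z).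
  by move=> /zh[z1 z2]; apply: has_jac_increment; apply: hJ; lra.
have -> : J y - J x = J (x + h) - J x by rewrite /h (addrC x) subrK.
have x0 : nrm (x - x) < r / 4 by rewrite subrr nrm0 divr_gt0.
apply: (jac_bound ii2 _ (hjh x x0)); first by rewrite divr_gt0.
  by move=> z zx; exists (J (z + h) - J z); exact: hjh.
move=> z zx; have [z1 z2] := zh z zx; have [x1 x2] := zh x x0.
rewrite -/h (_ : 2 * K2 * nrm h = K2 * nrm h + K2 * nrm h); last by ring.
rewrite (_ : _ - _ = (f (z + h) - f z) - (f (x + h) - f x)); last by [].
rewrite (le_trans (nrmB _ _))// lerD//.
  by rewrite (le_trans (fK2 _ _ z1 z2))// addrC addKr.
by rewrite (le_trans (fK2 _ _ x1 x2))// addrC addKr.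
Qed.

Lemma smooth_taylor {k : field_kind} m n (f : 'cV[field_of R k]_m -> 'cV[field_of R k]_n)
    Omega xs : open Omega -> smooth Omega f -> Omega xs ->
  exists2 d : R, 0 < d & exists2 C : R, 0 <= C &
    (forall x, nrm (x - xs) < d -> Omega x) /\ taylor_ball f xs d C.
Proof.
move=> oO sm Ox.
have [d0 d00 hd0] := (openP_nrm Omega).1 oO xs Ox.
have df x : Omega x -> differentiable f x.
  by move: sm; rewrite /smooth; case: k f Omega xs {oO d0 d00 hd0 Ox} x => f Omega xs x sm /sm // [].
have [d1 d10 [C C0 hC]] : exists2 d : R, 0 < d & exists2 C : R, 0 <= C &
    forall x y, nrm (x - xs) < d -> nrm (y - xs) < d ->
     nrm (jacobian_mx f y - jacobian_mx f x) <= C * nrm (y - x).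
  case: k f Omega xs oO sm Ox {d0 d00 hd0 df} => f Omega xs oO sm Ox.
    exact: real_smooth_lipschitz oO sm Ox.
  have ii2 : (('i)%C : field_of R ComplexKind) * ('i)%C = -1 by rewrite -expr2; exact: sqr_i.
  exact: (@holomorphic_lipschitz ComplexKind _ m n f Omega xs ii2 oO sm Ox).
exists (Num.min d0 d1); first by rewrite lt_min d00.
exists ((n * 2).+1%:R * C); first by rewrite mulr_ge0.
split; first by move=> x; rewrite lt_min => /andP[/hd0].
apply: taylor_of_lipschitz => //.
  by move=> x; rewrite lt_min => /andP[/hd0/df/differentiable_has_jac].
by move=> x y; rewrite !lt_min => /andP[_ ?] /andP[_ ?]; exact: hC.
Qed.

End Smooth.

(** * The Poincare-Miranda theorem *)

Section Kuhn.
Variables (A : comNzRingType) (n p : nat).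
Hypothesis char2 : forall x : A, x + x = 0.
Local Notation pt := ('I_n -> nat).
Implicit Types (q : pt) (j : 'I_n) (J : {set 'I_n}) (g l : pt -> A).

Definition upd (j : 'I_n) (c : nat) (q : pt) : pt := fun i => if i == j then c else q i.
Definition shift_pt (j : 'I_n) (q : pt) : pt := upd j (q j).+1 q.
(** The coboundary in direction [j]: in characteristic 2 the difference is a sum. *)
Definition fdiff j g q := g (shift_pt j q) + g q.

Lemma updC i j c c' q : i != j -> upd i c (upd j c' q) = upd j c' (upd i c q).
Proof.
move=> ij; apply/funext => x; rewrite /upd.
by case: eqP => // ->; rewrite (negbTE ij).
Qed.

Lemma upd_upd j c c' q : upd j c (upd j c' q) = upd j c q.
Proof. by apply/funext => x; rewrite /upd; case: eqP. Qed.

Lemma upd_neq i j c q : i != j -> upd j c q i = q i.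
Proof. by rewrite /upd => /negbTE ->. Qed.

Lemma upd_eq j c q : upd j c q j = c.
Proof. by rewrite /upd eqxx. Qed.

Lemma shiftC i j q : shift_pt i (shift_pt j q) = shift_pt j (shift_pt i q).
Proof.
have [->//|ij] := eqVneq i j.
apply/funext => x; rewrite /shift_pt /upd/= (negbTE ij) [j == i]eq_sym (negbTE ij).
by case: (eqVneq x i) => // ->; rewrite (negbTE ij).
Qed.

(* The cup product of the 1-cochains [fdiff _ l], for [l] in [ls], on the cube
   with lowest vertex [q] and directions [J]. *)
Fixpoint cup (ls : seq (pt -> A)) J q : A :=
  if ls is l :: ls' then \sum_(j in J) fdiff j l q * cup ls' (J :\ j) (shift_pt j q)
  else 1.

(** In characteristic 2 the terms (i, j) and (j, i) cancel. *)
Lemma sum_symmetric (S : 'I_n -> 'I_n -> A) J : (forall i j, S i j = S j i) ->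
  \sum_(i in J) \sum_(j in J :\ i) S i j = 0.
Proof.
move=> Ssym.
have -> : \sum_(i in J) \sum_(j in J :\ i) S i j =
    \sum_(i in J) \sum_(j in J | (j < i)%N) S i j + \sum_(i in J) \sum_(j in J | (i < j)%N) S i j.
  rewrite -big_split/=; apply: eq_bigr => i iJ.
  rewrite (bigID (fun j : 'I_n => (j < i)%N))/=; congr (_ + _); apply: eq_bigl => j; rewrite !inE.
    by rewrite andbAC; case: (ltngtP j i) => //=; rewrite ?andbF ?andbT// -val_eqE/= => h; rewrite ltn_eqF.
  by rewrite andbAC -leqNgt ltn_neqAle -val_eqE/= eq_sym; case: (_ \in J); rewrite ?andbT ?andbF.
rewrite [X in X + _](exchange_big_dep (fun j => j \in J))/=; last by move=> ? ? ? /andP[].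
rewrite [X in X + _](_ : _ = \sum_(i in J) \sum_(j in J | (i < j)%N) S i j) ?char2//.
by apply: eq_bigr => i iJ; rewrite iJ; apply: eq_bigr => j _; exact: Ssym.
Qed.

Lemma setD1C J i j : J :\ i :\ j = J :\ j :\ i.
Proof. by apply/setP => x; rewrite !inE andbCA. Qed.

(** A cup product of coboundaries is a cocycle. The Leibniz rule gives two sums: one contains second
    differences, symmetric in the two directions, and cancels; the other contains the coboundary of
    the shorter product and vanishes by induction. *)
Lemma cup_closed ls J q : \sum_(j in J) fdiff j (cup ls (J :\ j)) q = 0.
Proof.
elim: ls J q => [|l ls IH] J q /=; first by rewrite big1// => j _; rewrite /fdiff char2.
have -> : \sum_(j in J) fdiff j (fun q => \sum_(i in J :\ j)
      fdiff i l q * cup ls (J :\ j :\ i) (shift_pt i q)) q =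
    \sum_(j in J) \sum_(i in J :\ j)
      fdiff j (fdiff i l) q * cup ls (J :\ j :\ i) (shift_pt i (shift_pt j q)) +
    \sum_(j in J) \sum_(i in J :\ j)
      fdiff i l q * fdiff j (cup ls (J :\ i :\ j)) (shift_pt i q).
  rewrite -big_split/=; apply: eq_bigr => j jJ.
  rewrite /fdiff -!big_split/=; apply: eq_bigr => i iJ.
  rewrite (setD1C J i j) [shift_pt j (shift_pt i q)]shiftC.
  set a := l _; set b := l _; set c := l _; set d := l _.
  set w := cup _ _ _; set w' := cup _ _ _.
  have h := char2 ((c + d) * w).
  rewrite [RHS](_ : _ = (a + b) * w + (c + d) * w' + ((c + d) * w + (c + d) * w)); last by ring.
  by rewrite h addr0.
rewrite sum_symmetric ?add0r; last first.
  move=> i j; rewrite (setD1C J i j) [shift_pt j (shift_pt i q)]shiftC.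
  congr (_ * _); rewrite /fdiff [shift_pt j (shift_pt i q)]shiftC.
  by ring.
rewrite (exchange_big_dep (fun j => j \in J))/=; last by move=> ? ? _; rewrite !inE => /andP[].
rewrite big1// => i iJ.
transitivity (fdiff i l q * \sum_(j in J :\ i) fdiff j (cup ls (J :\ i :\ j)) (shift_pt i q)); last first.
  by rewrite IH mulr0.
rewrite mulr_sumr.
by apply: eq_bigl => j; rewrite !inE eq_sym iJ andbT andbC.
Qed.

Lemma cup_cons l ls J q :
  cup (l :: ls) J q = \sum_(j in J) fdiff j l q * cup ls (J :\ j) (shift_pt j q).
Proof. by []. Qed.

(** The Leibniz rule for the product of [l] with a cocycle: the term with the coboundary of the
    cocycle is zero. *)
Lemma cup_exact l ls J q :
  cup (l :: ls) J q = \sum_(j in J) fdiff j (fun q => l q * cup ls (J :\ j) q) q.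
Proof.
have -> : cup (l :: ls) J q = cup (l :: ls) J q + l q * \sum_(j in J) fdiff j (cup ls (J :\ j)) q.
  by rewrite cup_closed mulr0 addr0.
rewrite cup_cons mulr_sumr -big_split/=.
apply: eq_bigr => j _; rewrite /fdiff.
set a := l _; set w := cup _ _ _; set w' := cup _ _ _.
have h := char2 (l q * w).
by rewrite [LHS](_ : _ = a * w + l q * w' + (l q * w + l q * w)); [rewrite h addr0|ring].
Qed.

(** The coordinates outside [s] are those of [q], so this runs over the small cubes of a face of the
    box, indexed by their lowest vertices. *)
Fixpoint box_sum (s : seq 'I_n) g q : A :=
  if s is j :: s' then \sum_(t < p) box_sum s' g (upd j t q) else g q.

Lemma box_sumD s g1 g2 q : box_sum s (fun q => g1 q + g2 q) q = box_sum s g1 q + box_sum s g2 q.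
Proof.
elim: s q => //= j s IH q; rewrite -big_split/=; apply: eq_bigr => t _; exact: IH.
Qed.

Lemma box_sum_sum s (I : finType) (P : pred I) (g : I -> pt -> A) q :
  box_sum s (fun q => \sum_(i | P i) g i q) q = \sum_(i | P i) box_sum s (g i) q.
Proof.
elim: s q => //= j s IH q; rewrite exchange_big/=; apply: eq_bigr => t _; exact: IH.
Qed.

Lemma eq_box_sum s g1 g2 q : g1 =1 g2 -> box_sum s g1 q = box_sum s g2 q.
Proof. by move=> /funext ->. Qed.

Lemma box_sum0 s q : box_sum s (fun=> 0) q = 0.
Proof. by elim: s q => //= j s IH q; rewrite big1. Qed.

Lemma box_sum_upd s g j c q : j \notin s ->
  box_sum s (fun q => g (upd j c q)) q = box_sum s g (upd j c q).
Proof.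
elim: s q => //= i s IH q; rewrite inE negb_or => /andP[ji js].
by apply: eq_bigr => t _; rewrite IH// updC.
Qed.

Lemma box_sum_shift s g j q : j \notin s ->
  box_sum s (fun q => g (shift_pt j q)) q = box_sum s g (shift_pt j q).
Proof.
elim: s q => //= i s IH q; rewrite inE negb_or => /andP[ji js].
by apply: eq_bigr => t _; rewrite IH// /shift_pt updC// upd_neq.
Qed.

(** Discrete Stokes formula: telescoping along [j] leaves two opposite faces, with equal signs in
    characteristic 2. *)
Lemma box_sum_fdiff s g j q : uniq s -> j \in s ->
  box_sum s (fdiff j g) q = box_sum (rem j s) (fun q => g (upd j p q) + g (upd j 0 q)) q.
Proof.
elim: s q => //= a s IH q /andP[aS us]; rewrite inE.
have [ja _|aj /= js] := eqVneq j a; last first.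
  by apply: eq_bigr => t _; exact: IH.
rewrite -{a}ja in aS *; rewrite box_sumD !box_sum_upd// /fdiff.
suff tel c : \sum_(t < c) box_sum s (fun q => g (shift_pt j q) + g q) (upd j t q) =
    box_sum s g (upd j c q) + box_sum s g (upd j 0 q) by exact: tel.
elim: c => [|c IHc]; first by rewrite big_ord0 char2.
rewrite big_ord_recr/= IHc box_sumD box_sum_shift//.
rewrite /shift_pt upd_eq upd_upd; set a1 := box_sum _ _ _; set a2 := box_sum _ _ _; set a3 := box_sum _ _ _.
have h := char2 a1; rewrite [LHS](_ : _ = a3 + a2 + (a1 + a1)); last by ring.
by rewrite h addr0.
Qed.

Lemma box_sum_neq0 s g q : box_sum s g q != 0 -> exists q',
  [/\ forall j, j \in s -> (q' j < p)%N, forall j, j \notin s -> q' j = q j & g q' != 0].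
Proof.
elim: s q => [|j s IH] q /=; first by exists q.
move=> S0; have [t /IH[q' [h1 h2 h3]]] : exists t : 'I_p, box_sum s g (upd j t q) != 0.
  apply/existsP; rewrite -[[exists _, _]]negbK negb_exists; apply/negP => /forallP h.
  by move/negP: S0; apply; rewrite big1// => t _; have := h t; rewrite negbK => /eqP.
exists q'; split=> // i; rewrite inE.
  have [->{i} _|ij /= /h1//] := eqVneq i j.
  have [/h1//|js] := boolP (j \in s).
  by rewrite h2// upd_eq.
by rewrite negb_or => /andP[ij /h2 ->]; rewrite upd_neq.
Qed.

(** As [j] is not in [J], all vertices involved have the same j-th coordinate as [q], so the
    coboundary of [l] vanishes there. *)
Lemma cup_const ls l J q j (c : A) : List.In l ls -> j \notin J ->
  (forall q', q' j = q j -> l q' = c) -> cup ls J q = 0.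
Proof.
elim: ls J q => //= l' ls IH J q [->|lls] jJ lc; rewrite big1// => i iJ.
  have ij : j != i by apply: contraNneq jJ => ->.
  rewrite /fdiff !lc ?char2 ?mul0r// /shift_pt upd_neq//.
have ij : j != i by apply: contraNneq jJ => ->.
have -> : cup ls (J :\ i) (shift_pt i q) = 0; last by rewrite mulr0.
apply: IH => //; first by rewrite !inE negb_and jJ orbT.
by move=> q' h; apply: lc; rewrite h /shift_pt upd_neq.
Qed.

(** A non-zero term of the product selects, for every factor, an edge of the cube along which its
    label changes. *)
Lemma cup_neq0 ls J q : cup ls J q != 0 -> forall l, List.In l ls -> exists u v,
  [/\ forall i, (q i <= u i <= q i + (i \in J))%N,
      forall i, (q i <= v i <= q i + (i \in J))%N & l u != l v].
Proof.
elim: ls J q => //= l' ls IH J q C0 l.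
have [j [jJ d0 c0]] : exists j, [/\ j \in J, fdiff j l' q != 0 & cup ls (J :\ j) (shift_pt j q) != 0].
  have [j /andP[jJ h]] : exists j, (j \in J) && (fdiff j l' q * cup ls (J :\ j) (shift_pt j q) != 0).
    apply/existsP; rewrite -[[exists _, _]]negbK negb_exists; apply/negP => /forallP h.
    move/negP: C0; apply; rewrite big1// => j jJ.
    by have := h j; rewrite negb_and jJ /= negbK => /eqP.
  exists j; split=> //; first by apply: contraNneq h => ->; rewrite mul0r.
  by apply: contraNneq h => ->; rewrite mulr0.
have sh i : (q i <= shift_pt j q i <= q i + (i \in J))%N.
  rewrite /shift_pt /upd; case: eqP => [->|_]; last by rewrite leqnn leq_addr.
  by rewrite jJ leqnSn addn1 leqnn.
case=> [<-|lls].
  exists (shift_pt j q), q; split => // [i|]; first by rewrite leqnn leq_addr.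
  by apply: contraNneq d0; rewrite /fdiff => ->; rewrite char2.
have [u [v [hu hv uv]]] := IH _ _ c0 l lls.
have tr w : (forall i, (shift_pt j q i <= w i <= shift_pt j q i + (i \in J :\ j))%N) ->
    forall i, (q i <= w i <= q i + (i \in J))%N.
  move=> hw i; have /andP[h1 h2] := hw i; have /andP[h3 h4] := sh i.
  rewrite (leq_trans h3 h1) (leq_trans h2)// !inE /shift_pt /upd.
  by case: eqP => [->|_] /=; rewrite ?jJ ?addn0 ?addn1.
by exists u, v; split => //; exact: tr.
Qed.

(* By closedness the sum of the cup product over the box telescopes to the
   faces, where [lam] is prescribed: a mod 2 degree computation. *)
Lemma box_sum_cup (lam : 'I_n -> pt -> A) s q : uniq s ->
  (forall j q, q j = 0%N -> lam j q = 0) -> (forall j q, q j = p -> lam j q = 1) ->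
  box_sum s (cup (map lam s) [set j in s]) q = 1.
Proof.
move=> us lam0 lam1; elim: s q us => //= a s IH q /andP[aS us].
have sE : [set j in a :: s] :\ a = [set j in s].
  by apply/setP => j; rewrite !inE; case: eqVneq => // ->; rewrite (negbTE aS).
have -> : \sum_(t < p) box_sum s (fun q => \sum_(j in [set j in a :: s])
      fdiff j (lam a) q * cup (map lam s) ([set j in a :: s] :\ j) (shift_pt j q)) (upd a t q) =
    box_sum (a :: s) (cup (map lam (a :: s)) [set j in a :: s]) q by [].
rewrite (eq_box_sum _ _ (fun q => cup_exact _ _ _ q)) box_sum_sum.
rewrite (bigD1 a) ?inE ?eqxx//= -/(box_sum (a :: s) _ q) box_sum_fdiff ?mem_head//=; last by rewrite aS.
(* Across direction [a] the far face carries the label 1 and the near face 0, which leaves the same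
   sum in one dimension less. *)
rewrite eqxx sE (eq_box_sum _ _ (g2 := fun q => cup (map lam s) [set j in s] (upd a p q))); last first.
  by move=> q'; rewrite lam1 ?upd_eq// lam0 ?upd_eq// mul1r mul0r addr0.
rewrite box_sum_upd// IH// big1 ?addr0// => j; rewrite !inE => /andP[/orP[/eqP->|js] ja].
  by rewrite eqxx in ja.
rewrite -/(box_sum (a :: s) _ q) box_sum_fdiff ?inE ?js ?orbT//=; last by rewrite aS.
(* Across any other direction [j], the label [lam j] is constant on both faces and still occurs in
   the product, which vanishes. *)
rewrite (eq_box_sum _ _ (g2 := fun=> 0)) ?box_sum0// => q'.
have lj : List.In (lam j) (map lam s).
  elim: (s) js => //= b s' IHs; rewrite inE => /orP[/eqP->|/IHs]; [by left|by right].
rewrite (@cup_const _ (lam j) _ _ j 1) ?mulr0 ?add0r//; last 2 first.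
- by rewrite !inE eqxx.
- by move=> q'' ; rewrite upd_eq => /lam1.
rewrite (@cup_const _ (lam j) _ _ j 0) ?mulr0//; first by rewrite !inE eqxx.
by move=> q'' ; rewrite upd_eq => /lam0.
Qed.

End Kuhn.

(** The sum over the box is 1 in the field with two elements, so some cube has a non-zero product;
    every label takes both values on its vertices. *)
Lemma kuhn_cube n p (lam : 'I_n -> ('I_n -> nat) -> bool) :
  (forall j q, q j = 0%N -> lam j q = false) -> (forall j q, q j = p -> lam j q = true) ->
  exists q, (forall j, (q j < p)%N) /\ forall j, exists u v,
    [/\ forall i, (q i <= u i <= (q i).+1)%N,
        forall i, (q i <= v i <= (q i).+1)%N & lam j u != lam j v].
Proof.
move=> lam0 lam1.
have char2 (x : 'F_2) : x + x = 0 by apply/eqP; case: x => -[|[|//]].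
pose mu j q : 'F_2 := (lam j q)%:R.
have : box_sum p (enum 'I_n) (cup (map mu (enum 'I_n)) [set j in enum 'I_n]) (fun=> 0%N) != 0.
  rewrite (box_sum_cup char2) ?oner_neq0 ?enum_uniq// => j q h; first by rewrite /mu lam0.
  by rewrite /mu lam1.
move=> /box_sum_neq0[q [qp _ /(cup_neq0 char2) h]].
exists q; split=> [j|j]; first by apply: qp; rewrite mem_enum.
have [|u [v [hu hv uv]]] := h (mu j).
  elim: (enum 'I_n) (mem_enum 'I_n j) => //= b s IH; rewrite inE => /orP[/eqP->|/IH]; [by left|by right].
exists u, v; split => [i|i|].
- by have := hu i; rewrite inE mem_enum addn1.
- by have := hv i; rewrite inE mem_enum addn1.
- by apply: contraNneq uv; rewrite /mu => ->.
Qed.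

Section Miranda.
Context {R : realType}.

Lemma cube_cluster n (rho : R) (c : nat -> 'rV[R]_n) :
  (forall N i, `|c N 0 i| <= rho) ->
  exists x : 'rV[R]_n, (forall i, `|x 0 i| <= rho) /\
    forall N (e : R), 0 < e -> exists2 M, (N <= M)%N & forall i, `|c M 0 i - x 0 i| < e.
Proof.
move=> c_rho.
pose A := [set v : 'rV[R]_n | forall i, `[- rho, rho]%classic (v ord0 i)].
have cA : compact A.
  by apply: (@rV_compact R n (fun=> `[- rho, rho]%classic)) => i; exact: segment_compact.
have [|x [Ax cx]] := cA (c @ \oo) _.
  by exists 0%N => // N _ i /=; rewrite in_itv/= -ler_norml.
exists x; split=> [i|N e e0].
  by have := Ax i; rewrite /= in_itv/= -ler_norml.
have cN : (c @ \oo) [set c M | M in [set M | (N <= M)%N]].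
  by exists N => // M NM; exists M.
have bx : nbhs x (ball x e) by exact: nbhsx_ballx.
have [_ [[M NM <-] [_ cxM]]] := cx _ _ cN bx.
by exists M => // i; have := cxM 0 i; rewrite /ball/= distrC.
Qed.

(** On grids of mesh 2 rho / (p + 1), [kuhn_cube] yields a cube on which every component of [g] is
    both >= 0 and <= 0; by continuity [g] vanishes at a cluster point of these cubes. *)
Lemma miranda n (rho : R) (g : 'cV[R]_n -> 'cV[R]_n) : 0 < rho ->
  (forall x : 'cV[R]_n, (forall i, `|x i 0| <= rho) -> forall e : R, 0 < e -> exists2 d : R, 0 < d &
     forall y : 'cV[R]_n, (forall i, `|y i 0| <= rho) -> (forall i, `|y i 0 - x i 0| < d) ->
       forall i, `|g y i 0 - g x i 0| < e) ->
  (forall (x : 'cV[R]_n) i, (forall j, `|x j 0| <= rho) -> x i 0 = - rho -> g x i 0 <= 0) ->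
  (forall (x : 'cV[R]_n) i, (forall j, `|x j 0| <= rho) -> x i 0 = rho -> 0 <= g x i 0) ->
  exists x : 'cV[R]_n, (forall i, `|x i 0| <= rho) /\ g x = 0.
Proof.
move=> rho0 cg gl gr.
pose P p (q : 'I_n -> nat) : 'cV[R]_n := \col_i (2 * rho * (q i)%:R / p.+1%:R - rho).
have PE p q i : P p q i 0 = 2 * rho * (q i)%:R / p.+1%:R - rho by rewrite mxE.
have Pin p q i : (q i <= p.+1)%N -> `|P p q i 0| <= rho.
  move=> qp; rewrite PE ler_norml.
  have h0 : 0 <= 2 * rho * (q i)%:R / p.+1%:R by rewrite !(divr_ge0, mulr_ge0)// ltW.
  have h1 : 2 * rho * (q i)%:R / p.+1%:R <= 2 * rho.
    by rewrite ler_pdivrMr// ler_wpM2l ?ler_nat// mulr_ge0// ltW.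
  move: (_ / _) h0 h1 => y h0 h1.
  by apply/andP; split; lra.
(* Positivity of the j-th component, overridden on the two faces: the sign conditions there are weak
   and do not determine the label. *)
pose lam p (j : 'I_n) (q : 'I_n -> nat) :=
  (q j != 0%N) && ((p.+1 <= q j)%N || (0 < g (P p q) j 0)).
have /choice[q hq] : forall p, exists q : 'I_n -> nat, (forall j, (q j < p.+1)%N) /\
    forall j, exists u v, [/\ forall i, (q i <= u i <= (q i).+1)%N,
      forall i, (q i <= v i <= (q i).+1)%N & lam p j u != lam p j v].
  by move=> p; apply: kuhn_cube => j q h; rewrite /lam h ?eqxx ?leqnn.
have /choice[uv huv] : forall pj : nat * 'I_n, exists uv : ('I_n -> nat) * ('I_n -> nat),
    [/\ forall i, (q pj.1 i <= uv.1 i <= (q pj.1 i).+1)%N,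
        forall i, (q pj.1 i <= uv.2 i <= (q pj.1 i).+1)%N,
        lam pj.1 pj.2 uv.1 & ~~ lam pj.1 pj.2 uv.2].
  move=> [p j]; have [_ /(_ j)[u [v [hu hv uv]]]] := hq p.
  case lu : (lam p j u) uv; case lv : (lam p j v) => // _.
    by exists (u, v); rewrite /= lu lv.
  by exists (v, u); rewrite /= lu lv.
have [x [xrho xc]] : exists x : 'rV[R]_n, (forall i, `|x 0 i| <= rho) /\
    forall N (e : R), 0 < e -> exists2 M, (N <= M)%N & forall i, `|(P M (q M))^T 0 i - x 0 i| < e.
  by apply: cube_cluster => N i; rewrite mxE Pin// ltnW//; have [->] := hq N.
have xrhoT i : `|x^T i 0| <= rho by rewrite mxE.
exists x^T; split=> //; apply/matrixP => j z; rewrite ord1 mxE {z}; apply/eqP.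
rewrite -normr_eq0 eq_le normr_ge0 andbT; apply/ler_addgt0Pr => e e0; rewrite add0r.
have [d d0 hd] := cg _ xrhoT _ e0.
have d20 : 0 < d / 2 by rewrite divr_gt0.
have [p Np hp] := xc (Num.bound (2 * rho / (d / 2))) _ d20.
have small : 2 * rho / p.+1%:R < d / 2.
  rewrite ltr_pdivrMr// -ltr_pdivrMl// [_^-1 * _]mulrC (lt_le_trans (archi_boundP _))//.
    by rewrite !(divr_ge0, mulr_ge0)// ltW.
  by rewrite ler_nat ltnW.
have near w : (forall i, (q p i <= w i <= (q p i).+1)%N) ->
    (forall i, `|P p w i 0| <= rho) /\ `|g (P p w) j 0 - g x^T j 0| < e.
  move=> hw; have wrho i : `|P p w i 0| <= rho.
    apply: Pin; have /andP[_ h] := hw i; apply: leq_trans h _.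
    by have [h _] := hq p; exact: h.
  split=> //; apply: hd => // i; have := hp i; rewrite !mxE => h.
  have : `|P p w i 0 - P p (q p) i 0| <= 2 * rho / p.+1%:R.
    rewrite !PE opprB addrA subrK -mulrBl -mulrBr normrM normrM normfV.
    rewrite (ger0_norm (_ : 0 <= 2 * rho)) ?mulr_ge0 ?(ltW rho0)// normr_nat ler_wpM2r ?invr_ge0//.
    have /andP[h1 h2] := hw i; rewrite ler_piMr ?mulr_ge0 ?(ltW rho0)//.
    by rewrite -natrB// normr_nat -[leRHS]/(1%:R) ler_nat leq_subLR addn1.
  rewrite !PE => h'; rewrite (_ : _ - x 0 i = (2 * rho * (w i)%:R / p.+1%:R - rho - (2 * rho * (q p i)%:R / p.+1%:R - rho)) + (2 * rho * (q p i)%:R / p.+1%:R - rho - x 0 i)); last by ring.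
  by rewrite (le_lt_trans (ler_normD _ _))// (splitr d) ltrD//; exact: le_lt_trans h' small.
have [hu hv lu lv] := huv (p, j).
have [urho ue] := near _ hu; have [vrho ve] := near _ hv.
have gu : 0 <= g (P p (uv (p, j)).1) j 0.
  case/andP: lu => _ /orP[pu|/ltW//]; apply: gr => //.
  have -> : P p (uv (p, j)).1 j 0 = 2 * rho * ((uv (p, j)).1 j)%:R / p.+1%:R - rho by exact: PE.
  have -> : (uv (p, j)).1 j = p.+1.
    apply/eqP; rewrite eqn_leq pu andbT; have /andP[_ h] := hu j; apply: leq_trans h _.
    by have [h _] := hq p; exact: h.
  by rewrite mulfK ?pnatr_eq0// mulr_natl mulr2n addrK.
have gv : g (P p (uv (p, j)).2) j 0 <= 0.
  move: lv; rewrite negb_and negbK negb_or -leNgt => /orP[/eqP v0|/andP[_]//].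
  by apply: gl => //; rewrite PE v0 mulr0 mul0r sub0r.
move: ue ve; rewrite !ltr_norml => /andP[u1 u2] /andP[v1 v2].
by rewrite ler_norml; apply/andP; split; lra.
Qed.

End Miranda.

(** * Local surjectivity where the derivative is invertible *)

Section LocalOnto.
Context {R : realType}.

(** Strict differentiability at [xs]. In the factor 3, 2 comes from |y - x| <= 2 r in the Taylor
    remainder and 1 from replacing the Jacobian at x by the one at [xs]. *)
Lemma taylor_strict {k : field_kind} m n (f : 'cV[field_of R k]_m -> 'cV[field_of R k]_n)
    xs (d C r : R) : 0 <= C -> taylor_ball f xs d C -> r <= d ->
  forall x y, nrm (x - xs) < r -> nrm (y - xs) < r ->
    nrm (f y - f x - jacobian_mx f xs *m (y - x)) <= 3 * C * r * nrm (y - x).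
Proof.
move=> C0 [_ JC fC] rd x y xr yr.
have xd := lt_le_trans xr rd; have yd := lt_le_trans yr rd.
have xsd : nrm (xs - xs) < d by rewrite subrr nrm0 (le_lt_trans _ xd).
have -> : f y - f x - jacobian_mx f xs *m (y - x) =
    (f y - f x - jacobian_mx f x *m (y - x)) + (jacobian_mx f x - jacobian_mx f xs) *m (y - x).
  rewrite mulmxBl; move: (jacobian_mx f x *m _) (jacobian_mx f xs *m _) => *.
  by apply/matrixP => i j; rewrite !mxE; ring.
rewrite (le_trans (nrmD _ _))// (le_trans (lerD (fC _ _ xd yd) (nrmM _ _)))//.
have h1 := JC _ _ xsd xd.
have yx : nrm (y - x) <= 2 * r.
  by rewrite (le_trans (nrm_triangle _ xs _))// [nrm (xs - x)]nrmBC; lra.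
have h2 : nrm (jacobian_mx f x - jacobian_mx f xs) <= C * r.
  by rewrite (le_trans h1)// ler_wpM2l// ltW.
have h3 : C * nrm (y - x) <= C * (2 * r) by rewrite ler_wpM2l.
rewrite expr2 mulrA -mulrDl ler_wpM2r//; lra.
Qed.

(* [g] is only assumed differentiable near [u0], not continuously so: the
   inverse function theorem does not apply, and Miranda's theorem is used. *)
Lemma real_local_onto d (g : 'cV[field_of R RealKind]_d -> 'cV[field_of R RealKind]_d) u0 r L :
  0 < r -> (forall u, nrm (u - u0) < r -> exists L, has_jac g u L) -> has_jac g u0 L ->
  L \in unitmx -> forall e : R, 0 < e -> exists2 rho : R, 0 < rho &
    forall z, nrm (z - g u0) < rho -> exists2 u, nrm (u - u0) < e & g u = z.
Proof.
move=> r0 dg gL Lu e e0; set B := invmx L.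
have BL x : B *m (L *m x) = x :> 'cV_d by rewrite mulmxA mulVmx// mul1mx.
have b0 : 0 < nrm B + 1 by rewrite ltr_wpDl.
have c0 : 0 < d.+1%:R :> R by [].
have [|s s0 hs] := gL (((nrm B + 1) * d.+1%:R * 2)^-1); first by rewrite invr_gt0 !mulr_gt0.
(* The divisor makes the cube of half-side rho' fit in the [nrm] balls of radii r, s and e. *)
pose rho' := Num.min r (Num.min s e) / (2 * d.+1%:R).
have m0 : 0 < Num.min r (Num.min s e) by rewrite !lt_min r0 s0.
have rho'0 : 0 < rho' by rewrite divr_gt0// mulr_gt0.
have cube (x : 'cV[field_of R RealKind]_d) : (forall i, `|x i 0 : R| <= rho') -> nrm x <= d.+1%:R * rho' /\ d.+1%:R * rho' < Num.min r (Num.min s e).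
  move=> hx; split.
    have h : nrm x <= (d * 1)%:R * rho' by apply: nrm_entry_le => i j; rewrite (ord1 j); exact: hx.
    by rewrite (le_trans h)// ler_wpM2r ?(ltW rho'0)// ler_nat muln1.
  rewrite /rho' mulrA ltr_pdivrMr ?mulr_gt0// mulrC ltr_pM2l//.
  by rewrite -[ltLHS]mul1r ltr_pM2r// ltr1n.
have cubelt (x : 'cV[field_of R RealKind]_d) : (forall i, `|x i 0 : R| <= rho') -> [/\ nrm x < r, nrm x < s & nrm x < e].
  by move=> /cube[h1 h2]; have := le_lt_trans h1 h2; rewrite !lt_min => /andP[? /andP[]].
exists (rho' / (2 * (nrm B + 1))); first by rewrite divr_gt0// mulr_gt0.
move=> z zr.
(* Normalized by the inverse derivative, [G] stays within rho' of the identity on the cube, which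
   gives the sign conditions on its faces. *)
pose G (x : 'cV[field_of R RealKind]_d) := B *m (g (u0 + x) - z).
have GE (x : 'cV[field_of R RealKind]_d) : (forall i, `|x i 0 : R| <= rho') -> nrm (G x - x) <= rho'.
  move=> hx; have [xr xs xe] := cubelt _ hx; have [xle _] := cube _ hx.
  have -> : G x - x = B *m (g (u0 + x) - g u0 - L *m x) - B *m (z - g u0).
    rewrite -{2}(BL x) /G -!mulmxBr; congr (_ *m _); move: (L *m x) => y.
    by apply/matrixP => i j; rewrite !mxE; ring.
  rewrite (le_trans (nrmB _ _))// (le_trans (lerD (nrmM _ _) (nrmM _ _)))//.
  have h1 : nrm B * nrm (g (u0 + x) - g u0 - L *m x) <= rho' / 2.
    rewrite (@le_trans _ _ ((nrm B + 1) * (((nrm B + 1) * d.+1%:R * 2)^-1 * (d.+1%:R * rho'))))//.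
      apply: ler_pM => //; first by rewrite lerDl.
      by rewrite (le_trans (hs x xs))// ler_wpM2l// invr_ge0 !mulr_ge0// ltW.
    have b1 : nrm B + 1 != 0 by rewrite gt_eqF.
    have d1 : d.+1%:R != 0 :> R by rewrite pnatr_eq0.
    rewrite [leLHS](_ : _ = rho' / 2)//; move: (d.+1%:R : R) d1 => D D0.
    by field; rewrite b1 D0.
  have h2 : nrm B * nrm (z - g u0) <= rho' / 2.
    rewrite (@le_trans _ _ ((nrm B + 1) * (rho' / (2 * (nrm B + 1)))))//.
      by apply: ler_pM => //; [rewrite lerDl|exact: ltW].
    have b1 : nrm B + 1 != 0 by rewrite gt_eqF.
    by rewrite [leLHS](_ : _ = rho' / 2)//; field.
  by lra.
have GEi (x : 'cV[field_of R RealKind]_d) i : (forall i, `|x i 0 : R| <= rho') -> `|(G x i 0 : R) - x i 0| <= rho'.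
  move=> hx; rewrite (le_trans _ (GE x hx))//.
  by have := modulus_le_nrm (G x - x) i 0; rewrite !mxE.
have [|x i hx xi|x i hx xi|x [hx Gx0]] := @miranda R d rho' G rho'0.
- move=> x hx eps eps0; have [xr _ _] := cubelt _ hx.
  have [|L' hL'] := dg (u0 + x); first by rewrite addrC addKr.
  have [|t t0 ht] := @has_jac_continuous _ _ _ _ g (u0 + x) L' hL' (eps / (nrm B + 1)).
    by rewrite divr_gt0.
  exists (t / d.+1%:R); first by rewrite divr_gt0.
  move=> y hy yx i.
  have yx' : nrm (u0 + y - (u0 + x)) < t.
    rewrite opprD addrACA subrr add0r.
    have h : @nrm R RealKind d 1 (y - x) <= (d * 1)%:R * (t / d.+1%:R).
      by apply: nrm_entry_le => i' j; rewrite (ord1 j) !mxE; apply: ltW; exact: yx.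
    apply: (le_lt_trans h); rewrite muln1 mulrCA -ltr_pdivlMl// mulVf ?gt_eqF//.
    by rewrite ltr_pdivrMr// mul1r ltr_nat.
  have := ht _ yx' => gyx.
  have -> : `|G y i 0 - G x i 0| = @modulus R RealKind ((G y - G x) i 0) by rewrite !mxE.
  rewrite (le_lt_trans (modulus_le_nrm _ _ _))// /G -mulmxBr (le_lt_trans (nrmM _ _))//.
  rewrite opprB addrA subrK (@le_lt_trans _ _ ((nrm B + 1) * nrm (g (u0 + y) - g (u0 + x))))//.
    by rewrite ler_wpM2r// lerDl.
  by rewrite mulrC -ltr_pdivlMr.
- by have := GEi x i hx; rewrite xi ler_norml => /andP[_]; lra.
- by have := GEi x i hx; rewrite xi ler_norml => /andP[+ _]; lra.
exists (u0 + x); first by rewrite addrC addKr; have [] := cubelt _ hx.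
apply/eqP; rewrite -subr_eq0; apply/eqP.
by rewrite -[LHS]mul1mx -(mulmxV Lu) -mulmxA -/B -/(G x) Gx0 mulmx0.
Qed.

(** The map x -> x - B (g (u0 + x) - z), with B the inverse derivative, is a contraction of factor
    1/2 on a ball small enough for [taylor_strict]; its fixed point solves the equation. *)
Lemma strict_local_onto {k : field_kind} d (g : 'cV[field_of R k]_d -> 'cV[field_of R k]_d) u0 (r C : R) :
  0 < r -> 0 <= C -> taylor_ball g u0 r C -> jacobian_mx g u0 \in unitmx ->
  forall e : R, 0 < e -> exists2 rho : R, 0 < rho &
    forall z, nrm (z - g u0) < rho -> exists2 u, nrm (u - u0) < e & g u = z.
Proof.
move=> r0 C0 tg; set L := jacobian_mx g u0 => Lu e e0; set B := invmx L.
have b0 : 0 < nrm B + 1 by rewrite ltr_wpDl.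
pose s := Num.min (Num.min r e) (6 * (C + 1) * (nrm B + 1))^-1.
have C10 : 0 < C + 1 by rewrite ltr_wpDl.
have s0 : 0 < s by rewrite !lt_min r0 e0 invr_gt0 !mulr_gt0.
have sr : s <= r by rewrite /s !ge_min lexx.
have se : s <= e by rewrite /s !ge_min lexx orbT.
have sB : (nrm B + 1) * (3 * (C + 1) * s) <= 2^-1.
  have : s <= (6 * (C + 1) * (nrm B + 1))^-1 by rewrite /s ge_min lexx orbT.
  by rewrite -div1r ler_pdivlMr ?mulr_gt0//; lra.
exists (s / (2 * (nrm B + 1))); first by rewrite divr_gt0// mulr_gt0.
move=> z zs; pose T x := x - B *m (g (u0 + x) - z).
have [||w [ws Tw]] := @contraction_fixpoint R k d T s.
- move=> x y xs ys.
  have -> : T x - T y = - (B *m (g (u0 + x) - g (u0 + y) - L *m (u0 + x - (u0 + y)))).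
    rewrite mulmxBr [B *m (L *m _)]mulmxA mulVmx// mul1mx /T !mulmxBr.
    move: (B *m _) (B *m _) (B *m _) => *.
    by apply/matrixP => i j; rewrite !mxE; ring.
  rewrite nrmN (le_trans (nrmM _ _))//.
  have := taylor_strict C0 tg sr (x := u0 + y) (y := u0 + x).
  rewrite ![u0 + _]addrC !addrK -/L => /(_ ys xs) h.
  have -> : x - y = x + u0 - (y + u0) by rewrite opprD addrACA subrr addr0.
  rewrite (@le_trans _ _ ((nrm B + 1) * (3 * (C + 1) * s * nrm (x + u0 - (y + u0)))))//.
    apply: ler_pM => //; first by rewrite lerDl.
    rewrite (le_trans h)// ler_wpM2r// ler_wpM2r ?(ltW s0)// ler_wpM2l// lerDl//.
  by rewrite mulrA ler_wpM2r.
- rewrite /T addr0 sub0r nrmN.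
  have h : nrm (B *m (g u0 - z)) <= (nrm B + 1) * nrm (z - g u0).
    by rewrite (le_trans (nrmM _ _))// nrmBC ler_wpM2r// lerDl.
  have : (nrm B + 1) * nrm (z - g u0) < (nrm B + 1) * (s / (2 * (nrm B + 1))) by rewrite ltr_pM2l.
  rewrite [X in _ < X](_ : _ = s / 2); last first.
    by field; rewrite gt_eqF.
  by lra.
exists (u0 + w).
  rewrite addrC addKr (le_lt_trans ws)//.
  rewrite /T addr0 sub0r nrmN.
  have h : nrm (B *m (g u0 - z)) <= (nrm B + 1) * nrm (z - g u0).
    by rewrite (le_trans (nrmM _ _))// nrmBC ler_wpM2r// lerDl.
  have : (nrm B + 1) * nrm (z - g u0) < (nrm B + 1) * (s / (2 * (nrm B + 1))) by rewrite ltr_pM2l.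
  rewrite [X in _ < X](_ : _ = s / 2); last first.
    by field; rewrite gt_eqF.
  by lra.
apply/eqP; rewrite -subr_eq0; apply/eqP.
rewrite -[LHS]mul1mx -(mulmxV Lu) -mulmxA -/B.
have -> : B *m (g (u0 + w) - z) = 0; last by rewrite mulmx0.
by apply/eqP; rewrite -oppr_eq0 -(inj_eq (addrI w)) addr0; apply/eqP.
Qed.

Lemma local_onto {k : field_kind} d (g : 'cV[field_of R k]_d -> 'cV[field_of R k]_d) Omega u0 :
  open Omega -> Omega u0 -> (forall u, Omega u -> differentiable g u) ->
  jacobian_mx g u0 \in unitmx ->
  forall e : R, 0 < e -> exists2 rho : R, 0 < rho &
    forall z, nrm (z - g u0) < rho -> exists2 u, nrm (u - u0) < e & g u = z.
Proof.
move=> oO Ou dg Lu.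
have [r r0 hr] := (openP_nrm Omega).1 oO u0 Ou.
case: k g Omega u0 oO Ou dg Lu r0 hr => g Omega u0 oO Ou dg Lu r0 hr.
  apply: real_local_onto r0 _ _ Lu.
    by move=> u /hr/dg/differentiable_has_jac; eexists; eassumption.
  exact/differentiable_has_jac/dg.
have [d0 d00 [C C0 [_ tg]]] := @smooth_taylor R ComplexKind d d g Omega u0 oO dg Ou.
exact: strict_local_onto d00 C0 tg Lu.
Qed.

End LocalOnto.

(** * Singular values and pseudo-inverses *)

Section SVD.
Context {R : realType}.

Section Generic.
Context {k : field_kind}.
Local Notation F := (field_of R k).
Local Notation "a %:F" := (@of_real R k a).

Lemma adjointE m n (A : 'M[F]_(m, n)) i j : adjoint A i j = conjugate (A j i).
Proof. by rewrite !mxE. Qed.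

Lemma adjointM m n p (A : 'M[F]_(m, n)) (B : 'M[F]_(n, p)) :
  adjoint (A *m B) = adjoint B *m adjoint A.
Proof. by rewrite /adjoint map_mxM trmx_mul. Qed.

Lemma adjointK m n (A : 'M[F]_(m, n)) : adjoint (adjoint A) = A.
Proof. by apply/matrixP => i j; rewrite !adjointE conjugateK. Qed.

Lemma adjoint1 n : adjoint (1%:M : 'M[F]_n) = 1%:M.
Proof. by rewrite /adjoint map_mx1 trmx1. Qed.

Lemma adjointZ m n a (A : 'M[F]_(m, n)) : adjoint (a *: A) = conjugate a *: adjoint A.
Proof. by apply/matrixP => i j; rewrite !mxE rmorphM. Qed.

Lemma adjoint_row m n p (A : 'M[F]_(m, n)) (B : 'M[F]_(m, p)) :
  adjoint (row_mx A B) = col_mx (adjoint A) (adjoint B).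
Proof. by rewrite /adjoint map_row_mx tr_row_mx. Qed.

Lemma adjoint_diag n (s : 'rV[R]_n) :
  adjoint (diag_mx (map_mx (@of_real R k) s)) = diag_mx (map_mx (@of_real R k) s).
Proof.
apply/matrixP => i j; rewrite adjointE !mxE rmorphMn/= conjugate_of_real eq_sym.
by case: eqP => // ->.
Qed.

Lemma nrm_adjoint m n (A : 'M[F]_(m, n)) : nrm (adjoint A) = nrm A.
Proof.
rewrite /nrm exchange_big/=; do 2!apply: eq_bigr => ? _.
by rewrite adjointE modulus_conjugate.
Qed.

Lemma adjoint_mulE m n (A : 'M[F]_(m, n)) j :
  (adjoint A *m A) j j = (\sum_i modulus (A i j) ^+ 2)%:F.
Proof.
rewrite mxE rmorph_sum; apply: eq_bigr => i _.
by rewrite adjointE mulrC mul_conjugate.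
Qed.

Lemma adjoint_mul_eq0 m n (A : 'M[F]_(m, n)) : adjoint A *m A = 0 -> A = 0.
Proof.
move=> A0; apply/matrixP => i j; have := adjoint_mulE A j.
rewrite A0 !mxE => /esym/eqP; rewrite fmorph_eq0 psumr_eq0; last by move=> *; exact: sqr_ge0.
by move=> /allP/(_ i (mem_index_enum _)) /=; rewrite expf_eq0 modulus_eq0 => /eqP.
Qed.

Lemma exists_unit_scaling m (w : 'cV[F]_m) : w != 0 ->
  exists a : R, adjoint (a%:F *: w) *m (a%:F *: w) = 1%:M.
Proof.
move=> w0; set N := \sum_i modulus (w i 0) ^+ 2.
have N0 : 0 < N.
  rewrite lt_def sumr_ge0 ?andbT; last by move=> *; exact: sqr_ge0.
  apply: contraNneq w0 => N0; apply/eqP/adjoint_mul_eq0/matrixP => i j.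
  by rewrite !ord1 adjoint_mulE -/N N0 rmorph0 mxE.
exists (Num.sqrt N)^-1; apply/matrixP => i j; rewrite !ord1.
rewrite adjointZ conjugate_of_real -scalemxAl -scalemxAr scalerA [LHS]mxE adjoint_mulE -/N.
rewrite -!rmorphM/= -invfM -expr2 sqr_sqrtr ?(ltW N0)// mulVf ?gt_eqF// rmorph1.
by rewrite !mxE eqxx.
Qed.

Lemma exists_kernel p q (B : 'M[F]_(p, q)) : (\rank B < q)%N ->
  exists2 c : 'cV[F]_q, c != 0 & B *m c = 0.
Proof.
move=> rB; have K0 : kermx B^T != 0.
  by rewrite kermx_eq0 /row_free mxrank_tr ltn_eqF.
exists (nz_row (kermx B^T))^T; first by rewrite trmx_eq0 nz_row_eq0.
apply: trmx_inj; rewrite trmx_mul trmxK trmx0; apply/sub_kermxP.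
exact: nz_row_sub.
Qed.

Lemma exists_orthogonal m p (V : 'M[F]_(m, p)) : (p < m)%N ->
  exists2 w : 'cV[F]_m, adjoint V *m w = 0 & adjoint w *m w = 1%:M.
Proof.
move=> pm; have [|c c0 Vc] := @exists_kernel _ _ (adjoint V).
  exact: leq_ltn_trans (rank_leq_row _) pm.
have [a ha] := exists_unit_scaling c0.
by exists (a%:F *: c) => //; rewrite -scalemxAr Vc scaler0.
Qed.

(** If H^(d+2) = 0, then X = H^(d+1) satisfies adjoint X X = H^(2d+2) = 0, hence X = 0; the exponent
    descends one by one. *)
Lemma selfadjoint_nilpotent m (H : 'M[F]_m.+1) d : adjoint H = H -> H ^+ d.+1 = 0 -> H = 0.
Proof.
move=> HH; have adjX e : adjoint (H ^+ e) = H ^+ e.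
  elim: e => [|e IH]; first by rewrite expr0 adjoint1.
  by rewrite {1}exprS -mulmxE adjointM IH HH mulmxE -exprSr.
elim: d => [|d IH Hd]; first by rewrite expr1.
apply: IH; apply: adjoint_mul_eq0; rewrite adjX mulmxE -exprD.
by rewrite -addSnnS exprD Hd mul0r.
Qed.

(* The eigenvalue is automatically real and positive. *)
Lemma eigen_normalize n m (B : 'M[F]_(n, m)) (w : 'cV[F]_m) a : w != 0 -> a != 0 ->
  adjoint B *m B *m w = a *: w ->
  exists (l : R) (v : 'cV[F]_m), [/\ 0 < l, adjoint v *m v = 1%:M & adjoint B *m B *m v = l%:F *: v].
Proof.
move=> w0 a0 Hw; have [c hc] := exists_unit_scaling w0.
have : adjoint B *m B *m (c%:F *: w) = a *: (c%:F *: w).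
  by rewrite -scalemxAr Hw !scalerA mulrC.
move: (c%:F *: w) hc => v hc Hv {w w0 Hw}.
have aE : a = (\sum_i modulus ((B *m v) i 0) ^+ 2)%:F.
  have := congr1 (fun M => (adjoint v *m M) 0 0) Hv.
  rewrite -scalemxAr hc => h.
  by rewrite -adjoint_mulE adjointM -mulmxA [adjoint B *m _]mulmxA h !mxE eqxx mulr1.
exists (\sum_i modulus ((B *m v) i 0) ^+ 2), v; split => //; last by rewrite -aE.
rewrite lt_def sumr_ge0 ?andbT; last by move=> *; exact: sqr_ge0.
by apply: contraNneq a0; rewrite aE => ->; rewrite rmorph0.
Qed.

End Generic.

(** If all eigenvalues of H = adjoint B B were 0, its characteristic polynomial would be a power of
    X, so H would be nilpotent by Cayley-Hamilton, hence 0, being self-adjoint. *)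
Lemma complex_eigen n m (B : 'M[field_of R ComplexKind]_(n, m)) : B != 0 ->
  exists (w : 'cV[field_of R ComplexKind]_m) a,
    [/\ w != 0, a != 0 & adjoint B *m B *m w = a *: w].
Proof.
case: m B => [|m] B B0; first by rewrite thinmx0 eqxx in B0.
set H := adjoint B *m B.
have HH : adjoint H = H by rewrite /H adjointM adjointK.
have H0 : H != 0 by apply: contraNneq B0 => /adjoint_mul_eq0 ->.
(* The eigenvectors of the library are rows, hence the transpose. *)
have [a a0 ra] : exists2 a, a != 0 & root (char_poly H^T) a.
  have [rs rsE] := closed_field_poly_normal (char_poly H^T : {poly R[i]}).
  rewrite (monicP (char_poly_monic _)) scale1r in rsE.
  apply: contrapT => /forall2NP nr.
  have rs0 z : z \in rs -> z = 0.
    move=> zrs; have [/negP|] := nr z; first by rewrite negbK => /eqP.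
    by rewrite rsE root_prod_XsubC.
  have pX : char_poly H^T = 'X^(size rs).
    rewrite rsE (eq_big_seq (fun=> 'X)) ?big_const_seq ?count_predT ?iter_mulr_1//.
    by move=> z /rs0 ->; rewrite subr0.
  have trX e : (H ^+ e)^T = H^T ^+ e.
    elim: e => [|e IH]; first by rewrite !expr0 trmx1.
    by rewrite exprS exprSr -!mulmxE trmx_mul IH.
  have := Cayley_Hamilton H^T; rewrite pX rmorphXn/= horner_mx_X => HX.
  have srs : size rs = m.+1.
    by have := size_char_poly H^T; rewrite pX size_polyXn => -[].
  move/eqP: H0; apply; apply: (@selfadjoint_nilpotent _ m H m HH).
  by apply: trmx_inj; rewrite trmx0 trX; rewrite srs in HX.
have /eigenvalueP[v hv v0] : eigenvalue H^T a by rewrite eigenvalue_root_char.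
exists v^T, a; split; rewrite ?trmx_eq0//.
by apply: trmx_inj; rewrite trmx_mul trmxK linearZ/= trmxK.
Qed.

Local Notation toC := (real_complex R).

(** After complexification, H is real and so is the eigenvalue given by [eigen_normalize]. The real
    and imaginary parts of the eigenvector thus satisfy the same equation, and one of them is
    non-zero. *)
Lemma real_eigen n m (B : 'M[field_of R RealKind]_(n, m)) : B != 0 ->
  exists (w : 'cV[field_of R RealKind]_m) a,
    [/\ w != 0, a != 0 & adjoint B *m B *m w = a *: w].
Proof.
move=> B0; pose Bc : 'M[field_of R ComplexKind]_(n, m) := map_mx toC (B : 'M[R]_(n, m)).
have Bc0 : Bc != 0 by rewrite map_mx_eq0.
have [w [a [w0 a0 hw]]] := complex_eigen Bc0.
have [l [v [l0 vv hv]]] := eigen_normalize w0 a0 hw.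
pose a1 : 'cV[R]_m := \col_i complex.Re (v i 0).
pose b1 : 'cV[R]_m := \col_i complex.Im (v i 0).
pose H : 'M[R]_m := adjoint B *m B.
have HE i j : (adjoint Bc *m Bc) i j = toC (H i j).
  rewrite /H !mxE rmorph_sum; apply: eq_bigr => x _; rewrite !mxE rmorphM/=.
  by congr (_ * _); exact: conjc_real.
have vE i : \sum_j toC (H i j) * v j 0 = toC l * v i 0.
  have := congr1 (fun M : 'cV_m => M i 0) hv; rewrite !mxE => <-.
  by apply: eq_bigr => j _; rewrite HE.
have Ha : H *m a1 = l *: a1.
  apply/matrixP => i j; rewrite ord1 !mxE; have := congr1 (@complex.Re R) (vE i).
  rewrite (raddf_sum (@complex.Re R : Rcomplex R -> R)) => h; apply: etrans (etrans h _).
    by apply: eq_bigr => x _; rewrite !mxE; case: (v x 0) => ? ? /=; rewrite mul0r subr0.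
  by case: (v i 0) => ? ? /=; rewrite mul0r subr0.
have Hb : H *m b1 = l *: b1.
  apply/matrixP => i j; rewrite ord1 !mxE; have := congr1 (@complex.Im R) (vE i).
  rewrite (raddf_sum (@complex.Im R : Rcomplex R -> R)) => h; apply: etrans (etrans h _).
    by apply: eq_bigr => x _; rewrite !mxE; case: (v x 0) => ? ? /=; rewrite mul0r addr0.
  by case: (v i 0) => ? ? /=; rewrite mul0r addr0.
have l1 : l != 0 by rewrite gt_eqF.
have [a10|a10] := eqVneq a1 0; last by exists a1, l.
have [b10|b10] := eqVneq b1 0; last by exists b1, l.
exfalso; have : v != 0.
  apply: contraTneq isT => v0; move: vv; rewrite v0 mulmx0 => /matrixP/(_ 0 0)/eqP.
  by rewrite !mxE eqxx eq_sym oner_eq0.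
move=> /eqP; apply; apply/matrixP => i j; rewrite ord1 mxE.
have := congr1 (fun M : 'cV_m => M i 0) a10; have := congr1 (fun M : 'cV_m => M i 0) b10.
by rewrite !mxE; case: (v i 0) => ? ? /= -> ->.
Qed.

Context {k : field_kind}.
Local Notation F := (field_of R k).
Local Notation "a %:F" := (@of_real R k a).
Local Notation diagF s := (diag_mx (map_mx (@of_real R k) s)).

Lemma exists_eigen n m (B : 'M[F]_(n, m)) : B != 0 ->
  exists (l : R) (v : 'cV[F]_m), [/\ 0 < l, adjoint v *m v = 1%:M & adjoint B *m B *m v = l%:F *: v].
Proof.
move=> B0; have [w [a [w0 a0]]] : exists (w : 'cV[F]_m) a,
    [/\ w != 0, a != 0 & adjoint B *m B *m w = a *: w].
  by case: k B B0 => B B0; [exact: real_eigen|exact: complex_eigen].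
exact: eigen_normalize.
Qed.

(** Deflation. B = A - U S adjoint V kills the columns of V, and adjoint U kills B, so an
    eigenvector of adjoint B B with non-zero eigenvalue is orthogonal to V and its image to U. Once
    B = 0, unit vectors orthogonal to U and V complete the system with singular value 0. *)
Lemma svd_partial n m (A : 'M[F]_(n, m)) p : (p <= minn n m)%N ->
  exists (U : 'M[F]_(n, p)) (s : 'rV[R]_p) (V : 'M[F]_(m, p)),
  [/\ adjoint U *m U = 1%:M, adjoint V *m V = 1%:M, forall j, 0 <= s 0 j,
      A *m V = U *m diagF s & adjoint A *m U = V *m diagF s].
Proof.
elim: p => [|p IH] pmn.
  by exists 0, 0, 0; split; rewrite ?mulmx0 ?thinmx0//; case.
have [U [s [V [UU VV s0 AV AU]]]] := IH (ltnW pmn).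
have [pn pm] : (p < n)%N /\ (p < m)%N by move: pmn; rewrite leq_min => /andP[].
suff [u [v [t [uu vv uU vV [t0 Av Au]]]]] : exists (u : 'cV[F]_n) (v : 'cV[F]_m) (t : R),
    [/\ adjoint u *m u = 1%:M, adjoint v *m v = 1%:M, adjoint U *m u = 0, adjoint V *m v = 0 &
        [/\ 0 <= t, A *m v = t%:F *: u & adjoint A *m u = t%:F *: v]].
  rewrite -addn1; exists (row_mx U u), (row_mx s (const_mx t)), (row_mx V v).
  have uU' : adjoint u *m U = 0 by rewrite -[LHS]adjointK adjointM adjointK uU /adjoint map_mx0 trmx0.
  have vV' : adjoint v *m V = 0 by rewrite -[LHS]adjointK adjointM adjointK vV /adjoint map_mx0 trmx0.
  have dE : diagF (row_mx s (const_mx t : 'rV_1)) = block_mx (diagF s) 0 0 (t%:F)%:M.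
    rewrite map_row_mx diag_mx_row; congr block_mx.
    by apply/matrixP => i j; rewrite !mxE.
  split.
  - by rewrite adjoint_row mul_col_row UU uu uU uU' -scalar_mx_block.
  - by rewrite adjoint_row mul_col_row VV vv vV vV' -scalar_mx_block.
  - by move=> j; rewrite mxE; case: splitP => i _; rewrite ?s0// mxE.
  - by rewrite dE mul_mx_row mul_row_block AV Av !mulmx0 addr0 add0r mul_mx_scalar.
  - by rewrite dE mul_mx_row mul_row_block AU Au !mulmx0 addr0 add0r mul_mx_scalar.
pose B := A - U *m diagF s *m adjoint V.
have UA : adjoint U *m A = diagF s *m adjoint V.
  by rewrite -[LHS]adjointK adjointM adjointK AU adjointM adjoint_diag.
have BV : B *m V = 0 by rewrite mulmxBl AV -!mulmxA VV mulmx1 subrr.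
have UB : adjoint U *m B = 0 by rewrite mulmxBr UA !mulmxA UU mul1mx subrr.
have [B0|B0] := eqVneq B 0.
  have [u uU uu] := exists_orthogonal U pn; have [v vV vv] := exists_orthogonal V pm.
  have AE : A = U *m diagF s *m adjoint V by apply/eqP; rewrite -subr_eq0; apply/eqP.
  exists u, v, 0; split=> //; split=> //; rewrite rmorph0 scale0r.
    by rewrite AE -mulmxA vV mulmx0.
  by rewrite AE !adjointM adjointK -!mulmxA uU !mulmx0.
have [l [v [l0 vv Hv]]] := exists_eigen B0.
have sl0 : 0 < Num.sqrt l by rewrite sqrtr_gt0.
pose t := Num.sqrt l; have tt : t * t = l by rewrite -expr2 sqr_sqrtr// ltW.
have tF : t%:F != 0 by rewrite fmorph_eq0 gt_eqF.
pose u := (t^-1)%:F *: (B *m v).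
have lF : l%:F != 0 by rewrite fmorph_eq0 gt_eqF.
have Bv : B *m v = t%:F *: u by rewrite /u scalerA -rmorphM/= mulfV ?gt_eqF// rmorph1 scale1r.
have vV : adjoint V *m v = 0.
  apply: (scalerI lF); rewrite scaler0 scalemxAr -Hv !mulmxA -adjointM BV.
  by rewrite /adjoint map_mx0 trmx0 !mul0mx.
have uU : adjoint U *m u = 0 by rewrite /u -scalemxAr mulmxA UB mul0mx scaler0.
have Bu : adjoint B *m u = t%:F *: v.
  rewrite /u -scalemxAr mulmxA Hv scalerA -rmorphM/= -tt mulrA mulVf ?mul1r// gt_eqF//.
exists u, v, t; split => //.
  rewrite {1}/u adjointZ conjugate_of_real adjointM -scalemxAl -mulmxA Bu -scalemxAr scalerA vv.
  by rewrite -rmorphM/= mulVf ?gt_eqF// rmorph1 scale1r.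
have AE : A = B + U *m diagF s *m adjoint V by rewrite /B subrK.
split; first exact: ltW.
- by rewrite AE mulmxDl -Bv -[X in _ + X]mulmxA vV mulmx0 addr0.
- have -> : adjoint A = adjoint B + adjoint (U *m diagF s *m adjoint V).
    by rewrite {1}AE /adjoint map_mxD linearD.
  by rewrite mulmxDl Bu !adjointM adjointK -!mulmxA uU !mulmx0 addr0.
Qed.

Lemma svd_entry n m p (U : 'M[F]_(n, p)) s (V : 'M[F]_(m, p)) i l :
  (U *m diagF s *m adjoint V) i l = \sum_j U i j * (s 0 j)%:F * conjugate (V l j).
Proof.
rewrite mxE; apply: eq_bigr => j _; rewrite adjointE; congr (_ * _).
by rewrite mul_mx_diag !mxE.
Qed.

Lemma sorting_perm p (s : 'rV[R]_p) :
  exists sg : 'S_p, forall i j : 'I_p, (i <= j)%N -> s 0 (sg j) <= s 0 (sg i).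
Proof.
pose T := [tuple s 0 i | i < p].
pose ge : rel R := fun x y => y <= x.
have geT : total ge by move=> x y; exact: le_total.
have getr : transitive ge by move=> x y z xy yz; exact: le_trans yz xy.
have /tuple_permP[sg hsg] : perm_eq (sort ge T) T by rewrite perm_sort.
exists sg => i j ij.
have nthE (l : 'I_p) : nth 0 (sort ge T) l = s 0 (sg l).
  by rewrite hsg -tnth_nth !tnth_mktuple.
rewrite -!nthE; apply: (sorted_leq_nth getr) => //.
- by move=> x; rewrite /ge.
- exact: sort_sorted.
- by rewrite inE size_sort size_tuple.
- by rewrite inE size_sort size_tuple.
Qed.

Lemma svd_exists n m (A : 'M[F]_(n, m)) : exists U s V, is_svd A U s V.
Proof.
have [U [s [V [UU VV s0 AV AU]]]] := svd_partial A (leqnn _).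
have AE : A = U *m diagF s *m adjoint V.
  (* One of U and V is square, hence unitary, and one of the two relations then recovers A. *)
  have mE : minn n m = n \/ minn n m = m by rewrite /minn; case: ifP; [left|right].
  move: (minn n m) mE U s V UU VV s0 AV AU => p [->|->] U s V UU VV _ AV AU.
    rewrite -mulmxA -[diagF s *m _]adjointK adjointM adjointK adjoint_diag -AU.
    by rewrite adjointM adjointK mulmxA (mulmx1C UU) mul1mx.
  by rewrite -AV -mulmxA (mulmx1C VV) mulmx1.
have [sg hsg] := sorting_perm s.
exists (\matrix_(i, j) U i (sg j)), (\row_j s 0 (sg j)), (\matrix_(i, j) V i (sg j)).
have orth q (W : 'M[F]_(q, minn n m)) : adjoint W *m W = 1%:M ->
    adjoint (\matrix_(i, j) W i (sg j)) *m (\matrix_(i, j) W i (sg j)) = 1%:M.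
  move=> WW; apply/matrixP => i j; have := congr1 (fun M : 'M_(minn n m) => M (sg i) (sg j)) WW.
  rewrite !mxE (inj_eq perm_inj) => <-; apply: eq_bigr => x _.
  by rewrite !mxE.
split; [exact: orth|exact: orth| | |].
- by move=> j; rewrite mxE.
- by move=> i j ij; rewrite !mxE hsg.
- apply/matrixP => i l; rewrite {1}AE !svd_entry (reindex_inj (@perm_inj _ sg)).
  by apply: eq_bigr => j _; rewrite !mxE.
Qed.

(** A X and A Y are both the orthogonal projector onto the range of A, as the adjoint of A X A Y = A
    Y shows; likewise for X A and Y A. *)
Lemma mpinv_unique n m (A : 'M[F]_(n, m)) X Y : is_mpinv A X -> is_mpinv A Y -> X = Y.
Proof.
move=> [AXA XAX AX XA] [AYA YAY AY YA].
have E1 : A *m X = A *m Y.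
  have h : A *m Y *m (A *m X) = A *m X by rewrite mulmxA AYA.
  have := congr1 (@adjoint R k _ _) (_ : A *m X *m (A *m Y) = A *m Y).
  by rewrite adjointM AX AY h mulmxA AXA; apply.
have E2 : X *m A = Y *m A.
  have h : X *m A *m (Y *m A) = X *m A by rewrite -mulmxA [A *m _]mulmxA AYA.
  have := congr1 (@adjoint R k _ _) (_ : Y *m A *m (X *m A) = Y *m A).
  by rewrite adjointM XA YA h -mulmxA [A *m _]mulmxA AXA; apply.
by rewrite -XAX -mulmxA E1 mulmxA E2 YAY.
Qed.

Lemma diagFM p (s t : 'rV[R]_p) : diagF s *m diagF t = diagF (\row_j (s 0 j * t 0 j)).
Proof.
rewrite mulmx_diag; congr diag_mx; apply/rowP => j.
by rewrite !mxE rmorphM.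
Qed.

Definition truncate p (r : nat) (s : 'rV[R]_p) : 'rV[R]_p := \row_j (if (j < r)%N then s 0 j else 0).
(** With the convention 0^-1 = 0, zero singular values stay zero, as a pseudo-inverse requires. *)
Definition inv_row p (s : 'rV[R]_p) : 'rV[R]_p := \row_j (s 0 j)^-1.

Lemma svd_mul n m p q (U : 'M[F]_(n, p)) (V : 'M[F]_(m, p)) (W : 'M[F]_(q, p)) s t :
  adjoint V *m V = 1%:M ->
  U *m diagF s *m adjoint V *m (V *m diagF t *m adjoint W) =
  U *m diagF (\row_j (s 0 j * t 0 j)) *m adjoint W.
Proof.
by move=> VV; rewrite -diagFM !mulmxA -[_ *m adjoint V *m V]mulmxA VV mulmx1.
Qed.

Lemma is_mpinv_svd n m p (U : 'M[F]_(n, p)) (V : 'M[F]_(m, p)) t :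
  adjoint U *m U = 1%:M -> adjoint V *m V = 1%:M ->
  is_mpinv (U *m diagF t *m adjoint V) (V *m diagF (inv_row t) *m adjoint U).
Proof.
move=> UU VV.
have self q (W : 'M[F]_(q, p)) s : adjoint (W *m diagF s *m adjoint W) = W *m diagF s *m adjoint W.
  by rewrite !adjointM adjointK adjoint_diag mulmxA.
split; rewrite !svd_mul//.
- congr (_ *m diagF _ *m _); apply/rowP => j; rewrite !mxE.
  by have [->|t0] := eqVneq (t 0 j) 0; rewrite ?mulr0// mulfV// mul1r.
- congr (_ *m diagF _ *m _); apply/rowP => j; rewrite !mxE.
  by have [->|t0] := eqVneq (t 0 j) 0; rewrite ?invr0 ?mul0r// mulVf// mul1r.
Qed.

(** The decomposition behind [rank_proj] cannot be prescribed; later bounds hold for whichever one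
    is returned here. *)
Lemma mpinv_rank_proj r n m (A : 'M[F]_(n, m)) : exists U s V, is_svd A U s V /\
  mpinv (rank_proj r A) = V *m diagF (inv_row (truncate r s)) *m adjoint U.
Proof.
have [B [U [s [V [svdA BE]]]]] : exists B U s V, is_svd A U s V /\
    B = \sum_(j < minn n m | (j < r)%N) of_real k (s 0 j) *: (col j U *m adjoint (col j V)).
  by have [U [s [V svdA]]] := svd_exists A; do 4!eexists; split; [exact: svdA|].
have : [set B | exists U s V, is_svd A U s V /\
    B = \sum_(j < minn n m | (j < r)%N) of_real k (s 0 j) *: (col j U *m adjoint (col j V))]
    (rank_proj r A).
  by apply: (xgetPex 0); exists B, U, s, V.
move=> {B U s V svdA BE} [U [s [V [svdA ->]]]]; exists U, s, V; split => //.
have [UU VV _ _ _] := svdA.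
set B := \sum_(j < _ | _) _.
have -> : B = U *m diagF (truncate r s) *m adjoint V.
  apply/matrixP => i l; rewrite svd_entry summxE big_mkcond; apply: eq_bigr => j _.
  rewrite [truncate r s 0 j]mxE; case: ifP => jr; last by rewrite rmorph0 mulr0 mul0r.
  by rewrite !mxE big_ord1 !mxE; ring.
have pB := is_mpinv_svd (truncate r s) UU VV.
exact: (mpinv_unique (xgetPex 0 (ex_intro _ _ pB)) pB).
Qed.

(** * Perturbation bounds for singular values *)

Lemma nrm_orthonormal n p (U : 'M[F]_(n, p)) : adjoint U *m U = 1%:M -> nrm U <= (n * p)%:R.
Proof.
move=> UU; rewrite -[leRHS]mulr1; apply: nrm_entry_le => i j.
rewrite -(@expr_le1 _ 2)// -(@of_real_le _ k) rmorph1.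
have <- : (adjoint U *m U) j j = 1 by rewrite UU mxE eqxx.
rewrite adjoint_mulE of_real_le (bigD1 i)//= lerDl sumr_ge0// => l _.
exact: sqr_ge0.
Qed.

Lemma nrm_diagF_mul p q (s : 'rV[R]_p) (c : 'M[F]_(p, q)) :
  nrm (diagF s *m c) = \sum_i \sum_j `|s 0 i| * modulus (c i j).
Proof.
apply: eq_bigr => i _; apply: eq_bigr => j _.
by rewrite mul_diag_mx !mxE modulusM modulus_of_real.
Qed.

(** Half of the min-max principle. Indices start at 0, so the first j + 1 right singular vectors
    span a space too large to miss the kernel of [B]: some V c with c supported on these coordinates
    has B V c = 0, and s_j |c| <= |S c| = |adjoint U (A - B) V c|. *)
Lemma singular_value_le n m (A B : 'M[F]_(n, m)) U s V (j : 'I_(minn n m)) :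
  is_svd A U s V -> (\rank B <= j)%N -> s 0 j <= nrm U * nrm V * nrm (A - B).
Proof.
move=> [UU VV s0 sdec AE] rB; set p := minn n m in U s V j UU VV s0 sdec AE rB *.
pose E : 'M[F]_(p, j.+1) := \matrix_(i, l) (i == l :> nat)%:R.
have [|c' c'0 Bc] := @exists_kernel k _ _ (B *m V *m E).
  by rewrite ltnS (leq_trans (mxrankM_maxl _ _))// (leq_trans (mxrankM_maxl _ _)).
pose c := E *m c'.
have cE (i : 'I_p) (ij : (i < j.+1)%N) z : c i z = c' (Ordinal ij) z.
  rewrite mxE (bigD1 (Ordinal ij))//= mxE eqxx mul1r big1 ?addr0// => l li.
  rewrite mxE eq_sym (_ : (l == i :> nat) = false) ?mul0r//.
  by apply: contraNF li => /eqP h; apply/eqP/val_inj.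
have c0 (i : 'I_p) z : (j < i)%N -> c i z = 0.
  move=> ji; rewrite mxE big1// => l _; rewrite mxE gtn_eqF ?mul0r//.
  by rewrite (leq_ltn_trans _ ji)// -ltnS.
have cn0 : c != 0.
  apply: contraNneq c'0 => cz; apply/eqP/matrixP => l z.
  have lp : (l < p)%N by rewrite (leq_trans (ltn_ord l)).
  have := cE (Ordinal lp) (ltn_ord l) z; rewrite cz !mxE => ->.
  by congr (c' _ _); apply: val_inj.
have nc0 : 0 < nrm c.
  by rewrite lt_def nrm_ge0 andbT; apply: contraNneq cn0 => /nrm_eq0 ->.
rewrite -(ler_pM2r nc0).
have Dc : diagF s *m c = adjoint U *m (A - B) *m V *m c.
  have BVc : B *m V *m c = 0 by rewrite /c mulmxA.
  rewrite mulmxBr !mulmxBl -[adjoint U *m B *m V *m c]mulmxA -[adjoint U *m B *m _]mulmxA.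
  rewrite [B *m (V *m c)]mulmxA BVc mulmx0 subr0 AE !mulmxA UU mul1mx.
  by rewrite -[_ *m adjoint V *m V]mulmxA VV mulmx1.
have h1 : s 0 j * nrm c <= nrm (diagF s *m c).
  rewrite nrm_diagF_mul /nrm mulr_sumr; apply: ler_sum => i _.
  rewrite mulr_sumr; apply: ler_sum => z _.
  have [ji|ij] := ltnP j i; first by rewrite c0// modulus0 !mulr0.
  by rewrite ler_wpM2r// (le_trans (sdec _ _ ij))// ler_norm.
rewrite (le_trans h1)// Dc (le_trans (nrmM _ _))// ler_wpM2r//.
rewrite (le_trans (nrmM _ _))// mulrAC ler_wpM2r//.
by rewrite (le_trans (nrmM _ _))// nrm_adjoint.
Qed.

(** The other half. As j < r, some c <> 0 has the first j coordinates of y = adjoint V M c equal to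
    0, so |S y| <= s_j |y|, while c = L A0 M c is recovered from U S y = A M c up to the
    perturbation A - A0. *)
Lemma singular_value_ge n m r (A A0 : 'M[F]_(n, m)) (L : 'M[F]_(r, n)) (M : 'M[F]_(m, r)) U s V
    (j : 'I_(minn n m)) :
  L *m A0 *m M = 1%:M -> is_svd A U s V -> (j < r)%N ->
  1 <= nrm L * (nrm U * s 0 j * nrm V + nrm (A - A0)) * nrm M.
Proof.
move=> LAM [UU VV s0 sdec AE] jr; set p := minn n m in U s V j UU VV s0 sdec AE jr *.
pose E : 'M[F]_(j, p) := \matrix_(i, l) (i == l :> nat)%:R.
have [|c c0 Ec] := @exists_kernel k _ _ (E *m (adjoint V *m M)).
  by rewrite (leq_ltn_trans (rank_leq_row _)).
have [y yE] : exists y, y = adjoint V *m M *m c by eexists.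
have y0 (i : 'I_p) z : (i < j)%N -> y i z = 0.
  move=> ij; have := congr1 (fun N : 'M_(_, _) => N (Ordinal ij) z) Ec.
  rewrite -mulmxA -yE !mxE => <-; rewrite (bigD1 i)//= mxE eqxx mul1r big1 ?addr0// => l li.
  rewrite mxE eq_sym (_ : (l == i :> nat) = false) ?mul0r//.
  by apply: contraNF li => /eqP h; apply/eqP/val_inj.
have nc0 : 0 < nrm c.
  by rewrite lt_def nrm_ge0 andbT; apply: contraNneq c0 => /nrm_eq0 ->.
rewrite -(ler_pM2r nc0) mul1r.
have cE : c = L *m (U *m (diagF s *m y) - (A - A0) *m M *m c).
  have -> : U *m (diagF s *m y) = A *m M *m c by rewrite yE AE !mulmxA.
  by rewrite !mulmxBl opprB addrC subrK !mulmxA LAM mul1mx.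
have h1 : nrm (diagF s *m y) <= s 0 j * nrm y.
  rewrite nrm_diagF_mul /nrm mulr_sumr; apply: ler_sum => i _.
  rewrite mulr_sumr; apply: ler_sum => z _.
  have [ij|ji] := ltnP i j; first by rewrite y0// modulus0 !mulr0.
  by rewrite ler_wpM2r// ger0_norm// sdec.
have h2 : nrm y <= nrm V * nrm M * nrm c.
  by rewrite yE (le_trans (nrmM _ _))// ler_wpM2r// (le_trans (nrmM _ _))// nrm_adjoint.
rewrite {1}cE (le_trans (nrmM _ _))// -!mulrA ler_wpM2l//.
rewrite (le_trans (nrmB _ _))// mulrDl lerD//.
  rewrite (le_trans (nrmM _ _))// -!mulrA ler_wpM2l// (le_trans h1)// ler_wpM2l//.
  by rewrite mulrA.
by rewrite (le_trans (nrmM _ _))// mulrA ler_wpM2r// nrmM.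
Qed.

Lemma newton_matrix_bounds n m r (A0 : 'M[F]_(n, m)) (L : 'M[F]_(r, n)) (M : 'M[F]_(m, r)) :
  L *m A0 *m M = 1%:M -> exists2 d : R, 0 < d & exists2 K : R, 0 <= K &
    forall A, nrm (A - A0) < d ->
      nrm (mpinv (rank_proj r A)) <= K /\
      forall B, (\rank B <= r)%N -> nrm (A - A *m mpinv (rank_proj r A) *m A) <= K * nrm (A - B).
Proof.
move=> LAM; set p := minn n m.
pose c : R := (n * p + m * p).+1%:R.
have c0 : 0 < c by rewrite ltr0n.
pose a := nrm L + 1; have a0 : 0 < a by rewrite ltr_wpDl.
pose b := nrm M + 1; have b0 : 0 < b by rewrite ltr_wpDl.
(* A perturbation of this size consumes at most half of the 1 in [singular_value_ge], leaving s_j >=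
   1 / (2 a b c^2) for j < r. *)
exists (2 * a * b)^-1; first by rewrite invr_gt0 !mulr_gt0.
pose K1 := c * (p%:R * (2 * a * b * c * c)) * c.
pose K2 := c * (p%:R * (c * c)) * c.
have K10 : 0 <= K1 by rewrite /K1 !mulr_ge0// ltW.
have K20 : 0 <= K2 by rewrite /K2 !mulr_ge0// ltW.
exists (K1 + K2); first exact: addr_ge0.
move=> A AA0; have [U [s [V [svdA ->]]]] := mpinv_rank_proj r A.
have [UU VV s0 sdec AE] := svdA.
have Uc : nrm U <= c.
  by rewrite (le_trans (nrm_orthonormal UU))// ler_nat leqW// leq_addr.
have Vc : nrm V <= c.
  by rewrite (le_trans (nrm_orthonormal VV))// ler_nat leqW// leq_addl.
have UDV q q' (X : 'M[F]_(q, p)) (Y : 'M[F]_(q', p)) (t : 'rV[R]_p) e : nrm X <= c -> nrm Y <= c ->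
    0 <= e -> (forall j, `|t 0 j| <= e) -> nrm (X *m diagF t *m adjoint Y) <= c * (p%:R * e) * c.
  move=> Xc Yc e0 te; rewrite (le_trans (nrmM _ _))// nrm_adjoint.
  apply: ler_pM => //; rewrite (le_trans (nrmM _ _))//; apply: ler_pM => //.
  rewrite -[diagF t]mulmx1 nrm_diagF_mul mulr_natl -[X in _ *+ X]card_ord -sumr_const.
  apply: ler_sum => i _; rewrite (bigD1 i)//= big1 => [|j ji]; last first.
    by rewrite mxE eq_sym (negbTE ji) modulus0 mulr0.
  by rewrite mxE eqxx modulus1 mulr1 addr0.
split.
  rewrite (@le_trans _ _ K1) ?lerDl//; apply: UDV => // [|j].
    by rewrite !mulr_ge0// ltW.
  rewrite !mxE; case: ifP => jr; last by rewrite invr0 normr0 !mulr_ge0// ltW.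
  have h := singular_value_ge LAM svdA jr.
  have sj0 := s0 j.
  have La : nrm L <= a by rewrite lerDl.
  have Mb : nrm M <= b by rewrite lerDl.
  have h1 : 1 <= a * (c * s 0 j * c + (2 * a * b)^-1) * b.
    rewrite (le_trans h)//; apply: ler_pM => //.
      by rewrite mulr_ge0// addr_ge0// !mulr_ge0.
    apply: ler_pM => //; first by rewrite addr_ge0// !mulr_ge0.
    by rewrite lerD ?(ltW AA0)// !ler_pM ?mulr_ge0.
  have h2 : a * (2 * a * b)^-1 * b = 2^-1.
    by field; rewrite !gt_eqF.
  have h3 : 2^-1 <= a * b * c * c * s 0 j.
    have e : a * (c * s 0 j * c + (2 * a * b)^-1) * b = a * b * c * c * s 0 j + a * (2 * a * b)^-1 * b by ring.
    by rewrite e h2 in h1; lra.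
  have sj1 : 0 < s 0 j.
    rewrite lt_def sj0 andbT; apply: contraTneq h3 => ->.
    by rewrite mulr0 -ltNge.
  rewrite ger0_norm ?invr_ge0// -[leLHS]mul1r ler_pdivrMr//.
  by lra.
move=> B rB; rewrite (@le_trans _ _ (K2 * nrm (A - B))) ?ler_wpM2r ?lerDr//.
(* In the singular bases this is diagonal: 0 for j < r and s_j for j >= r, where [singular_value_le]
   applies. *)
have -> : A - A *m (V *m diagF (inv_row (truncate r s)) *m adjoint U) *m A =
    U *m diagF (s - (\row_j (s 0 j * inv_row (truncate r s) 0 j * s 0 j))) *m adjoint V.
  rewrite {2 3}AE svd_mul// svd_mul// {1}AE -mulmxBl -mulmxBr -linearB -map_mxB/=.
  congr (_ *m diagF _ *m _); apply/rowP => j; rewrite !mxE.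
  by [].
rewrite (_ : K2 * _ = c * (p%:R * (c * c * nrm (A - B))) * c); last by rewrite /K2; ring.
apply: UDV => // [|j]; first by rewrite !mulr_ge0// ltW.
rewrite !mxE; case: ltnP => jr.
  have [->|sj] := eqVneq (s 0 j) 0; first by rewrite mul0r mulr0 subr0 normr0 !mulr_ge0// ltW.
  by rewrite mulfV// mul1r subrr normr0 !mulr_ge0// ltW.
rewrite invr0 mulr0 mul0r subr0 ger0_norm//.
rewrite (le_trans (singular_value_le svdA (leq_trans rB jr)))// ler_wpM2r//.
exact: ler_pM.
Qed.

End SVD.

(** * The branch through a semiregular zero *)

Section Implicit.
Context {R : realType} {k : field_kind}.
Local Notation F := (field_of R k).
Local Notation "a %:F" := (@of_real R k a).

(** From the factorization of [A] through its echelon bases: L A and P are the upper and lower rows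
    of X = [row_ebase A], M and N the matching columns of its inverse. N spans the kernel of [A],
    and the last identity reads x = N z + M w with z = P x and w = L A x. *)
Lemma split_coordinates n m d r (A : 'M[F]_(n, m)) : (d + r)%N = m -> \rank A = r ->
  exists (N : 'M[F]_(m, d)) (M : 'M[F]_(m, r)) (P : 'M[F]_(d, m)) (L : 'M[F]_(r, n)),
  [/\ L *m A *m M = 1%:M, A *m N = 0, P *m N = 1%:M, P *m M = 0 &
      N *m P + M *m (L *m A) = 1%:M].
Proof.
rewrite addnC => dr; case: m / dr A => A rA.
pose X := row_ebase A; pose Y := invmx X.
have XY : X *m Y = 1%:M by rewrite mulmxV ?row_ebase_unit.
have YX : Y *m X = 1%:M by rewrite mulVmx ?row_ebase_unit.
pose W := usubmx X; pose P := dsubmx X; pose M := lsubmx Y; pose N := rsubmx Y.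
have : block_mx (W *m M) (W *m N) (P *m M) (P *m N) = block_mx 1%:M 0 0 1%:M.
  rewrite -mul_col_row vsubmxK hsubmxK XY; exact: scalar_mx_block.
move=> /eq_block_mx[WM WN PM PN].
have MWNP : M *m W + N *m P = 1%:M by rewrite -mul_row_col hsubmxK vsubmxK.
have rn : (r <= n)%N by rewrite -rA rank_leq_row.
pose L : 'M[F]_(r, n) := pid_mx r *m invmx (col_ebase A).
have pidE q : (pid_mx r : 'M[F]_(q, r + d)) = row_mx (pid_mx r) 0.
  apply/matrixP => i j; rewrite !mxE; case: splitP => l ->; rewrite !mxE//.
  by case: eqP => //= h; rewrite h ltnNge leq_addr.
have AE : A = col_ebase A *m (pid_mx r *m X) by have := mulmx_ebase A; rewrite rA mulmxA => ->.
have LA : L *m A = W.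
  rewrite /L {2}AE -!mulmxA [invmx _ *m _]mulmxA mulVmx ?col_ebase_unit// mul1mx mulmxA.
  rewrite mul_pid_mx minnn (minn_idPr rn) pidE pid_mx_1 -[X]vsubmxK mul_row_col mul1mx mul0mx addr0.
  by [].
exists N, M, P, L; split; rewrite ?LA//; last by rewrite addrC.
rewrite {1}AE -!mulmxA (_ : X *m N = col_mx 0 1%:M); last first.
  by rewrite -[X]vsubmxK mul_col_mx WN PN.
by rewrite pidE mul_row_col mulmx0 mul0mx addr0 mulmx0.
Qed.

Lemma jac_comp_eq0 m n p (phi : 'cV[F]_m -> 'cV[F]_n) (f : 'cV[F]_n -> 'cV[F]_p) z A B (e : R) :
  has_jac phi z A -> has_jac f (phi z) B -> 0 < e ->
  (forall u, nrm (u - z) < e -> f (phi u) = 0) -> B *m A = 0.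
Proof.
move=> /has_jac_differentiable[dphi <-] /has_jac_differentiable[df <-] e0 f0.
have df' := differentiable_comp dphi df.
have <- : jacobian_mx (f \o phi) z = jacobian_mx f (phi z) *m jacobian_mx phi z.
  apply/matrixP => i j.
  have := diff_jacobian (delta_mx j 0) df'; rewrite diff_comp// /comp !diff_jacobian// mulmxA.
  by rewrite -!colE => /matrixP/(_ i 0); rewrite ![col _ _ _ _]mxE.
apply: (@has_jac_unique _ _ _ _ (f \o phi) z); first exact: differentiable_has_jac.
move=> eps eps0; exists e => // h he.
have f1 : f (phi (z + h)) = 0 by apply: f0; rewrite addrC addKr.
have f2 : f (phi z) = 0 by apply: f0; rewrite subrr nrm0.
by rewrite mul0mx subr0 /comp f1 f2 subrr nrm0 mulr_ge0// ltW.
Qed.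

Lemma unit_of_near_id r (X : 'M[F]_r) : nrm (X - 1%:M) <= 2^-1 -> X \in unitmx.
Proof.
move=> X1; rewrite -row_free_unit /row_free; apply: contraT => rX.
have [|c c0 Xc] := @exists_kernel _ _ _ _ X; first by rewrite ltn_neqAle rX rank_leq_row.
move/negP: c0; case; apply/eqP/nrm_eq0/eqP; rewrite eq_le nrm_ge0 andbT.
have : nrm c <= 2^-1 * nrm c.
  have {1}-> : c = - ((X - 1%:M) *m c) by rewrite mulmxBl Xc mul1mx sub0r opprK.
  by rewrite nrmN (le_trans (nrmM _ _))// ler_wpM2r.
lra.
Qed.

Section ImplicitFunction.
Variables (m n d r : nat) (f : 'cV[F]_m -> 'cV[F]_n) (xs : 'cV[F]_m) (dl C : R).
Variables (N : 'M[F]_(m, d)) (M : 'M[F]_(m, r)) (L : 'M[F]_(r, n)).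
Let J := jacobian_mx f.
Hypotheses (C0 : 0 <= C) (dl0 : 0 < dl) (taylor_f : taylor_ball f xs dl C) (f_xs : f xs = 0).
Hypotheses (LAM : L *m J xs *m M = 1%:M) (AN : J xs *m N = 0).

Definition point (z : 'cV[F]_d) (w : 'cV[F]_r) := xs + (N *m z + M *m w).

(** For fixed z, the map w -> w - L f (point z w) has derivative 1 - L J M, which is 0 at [xs], so
    it contracts by 1/2. The contraction gives [psi] and also the third clause, which contains
    uniqueness and the distance to the graph; applied at neighboring z it makes [psi] Lipschitz, and
    Taylor's formula then makes it differentiable. *)
Lemma implicit_function (e0 : R) : 0 < e0 -> exists rz rw : R, exists psi : 'cV[F]_d -> 'cV[F]_r,
  [/\ 0 < rz, 0 < rw &
  [/\ forall z w, nrm z < rz -> nrm w < rw ->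
        nrm (point z w - xs) < e0 /\ L *m J (point z w) *m M \in unitmx,
      forall z, nrm z < rz -> nrm (psi z) < rw /\ L *m f (point z (psi z)) = 0,
      forall z w, nrm z < rz -> nrm w < rw -> nrm (w - psi z) <= 2 * nrm (L *m f (point z w)) &
      forall z, nrm z < rz -> exists D, has_jac psi z D]].
Proof.
move=> e00.
pose a := nrm L + 1; pose b := nrm M + 1; pose c := nrm N + 1.
have a0 : 0 < a by rewrite ltr_wpDl.
have b0 : 0 < b by rewrite ltr_wpDl.
have c0 : 0 < c by rewrite ltr_wpDl.
have La : nrm L <= a by rewrite lerDl.
have Mb : nrm M <= b by rewrite lerDl.
have Nc : nrm N <= c by rewrite lerDl.
(* For e <= t the contraction factor a (3 C e) b is at most 1/2; C + 1 allows C = 0. *)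
pose t := (6 * (C + 1) * a * b)^-1.
have C10 : 0 < C + 1 by rewrite ltr_wpDl.
have t0 : 0 < t by rewrite invr_gt0 !mulr_gt0.
pose e := Num.min (Num.min dl e0) t.
have e_gt0 : 0 < e by rewrite !lt_min dl0 e00.
have edl : e <= dl by rewrite /e !ge_min lexx.
have ee0 : e <= e0 by rewrite /e !ge_min lexx orbT.
have et : a * (3 * C * e) * b <= 2^-1.
  have : e * (6 * (C + 1) * a * b) <= 1.
    by rewrite -ler_pdivlMr ?mulr_gt0// div1r /e ge_min lexx orbT.
  have h : 0 <= e * a * b by rewrite !mulr_ge0// ltW.
  rewrite (_ : e * _ = 2 * (a * (3 * C * e) * b) + 6 * (e * a * b)); last by ring.
  by move=> h1; lra.
have strict := taylor_strict C0 taylor_f edl.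
have LAM' v : L *m (J xs *m (M *m v)) = v :> 'cV_r by rewrite !mulmxA LAM mul1mx.
pose rw := e / (2 * b).
have rw0 : 0 < rw by rewrite divr_gt0// mulr_gt0.
(* The first bound keeps points within e of [xs]. The second makes [T z 0] small enough for the
   fixed point to have norm below rw: as J N = 0 at [xs], only the remainder of [taylor_strict]
   contributes to it. *)
pose rz := Num.min (e / (2 * c)) (rw / (2 * (a * (3 * C * e) * c + 1))).
have q0 : 0 <= a * (3 * C * e) * c by rewrite !mulr_ge0// ltW.
have q10 : 0 < a * (3 * C * e) * c + 1 by rewrite ltr_wpDl.
have rz0 : 0 < rz by rewrite lt_min !divr_gt0// !mulr_gt0.
have near z w : nrm z < rz -> nrm w < rw -> nrm (point z w - xs) < e.
  move=> zr wr; rewrite /point addrC addKr (le_lt_trans (nrmD _ _))//.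
  rewrite (le_lt_trans (lerD (nrmM _ _) (nrmM _ _)))//.
  have h1 : nrm N * nrm z <= c * nrm z by rewrite ler_wpM2r.
  have h2 : nrm M * nrm w <= b * nrm w by rewrite ler_wpM2r.
  have h3 : c * nrm z < e / 2.
    rewrite mulrC -ltr_pdivlMr// -mulrA -invfM.
    by move: zr; rewrite lt_min => /andP[].
  have h4 : b * nrm w < e / 2 by rewrite mulrC -ltr_pdivlMr// -mulrA -invfM.
  lra.
pose T z w := w - L *m f (point z w).
have ctr z w w' : nrm z < rz -> nrm w < rw -> nrm w' < rw ->
    nrm (T z w - T z w') <= 2^-1 * nrm (w - w').
  move=> zr wr wr'; have := strict _ _ (near z w' zr wr') (near z w zr wr).
  have -> : point z w - point z w' = M *m (w - w').
    rewrite /point mulmxBr; move: (M *m w) (M *m w') (N *m z) => *.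
    by apply/matrixP => i j; rewrite !mxE; ring.
  move=> h; have -> : T z w - T z w' = - (L *m (f (point z w) - f (point z w') - J xs *m (M *m (w - w')))).
    rewrite [in RHS]mulmxBr LAM' mulmxBr /T.
    move: (L *m f _) (L *m f _) => *.
    by apply/matrixP => i j; rewrite !mxE; ring.
  rewrite nrmN (le_trans (nrmM _ _))//.
  rewrite (@le_trans _ _ (a * (3 * C * e * (b * nrm (w - w')))))//.
    apply: ler_pM => //; rewrite (le_trans h)// ler_wpM2l//.
      by rewrite !mulr_ge0// ltW.
    by rewrite (le_trans (nrmM _ _))// ler_wpM2r.
  by rewrite !mulrA ler_wpM2r//; move: et; rewrite !mulrA.
have T0 z : nrm z < rz -> 2 * nrm (T z 0) < rw.
  move=> zr; have z0r : nrm (0 : 'cV[F]_r) < rw by rewrite nrm0.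
  have h0 : nrm (xs - xs) < e by rewrite subrr nrm0.
  have := strict _ _ h0 (near z 0 zr z0r).
  have pz : point z 0 - xs = N *m z by rewrite /point mulmx0 addr0 addrC addKr.
  rewrite f_xs subr0 pz mulmxA AN mul0mx subr0 => h.
  have h1 : nrm (T z 0) <= a * (3 * C * e) * c * nrm z.
    rewrite /T sub0r nrmN (le_trans (nrmM _ _))// -!mulrA; apply: ler_pM => //.
    by rewrite (le_trans h)// -!mulrA !ler_wpM2l// ?(ltW e_gt0)// (le_trans (nrmM _ _))// ler_wpM2r.
  have h2 : (a * (3 * C * e) * c + 1) * nrm z < rw / 2.
    move: zr; rewrite lt_min => /andP[_]; rewrite ltr_pdivlMr ?mulr_gt0// => h2.
    by rewrite ltr_pdivlMr// mulrC [_ * nrm z]mulrC mulrCA.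
  have := nrm_ge0 z; rewrite mulrDl mul1r in h2; lra.
have /choice[psi hpsi] : forall z, exists w, nrm z < rz -> nrm w < rw /\ L *m f (point z w) = 0.
  move=> z; have [zr|zr] := ltP (nrm z) rz; last by exists 0.
  have [w [wT Tw]] := contraction_fixpoint (fun w w' => ctr z w w' zr) (T0 z zr).
  exists w => _; split; first exact: le_lt_trans wT (T0 z zr).
  apply/eqP; rewrite -oppr_eq0 -(inj_eq (addrI w)) addr0; apply/eqP; exact: Tw.
have lower z w : nrm z < rz -> nrm w < rw -> nrm (w - psi z) <= 2 * nrm (L *m f (point z w)).
  move=> zr wr; have [pr p0] := hpsi z zr; have h := ctr z _ _ zr wr pr.
  have : nrm (w - psi z) <= nrm (T z w - T z (psi z)) + nrm (L *m f (point z w)).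
    rewrite {1}(_ : w - psi z = (T z w - T z (psi z)) + L *m f (point z w)) ?nrmD//.
    rewrite /T p0 subr0; move: (L *m f _) => *.
    by apply/matrixP => i j; rewrite !mxE; ring.
  lra.
have xsdl : nrm (xs - xs) < dl by rewrite subrr nrm0.
have unitX z w : nrm z < rz -> nrm w < rw -> L *m J (point z w) *m M \in unitmx.
  move=> zr wr; apply: unit_of_near_id; rewrite -LAM -mulmxBl -mulmxBr.
  have [_ JC _] := taylor_f; have ze := near z w zr wr.
  have h := JC _ _ xsdl (lt_le_trans ze edl).
  rewrite (le_trans (nrmM _ _))// (@le_trans _ _ (a * (3 * C * e) * b))//.
  apply: ler_pM => //; rewrite (le_trans (nrmM _ _))//; apply: ler_pM => //.
  rewrite (le_trans h)// (@le_trans _ _ (C * e)) ?ler_wpM2l ?(ltW ze)//.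
  by rewrite ler_wpM2r ?(ltW e_gt0)// ler_peMl// ler1n.
exists rz, rw, psi; split=> //; split=> // [z w zr wr|z zr].
  by split; [exact: lt_le_trans (near z w zr wr) ee0|exact: unitX].
have [pr p0] := hpsi z zr.
set x := point z (psi z).
set X := L *m J x *m M; have Xu : X \in unitmx by exact: unitX.
pose K1 := 2 * (a * ((3 * C * e + nrm (J xs)) * c)).
have K10 : 0 <= K1 by rewrite !mulr_ge0// ?addr_ge0// ?mulr_ge0// ltW.
have zk h : nrm h < rz - nrm z -> nrm (z + h) < rz.
  by move=> hr; rewrite (le_lt_trans (nrmD _ _))//; lra.
have psiK1 h : nrm h < rz - nrm z -> nrm (psi (z + h) - psi z) <= K1 * nrm h.
  move=> /zk zhr; rewrite nrmBC (le_trans (lower _ _ zhr pr))// /K1 -!mulrA ler_wpM2l//.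
  have := strict _ _ (near _ _ zr pr) (near _ _ zhr pr).
  have -> : point (z + h) (psi z) - point z (psi z) = N *m h.
    rewrite /point mulmxDr; move: (M *m _) (N *m z) => *.
    by apply/matrixP => i j; rewrite !mxE; ring.
  move=> hN; have -> : L *m f (point (z + h) (psi z)) =
      L *m (f (point (z + h) (psi z)) - f (point z (psi z)) - J xs *m (N *m h) + J xs *m (N *m h)).
    by rewrite subrK mulmxBr p0 subr0.
  rewrite (le_trans (nrmM _ _))//; apply: ler_pM => //; rewrite (le_trans (nrmD _ _))//.
  rewrite mulrDl lerD//.
    rewrite (le_trans hN)// -[3 * C * e]mulrA -!mulrA !ler_wpM2l ?(ltW e_gt0)//.
    by rewrite (le_trans (nrmM _ _))// ler_wpM2r.
  rewrite (le_trans (nrmM _ _))// ler_wpM2l//.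
  by rewrite (le_trans (nrmM _ _))// ler_wpM2r.
(* The value forced by differentiating L f (point z (psi z)) = 0. *)
pose D := - (invmx X *m (L *m J x *m N)).
exists D => eps eps0.
pose K2 := nrm (invmx X) * (a * (C * (c + b * K1) ^+ 2)).
have cK : 0 <= c + b * K1 by rewrite (addr_ge0 (ltW c0) (mulr_ge0 (ltW b0) K10)).
have K20 : 0 <= K2 by rewrite /K2 !mulr_ge0 ?exprn_ge0 ?(ltW a0).
have K210 : 0 < K2 + 1 by rewrite ltr_wpDl.
exists (Num.min (rz - nrm z) (eps / (K2 + 1))).
  by rewrite lt_min subr_gt0 zr divr_gt0.
move=> h; rewrite lt_min => /andP[hr heps]; have zhr := zk h hr.
set q := psi (z + h) - psi z.
have [pr' p0'] := hpsi _ zhr.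
set x' := point (z + h) (psi (z + h)).
have xx' : x' - x = N *m h + M *m q.
  rewrite /x' /x /q /point !mulmxDr mulmxN; move: (M *m _) (M *m _) (N *m z) (N *m h) => *.
  by apply/matrixP => i j; rewrite !mxE; ring.
have [_ _ fC] := taylor_f.
have hx := fC x x' (lt_le_trans (near _ _ zr pr) edl) (lt_le_trans (near _ _ zhr pr') edl).
have xxn : nrm (x' - x) <= (c + b * K1) * nrm h.
  rewrite xx' (le_trans (nrmD _ _))// mulrDl -mulrA.
  by rewrite lerD// (le_trans (nrmM _ _))//; apply: ler_pM => //; exact: psiK1.
have qE : q - D *m h = - (invmx X *m (L *m (f x' - f x - J x *m (x' - x)))).
  rewrite xx' [L *m _]mulmxBr [L *m (f x' - _)]mulmxBr p0' p0 subrr sub0r mulmxN opprK.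
  have -> : L *m (J x *m (N *m h + M *m q)) = L *m J x *m N *m h + X *m q.
    by rewrite mulmxA mulmxDr !mulmxA.
  by rewrite mulmxDr mulKmx// /D mulNmx opprK addrC !mulmxA.
rewrite qE nrmN (le_trans (nrmM _ _))//.
rewrite (@le_trans _ _ (K2 * nrm h ^+ 2))//.
  have h2 : nrm (x' - x) ^+ 2 <= (c + b * K1) ^+ 2 * nrm h ^+ 2.
    by rewrite -exprMn lerXn2r ?nnegrE ?(mulr_ge0 cK).
  have h3 := le_trans hx (ler_wpM2l C0 h2).
  have h4 := le_trans (nrmM L (f x' - f x - J x *m (x' - x))) (ler_pM (nrm_ge0 _) (nrm_ge0 _) La h3).
  have h5 := ler_wpM2l (nrm_ge0 (invmx X)) h4.
  by rewrite (le_trans h5)// /K2 !mulrA.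
rewrite expr2 mulrA ler_wpM2r// (@le_trans _ _ ((K2 + 1) * nrm h)) ?ler_wpM2r ?lerDl//.
by rewrite mulrC -ler_pdivlMr// ltW.
Qed.

End ImplicitFunction.

End Implicit.

Section Branch.
Context {R : realType} {k : field_kind}.
Local Notation F := (field_of R k).
Local Notation "a %:F" := (@of_real R k a).

(** The union of the segments from 0 to its points, which share 0. *)
Lemma connected_nrm_ball d (rho : R) : connected [set z : 'cV[F]_d | nrm z < rho].
Proof.
have -> : [set z : 'cV[F]_d | nrm z < rho] =
    \bigcup_(z in [set z : 'cV[F]_d | nrm z < rho]) ((fun t : R => t%:F *: z) @` `[0, 1]).
  apply/seteqP; split => [z zr|z [y /= yr [t]]].
    by exists z => //; exists 1; rewrite ?rmorph1 ?scale1r//= in_itv/= lexx ler01.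
  rewrite /= in_itv/= => /andP[t0 t1] <-; rewrite nrmZ modulus_of_real ger0_norm//.
  by rewrite (le_lt_trans _ yr)// ler_piMl.
apply: bigcup_connected => [|z _].
  exists 0 => z _; exists 0; rewrite ?rmorph0 ?scale0r//=.
  by rewrite in_itv/= lexx ler01.
apply: connected_continuous_connected; first exact: segment_connected.
apply: continuous_subspaceT => t U /= /nbhs_nrmP[e e0 eU].
have z0 : 0 < nrm z + 1 by rewrite ltr_wpDl.
apply/nbhs_normP; exists (e / (nrm z + 1)) => /=; first by rewrite divr_gt0.
move=> s /= ts; apply: eU; rewrite -scalerBl -rmorphB nrmZ modulus_of_real distrC.
rewrite ltr_pdivlMr// in ts; rewrite (le_lt_trans _ ts)// ler_wpM2l//.
by rewrite lerDl.
Qed.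

(** Stated on remainders, so as to cover both the graph map, which adds an affine term, and the
    projection of a chart. *)
Lemma has_jac_mull m n p (g : 'cV[F]_m -> 'cV[F]_n) (G : 'cV[F]_m -> 'cV[F]_p) z A B
    (Q : 'M[F]_(p, n)) : has_jac g z A ->
  (forall h, G (z + h) - G z - B *m h = Q *m (g (z + h) - g z - A *m h)) -> has_jac G z B.
Proof.
move=> hg GE e e0; have Q0 : 0 < nrm Q + 1 by rewrite ltr_wpDl.
have [|d d0 hd] := hg (e / (nrm Q + 1)); first by rewrite divr_gt0.
exists d => // h /hd hh; rewrite GE (le_trans (nrmM _ _))//.
rewrite (@le_trans _ _ ((nrm Q + 1) * (e / (nrm Q + 1) * nrm h)))//.
  by apply: ler_pM => //; rewrite lerDl.
by rewrite mulrA mulrCA divff ?gt_eqF// mulr1.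
Qed.

(* The zeros of [L *m f] near [xs] form the graph of [psi]. When [xs] has a chart
   [phi], the projection of [phi] to the [z] coordinates is locally onto, so [f]
   itself vanishes on the whole graph, which is then a chart at all its points. *)
Lemma zero_branch n m d r Omega (f : 'cV[F]_m -> 'cV[F]_n) (xs : 'cV[F]_m) (dl C : R) :
  0 <= C -> 0 < dl -> (forall x, nrm (x - xs) < dl -> Omega x) -> taylor_ball f xs dl C ->
  zeros Omega f xs -> zero_dim Omega f xs d -> (d + r)%N = m ->
  \rank (jacobian_mx f xs) = r ->
  exists2 e : R, 0 < e & exists2 K : R, 0 <= K & forall x, nrm (x - xs) < e ->
    exists y, [/\ semiregular_zero Omega f y, same_branch Omega f xs y,
      \rank (jacobian_mx f y) = r, nrm (y - xs) < dl & nrm (x - y) <= K * nrm (f x)].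
Proof.
move=> C0 dl0 dlO tf [Oxs f0] xsd dr rA.
have [N [M [P [L [LAM AN PN PM NP]]]]] := split_coordinates dr rA.
have [rz [rw [psi [rz0 rw0 [pt hpsi low dpsi]]]]] := implicit_function C0 dl0 tf f0 LAM AN dl0.
pose J := jacobian_mx f.
pose Phi z := point xs N M z (psi z).
pose zc x := P *m (x - xs); pose wc x := L *m J xs *m (x - xs).
have ptE x : point xs N M (zc x) (wc x) = x.
  by rewrite /point /zc /wc !mulmxA -mulmxDl -[M *m L *m _]mulmxA NP mul1mx addrC subrK.
have zcE z w : zc (point xs N M z w) = z.
  by rewrite /zc /point addrC addKr mulmxDr !mulmxA PN PM mul1mx mul0mx addr0.
have wcE z w : wc (point xs N M z w) = w.
  by rewrite /wc /point addrC addKr mulmxDr -[L *m J xs *m (N *m z)]mulmxA [J xs *m _]mulmxA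
    AN mul0mx mulmx0 add0r mulmxA LAM mul1mx.
have p00 : point xs N M 0 0 = xs by rewrite /point !mulmx0 !addr0.
have psi0 : psi 0 = 0.
  have h : nrm (0 - psi 0) <= 0.
    by rewrite (le_trans (low 0 0 _ _)) ?nrm0// p00 f0 mulmx0 nrm0 mulr0.
  by apply/eqP; rewrite -oppr_eq0 -sub0r; apply/eqP/nrm_eq0/eqP; rewrite eq_le h nrm_ge0.
have Phi0 : Phi 0 = xs by rewrite /Phi psi0.
have cV0 (z : 'cV[F]_d) : d = 0%N -> z = 0.
  by move=> d0; apply/matrixP => i; exfalso; case: i => i; rewrite d0.
have PhiP x : nrm (zc x) < rz -> nrm (wc x) < rw -> f x = 0 -> Phi (zc x) = x.
  move=> zr wr fx; have h : nrm (wc x - psi (zc x)) <= 0.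
    by rewrite (le_trans (low _ _ zr wr))// ptE fx mulmx0 nrm0 mulr0.
  have {h}/nrm_eq0/eqP : nrm (wc x - psi (zc x)) = 0 by apply/eqP; rewrite eq_le h nrm_ge0.
  by rewrite subr_eq0 /Phi => /eqP <-; rewrite ptE.
have small (a b : R) : 0 < a -> 0 < b -> exists2 e : R, 0 < e &
    forall x, nrm (x - xs) < e -> nrm (zc x) < a /\ nrm (wc x) < b.
  move=> a0 b0; pose Q := nrm P + nrm (L *m J xs) + 1.
  have Q0 : 0 < Q by rewrite ltr_wpDl// addr_ge0.
  exists (Num.min a b / Q); first by rewrite divr_gt0// lt_min a0.
  move=> x; rewrite ltr_pdivlMr// lt_min => /andP[xa xb].
  split; rewrite (le_lt_trans (nrmM _ _))//.
    rewrite (le_lt_trans _ xa)// mulrC ler_wpM2l//.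
    by rewrite /Q -addrA lerDl addr_ge0.
  rewrite (le_lt_trans _ xb)// mulrC ler_wpM2l//.
  by rewrite /Q addrAC lerDr addr_ge0.
have dPhi z : nrm z < rz -> exists D, has_jac Phi z (N + M *m D).
  move=> /dpsi[D hD]; exists D; apply: (has_jac_mull (Q := M) hD) => h.
  rewrite /Phi /point !mulmxBr !mulmxDr mulmxDl mulmxA.
  move: (M *m psi _) (M *m psi _) (N *m z) (N *m h) (M *m D *m h) => *.
  by apply/matrixP => i j; rewrite !mxE; ring.
have rND D : \rank (N + M *m D)%R = d.
  apply/eqP; rewrite eqn_leq rank_leq_col -[X in (X <= _)%N](@mxrank1 F d).
  rewrite -(_ : P *m (N + M *m D) = 1%:M) ?mxrankM_maxr//.
  by rewrite mulmxDr mulmxA PN PM mul0mx addr0.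
have [rho /andP[rho0 rhoz] fPhi] : exists2 rho : R, 0 < rho <= rz &
    forall z, nrm z < rho -> f (Phi z) = 0.
  case: (xsd) => [[d0 _]|[phi [Lam [z0 ch]]]].
    exists rz; first by rewrite rz0 lexx.
    move=> z _; suff -> : z = 0 by rewrite Phi0.
    exact: cV0.
  case: ch => d0 [Delta [_ DO DZ]] oLam _ dphi _ Lz0 phiz0 rphi.
  have fphi u : Lam u -> f (phi u) = 0.
    move=> Lu; have : (phi @` Lam) (phi u) by exists u.
    by rewrite -DZ => -[_ []].
  have [e1 e10 he1] := (openP_nrm Lam).1 oLam z0 Lz0.
  have jphi := differentiable_has_jac (dphi z0 Lz0).
  set Jp := jacobian_mx phi z0 in jphi rphi.
  have AJ : J xs *m Jp = 0.
    have jf : has_jac f (phi z0) (J xs).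
      by rewrite phiz0; have [h _ _] := tf; apply: h; rewrite subrr nrm0.
    exact: jac_comp_eq0 jphi jf e10 (fun u hu => fphi u (he1 u hu)).
  (* The columns of [Jp] lie in the kernel of [J xs], hence in the range of [N], so the square
     matrix [P *m Jp] inherits the rank d. *)
  have JpE : Jp = N *m (P *m Jp).
    by rewrite mulmxA -[LHS]mul1mx -NP mulmxDl -!mulmxA AJ !mulmx0 addr0.
  pose g u := zc (phi u).
  have jg u : Lam u -> has_jac g u (P *m jacobian_mx phi u).
    move=> /dphi/differentiable_has_jac jg; apply: (has_jac_mull (Q := P) jg) => h.
    rewrite /g /zc !mulmxBr -mulmxA.
    move: (P *m phi _) (P *m phi _) (P *m xs) (P *m (_ *m h)) => *.
    by apply/matrixP => i j; rewrite !mxE; ring.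
  have gu : jacobian_mx g z0 \in unitmx.
    have [_ ->] := has_jac_differentiable (jg _ Lz0).
    rewrite -row_free_unit /row_free eqn_leq rank_leq_row/= -{1}rphi -/Jp {1}JpE.
    exact: mxrankM_maxr.
  have [e2 e20 he2] := small rz rw rz0 rw0.
  have [e3 e30 he3] := has_jac_continuous jphi e20.
  have [|rho rho0 hrho] := local_onto oLam Lz0 (fun u Lu => (has_jac_differentiable (jg u Lu)).1) gu
    (e := Num.min e1 e3); first by rewrite lt_min e10.
  exists (Num.min rho rz); first by rewrite lt_min rho0 rz0 ge_min lexx orbT.
  move=> z; rewrite lt_min => /andP[zr _].
  have [|u] := hrho z; first by rewrite /g phiz0 /zc subrr mulmx0 subr0.
  rewrite lt_min => /andP[/he1 Lu /he3]; rewrite phiz0 => /he2[h1 h2] guz.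
  (* [phi u] is a zero of [f] in the coordinate box, hence the point of the graph above its own z
     coordinate, which is [z]. *)
  by rewrite -guz /g PhiP// fphi.
(* At most r, because the kernel contains the d-dimensional tangent space of the graph; at least r,
   because L J M is invertible. *)
have rankJ z : nrm z < rho -> \rank (J (Phi z)) = r.
  move=> zr; have zr' := lt_le_trans zr rhoz.
  have [pr _] := hpsi z zr'; have [pdl pu] := pt z (psi z) zr' pr.
  have [D hD] := dPhi z zr'.
  have JND : J (Phi z) *m (N + M *m D) = 0.
    apply: (jac_comp_eq0 (phi := Phi) (z := z) (f := f) (e := rho - nrm z)) => //.
    - by have [h _ _] := tf; exact: h.
    - by rewrite subr_gt0.
    - move=> u uz; apply: fPhi; rewrite -[u](subrK z) (le_lt_trans (nrmD _ _))//; lra.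
  apply/eqP; rewrite eqn_leq; apply/andP; split.
    have := mulmx0_rank_max JND.
    by rewrite rND -[(_ <= r)%N](leq_add2l d) dr addnC.
  rewrite -[X in (X <= _)%N](mxrank_unit pu).
  by rewrite (leq_trans (mxrankM_maxl _ _))// mxrankM_maxr.
pose Lam := [set z : 'cV[F]_d | nrm z < rho].
have oLam : open Lam.
  apply/openP_nrm => z zr; exists (rho - nrm z); first by rewrite subr_gt0.
  by move=> y yz; rewrite /Lam/= -[y](subrK z) (le_lt_trans (nrmD _ _))//; lra.
have PhiLam z : Lam z -> [/\ nrm (zc (Phi z)) < rho, nrm (wc (Phi z)) < rw & nrm (Phi z - xs) < dl].
  move=> zr; have zr' := lt_le_trans zr rhoz; have [pr _] := hpsi z zr'.
  by rewrite zcE wcE; split=> //; have [] := pt z (psi z) zr' pr.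
have zPhi z : Lam z -> zeros Omega f (Phi z).
  by move=> Lz; have [_ _ /dlO h] := PhiLam z Lz; split=> //; exact: fPhi.
have rPhi z : Lam z -> differentiable Phi z /\ \rank (jacobian_mx Phi z) = d.
  move=> Lz; have [D /has_jac_differentiable[dP ->]] := dPhi z (lt_le_trans Lz rhoz).
  by split; last exact: rND.
have chart z : (0 < d)%N -> Lam z -> zero_chart Omega f (Phi z) Phi Lam z.
  move=> d0 Lz; split.
  - exact: d0.
  - exists [set x | nrm (zc x) < rho /\ nrm (wc x) < rw]; split.
    + split; last by have [] := PhiLam z Lz.
      apply/openP_nrm => x [xz xw].
      have [||e e0 he] := small (rho - nrm (zc x)) (rw - nrm (wc x)); rewrite ?subr_gt0//.
      exists e => // y yx; have [] := he (xs + (y - x)); first by rewrite addrC addKr.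
      have -> : zc (xs + (y - x)) = zc y - zc x.
        by rewrite /zc addrC addKr -mulmxBr opprB addrA subrK.
      have -> : wc (xs + (y - x)) = wc y - wc x.
        by rewrite /wc addrC addKr -mulmxBr opprB addrA subrK.
      rewrite /= => h1 h2; split.
        by rewrite -[zc y](subrK (zc x)) (le_lt_trans (nrmD _ _))//; lra.
      by rewrite -[wc y](subrK (wc x)) (le_lt_trans (nrmD _ _))//; lra.
    + move=> x [xz xw]; apply: dlO; rewrite -[x]ptE.
      by have [] := pt _ _ (lt_le_trans xz rhoz) xw.
    + apply/seteqP; split=> [x [[xz xw] [_ fx]]|_ [u Lu <-]].
        by exists (zc x) => //; exact: PhiP (lt_le_trans xz rhoz) xw fx.
      by split; [have [] := PhiLam u Lu|exact: zPhi].
  - exact: oLam.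
  - exact: connected_nrm_ball.
  - by move=> u /rPhi[].
  - by move=> u v _ _ uv; rewrite -[u](zcE u (psi u)) -[v](zcE v (psi v)) -/(Phi u) uv.
  - exact: Lz.
  - exact: erefl.
  - by have [] := rPhi z Lz.
have L0 : Lam 0 by rewrite /Lam/= nrm0.
have good z : Lam z -> semiregular_zero Omega f (Phi z) /\ same_branch Omega f xs (Phi z).
  move=> Lz; have [d0|d0] := posnP d.
    have -> : Phi z = xs.
      by rewrite -Phi0; congr Phi; exact: cV0.
    split; first by split=> //; exists d; rewrite // rA.
    apply: same_branch_isolated; case: xsd => [[]//|[phi [Lam' [z' [+ _ _ _ _ _ _ _ _]]]]].
    by rewrite d0.
  split.
    split; first exact: zPhi.
    exists d; last by rewrite rankJ.
    by right; exists Phi, Lam, z; exact: chart.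
  have ch := chart 0 d0 L0; rewrite Phi0 in ch.
  apply: (same_branch_chart ch (Lambda0 := Lam)); [by []|by []| |by exists z].
  by move=> u /rPhi[].
have [e e0 he] := small rho rw rho0 rw0.
exists e => //; exists (nrm M * (2 * nrm L)) => [|x /he[xz xw]]; first by rewrite !mulr_ge0.
have [sx bx] := good _ xz; exists (Phi (zc x)); split=> //.
- exact: rankJ.
- by have [] := PhiLam _ xz.
have -> : x - Phi (zc x) = M *m (wc x - psi (zc x)).
  rewrite -{1}[x]ptE /Phi /point mulmxBr.
  by move: (M *m _) (M *m _) (N *m _) => *; apply/matrixP => i j; rewrite !mxE; ring.
rewrite (le_trans (nrmM _ _))// -!mulrA ler_wpM2l//.
rewrite (le_trans (low _ _ (lt_le_trans xz rhoz) xw))// ptE ler_wpM2l//.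
exact: nrmM.
Qed.

End Branch.

(** * Convergence of the iteration *)

Section Newton.
Context {R : realType} {k : field_kind}.
Local Notation F := (field_of R k).

(* Splitting [f x = w + J (x - y)] with [w] quadratically small, the part [w] is
   harmless and [J - J G J] is small because [J] is close to a matrix of rank r. *)
Lemma newton_step n m r (f : 'cV[F]_m -> 'cV[F]_n) (x y : 'cV[F]_m) (G : 'M[F]_(m, n)) (C KA K1 : R) :
  0 <= C -> 0 <= KA -> f y = 0 -> \rank (jacobian_mx f y) = r -> nrm G <= KA ->
  (forall B, (\rank B <= r)%N ->
    nrm (jacobian_mx f x - jacobian_mx f x *m G *m jacobian_mx f x) <= KA * nrm (jacobian_mx f x - B)) ->
  nrm (jacobian_mx f x - jacobian_mx f y) <= C * nrm (x - y) ->
  nrm (f y - f x - jacobian_mx f x *m (y - x)) <= C * nrm (y - x) ^+ 2 ->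
  nrm (x - y) <= K1 * nrm (f x) ->
  nrm (f x - jacobian_mx f x *m (G *m f x)) <=
    ((1 + nrm (jacobian_mx f x) * KA) * C + KA * C) * K1 ^+ 2 * nrm (f x) ^+ 2.
Proof.
set J := jacobian_mx f x => C0 KA0 fy ry GK hB hC hT hK.
set v := x - y in hC hK.
pose w := f x - J *m v.
have wC : nrm w <= C * nrm v ^+ 2.
  have -> : w = - (f y - f x - J *m (y - x)).
    by rewrite fy sub0r -[y - x]opprB mulmxN opprK opprD opprK.
  by rewrite nrmN (le_trans hT)// nrmBC.
have -> : f x - J *m (G *m f x) = w - J *m (G *m w) + (J - J *m G *m J) *m v.
  have -> : J *m (G *m w) = J *m G *m f x - J *m G *m J *m v by rewrite mulmxA /w mulmxBr !mulmxA.
  rewrite mulmxBl /w mulmxA.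
  move: (f x) (J *m v) (J *m G *m f x) (J *m G *m J *m v) => *.
  by apply/matrixP => i j; rewrite !mxE; ring.
have v2 : nrm v ^+ 2 <= K1 ^+ 2 * nrm (f x) ^+ 2.
  by rewrite -exprMn lerXn2r ?nnegrE// (le_trans _ hK).
have h1 : nrm (J *m (G *m w)) <= nrm J * KA * nrm w.
  rewrite (le_trans (nrmM _ _))// -mulrA ler_wpM2l// (le_trans (nrmM _ _))//.
  by rewrite ler_wpM2r.
have h2 : nrm ((J - J *m G *m J) *m v) <= KA * C * nrm v ^+ 2.
  rewrite (le_trans (nrmM _ _))// expr2 !mulrA ler_wpM2r//.
  rewrite (le_trans (hB _ (eq_leq ry)))// -mulrA ler_wpM2l//.
rewrite (le_trans (nrmD _ _))// (le_trans (lerD (nrmB _ _) h2))//.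
rewrite (@le_trans _ _ (((1 + nrm J * KA) * C + KA * C) * nrm v ^+ 2))//.
  rewrite [leRHS]mulrDl lerD// -[leRHS]mulrA.
  rewrite (le_trans (lerD (lexx _) h1))// -{1}[nrm w]mul1r -mulrDl ler_wpM2l//.
  by rewrite addr_ge0// mulr_ge0.
by rewrite -mulrA ler_wpM2l// !(addr_ge0, mulr_ge0).
Qed.

(** With b_i = c th^(2^i), two bounds are carried along: |u_i - x0| <= b_0 - b_i keeps the iterates
    where the step estimates hold, and (K2 + 1) |f(u_i)| <= th^(2^i) is squared at each step. A step
    is at most KA |f(u_i)| <= b_i - b_(i+1), so a limit exists at distance O(b_i). *)
Lemma newton_convergence n m r (f : 'cV[F]_m -> 'cV[F]_n) (xs : 'cV[F]_m) (dl C e1 K1 : R)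
    (L : 'M[F]_(r, n)) (M : 'M[F]_(m, r)) :
  0 <= C -> 0 < dl -> taylor_ball f xs dl C -> f xs = 0 ->
  L *m jacobian_mx f xs *m M = 1%:M -> 0 < e1 ->
  (forall x, nrm (x - xs) < e1 -> exists y, [/\ f y = 0, \rank (jacobian_mx f y) = r,
    nrm (y - xs) < dl & nrm (x - y) <= K1 * nrm (f x)]) ->
  forall eta : R, 0 < eta -> exists2 rho : R, 0 < rho & forall x0, nrm (x0 - xs) < rho ->
    exists xhat, [/\ nrm (xhat - xs) < eta, f xhat = 0,
      forall i, nrm (newton_iter f r x0 i - xs) < eta &
      converges_quadratically (newton_iter f r x0) xhat].
Proof.
move=> C0 dl0 tf f0 LAM e10 hy eta eta0.
have [dA dA0 [KA KA0 hA]] := newton_matrix_bounds LAM.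
pose J := jacobian_mx f; have C10 : 0 < C + 1 by rewrite ltr_wpDl.
have [e [e0 edl ee1 eta_e eA]] : exists e : R, [/\ 0 < e, e <= dl, e <= e1, e <= eta & C * e <= dA].
  exists (Num.min (Num.min dl e1) (Num.min eta (dA / (C + 1)))); split.
  - by rewrite !lt_min dl0 e10 eta0 divr_gt0.
  - by rewrite !ge_min lexx.
  - by rewrite !ge_min lexx orbT.
  - by rewrite !ge_min lexx !orbT.
  - apply: (@le_trans _ _ (C * (dA / (C + 1)))).
      by rewrite ler_wpM2l// !ge_min lexx !orbT.
    by rewrite mulrCA ger_pMr// ler_pdivrMr// mul1r lerDl.
have [_ JC fC] := tf.
have xs_e : nrm (xs - xs) < e by rewrite subrr nrm0.
have Jn x : nrm (x - xs) < e -> nrm (J x - J xs) < dA.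
  move=> xe; rewrite (le_lt_trans (JC _ _ (lt_le_trans xs_e edl) (lt_le_trans xe edl)))//.
  have [C00|C00] := eqVneq C 0; first by rewrite C00 mul0r.
  by rewrite (lt_le_trans _ eA)// ltr_pM2l// lt_def C00.
pose Jb := nrm (J xs) + dA.
have Jb0 : 0 <= Jb by rewrite addr_ge0// ltW.
(* The first summand bounds the Taylor remainder over the step, the second the linearized residual,
   by [newton_step]. *)
pose K2 := C * KA ^+ 2 + ((1 + Jb * KA) * C + KA * C) * K1 ^+ 2.
have K20 : 0 <= K2 by rewrite /K2 !(sqr_ge0, addr_ge0, mulr_ge0) ?(ltW dA0).
pose step x := x - mpinv (rank_proj r (J x)) *m f x.
have step1 x : nrm (x - xs) < e -> nrm (step x - x) <= KA * nrm (f x).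
  move=> xe; have [GK _] := hA _ (Jn x xe).
  by rewrite /step addrAC subrr sub0r nrmN (le_trans (nrmM _ _))// ler_wpM2r.
have step2 x : nrm (x - xs) < e -> nrm (step x - xs) < e -> nrm (f (step x)) <= K2 * nrm (f x) ^+ 2.
  move=> xe xe'; have [GK hB] := hA _ (Jn x xe).
  have xdl := lt_le_trans xe edl; have xdl' := lt_le_trans xe' edl.
  have [y [fy ry ydl xy]] := hy x (lt_le_trans xe ee1).
  have h := newton_step C0 KA0 fy ry GK hB (JC _ _ ydl xdl) (fC _ _ xdl ydl) xy.
  have h1 := fC _ _ xdl xdl'.
  have -> : f (step x) = (f (step x) - f x - J x *m (step x - x)) +
      (f x - J x *m (mpinv (rank_proj r (J x)) *m f x)).
    have -> : step x - x = - (mpinv (rank_proj r (J x)) *m f x) by rewrite /step addrAC subrr sub0r.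
    rewrite mulmxN; move: (f (step x)) (f x) (J x *m _) => *.
    by apply/matrixP => i j; rewrite !mxE; ring.
  rewrite (le_trans (nrmD _ _))// /K2 mulrDl lerD//.
    rewrite (le_trans h1)// -mulrA ler_wpM2l// -exprMn lerXn2r ?nnegrE ?mulr_ge0//.
    exact: step1.
  rewrite (le_trans h)// ler_wpM2r ?sqr_ge0// ler_wpM2r ?sqr_ge0// lerD2r ler_wpM2r//.
  rewrite lerD2l ler_wpM2r// -[jacobian_mx f x](subrK (J xs)) (le_trans (nrmD _ _))// addrC.
  by rewrite lerD2l ltW// Jn.
pose Kf := nrm (J xs) + 3 * C * e.
have Kf0 : 0 <= Kf by rewrite addr_ge0// !mulr_ge0// ltW.
have fK x y : nrm (x - xs) < e -> nrm (y - xs) < e -> nrm (f y - f x) <= Kf * nrm (y - x).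
  move=> xe ye; have h := taylor_strict C0 tf edl xe ye.
  rewrite -[f y - f x](subrK (J xs *m (y - x))) (le_trans (nrmD _ _))// addrC /Kf mulrDl lerD//.
  exact: nrmM.
pose D : R := (m * 1 * 2)%:R; have D0 : 0 <= D by [].
(* The factor 2 makes up for the subtraction of b_(i+1), which is at most b_i / 2 since th <=
   1/2. *)
pose c := 2 * KA / (K2 + 1).
have K210 : 0 < K2 + 1 by rewrite ltr_wpDl.
have c0 : 0 <= c by rewrite divr_ge0 ?mulr_ge0// ltW.
pose s := (D + 1) * c + 1.
have s1 : 1 <= s by rewrite lerDr mulr_ge0// addr_ge0.
have s0 : 0 < s by rewrite (lt_le_trans ltr01).
(* [D] is the constant of [mx_complete]. The bound D c mu <= 1 serves the constant of quadratic
   convergence, the last one keeps the iterates and the limit within e of [xs]. *)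
have [mu [mu0 mu1 cmu cme]] : exists mu : R, [/\ 0 < mu, mu <= 1, D * c * mu <= 1 & (D + 1) * c * mu <= e / 4].
  have msE : Num.min 1 (e / 4) = Num.min 1 (e / 4) / s * s by rewrite divfK// gt_eqF.
  have m0 : 0 < Num.min 1 (e / 4) :> R by rewrite lt_min ltr01 divr_gt0.
  have h1 : Num.min 1 (e / 4) <= 1 :> R by rewrite ge_min lexx.
  have h2 : Num.min 1 (e / 4) <= e / 4 by rewrite ge_min lexx orbT.
  exists (Num.min 1 (e / 4) / s); move: (Num.min 1 (e / 4)) m0 h1 h2 msE => q q0 h1 h2 qE.
  have p0 : 0 < q / s by rewrite divr_gt0.
  move: (q / s) p0 qE => p p0 qE.
  have hc := mulr_ge0 c0 (ltW p0).
  have hDc := mulr_ge0 (mulr_ge0 D0 c0) (ltW p0).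
  move: qE; rewrite /s mulrDr mulr1 mulrC => qE.
  split=> //; rewrite ?mulrDl ?mul1r in qE *; lra.
pose th := mu / 2.
have th0 : 0 < th by rewrite divr_gt0.
have th2 : th <= 2^-1 by rewrite /th; lra.
pose b i := c * th ^+ (2 ^ i)%N.
have thi i : 0 <= th ^+ (2 ^ i)%N by rewrite exprn_ge0// ltW.
have b0 i : 0 <= b i by rewrite mulr_ge0.
have thS i : th ^+ (2 ^ i.+1)%N = th ^+ (2 ^ i)%N ^+ 2 by rewrite -exprM expnSr.
have th_half i : th ^+ (2 ^ i)%N <= 2^-1.
  rewrite (le_trans _ th2)// -[leRHS]expr1 ler_wiXn2l ?(ltW th0) ?expn_gt0//.
  by rewrite (le_trans th2)// invf_le1// ler1n.
have b_step i : KA / (K2 + 1) * th ^+ (2 ^ i)%N <= b i - b i.+1.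
  rewrite /b thS; have := th_half i; have := thi i; move: (th ^+ _) => t t0 t2.
  have -> : KA / (K2 + 1) = c / 2 by rewrite /c; field; rewrite gt_eqF.
  have tt : t ^+ 2 <= t / 2 by rewrite expr2 ler_wpM2l.
  have := ler_wpM2l c0 tt; lra.
have b00 : b 0 <= e / 8.
  rewrite /b expn0 expr1 /th; have := mulr_ge0 (mulr_ge0 D0 c0) (ltW mu0).
  by move: cme; rewrite !mulrDl mul1r; lra.
have Db00 : D * b 0 <= e / 8.
  rewrite /b expn0 expr1 /th; have := mulr_ge0 c0 (ltW mu0).
  by move: cme; rewrite !mulrDl mul1r; lra.
have Kf10 : 0 < Kf + 1 by rewrite ltr_wpDl.
(* The first bound leaves room for the total displacement; the second gives (K2 + 1) |f(x0)| <= th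
   through the Lipschitz constant Kf. *)
exists (Num.min (e / 4) (th / ((K2 + 1) * (Kf + 1)))).
  by rewrite lt_min !divr_gt0// mulr_gt0.
move=> x0; rewrite lt_min => /andP[x0e x0th].
set u := newton_iter f r x0.
have uS i : u i.+1 = step (u i) by [].
have near i : nrm (u i - x0) <= b 0 - b i -> nrm (u i - xs) < e.
  move=> h; rewrite (le_lt_trans (nrm_triangle _ x0 _))//; have := b0 i; lra.
have inv i : nrm (u i - x0) <= b 0 - b i /\ (K2 + 1) * nrm (f (u i)) <= th ^+ (2 ^ i)%N.
  elim: i => [|i [IH1 IH2]].
    split; first by rewrite /u/= !subrr nrm0.
    have x0e' : nrm (x0 - xs) < e by lra.
    have := fK _ _ xs_e x0e'; rewrite f0 subr0 expn0 expr1 => h.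
    move: x0th; rewrite ltr_pdivlMr ?mulr_gt0// => x0th.
    rewrite (le_trans _ (ltW x0th))// mulrCA ler_wpM2l ?(ltW K210)//.
    by rewrite (le_trans h)// mulrC ler_wpM2l// lerDl.
  have ui := near i IH1.
  have st : nrm (u i.+1 - u i) <= b i - b i.+1.
    rewrite (le_trans _ (b_step i))// uS (le_trans (step1 _ ui))// -mulrA ler_wpM2l//.
    by rewrite mulrC ler_pdivlMr// mulrC.
  have IH1' : nrm (u i.+1 - x0) <= b 0 - b i.+1.
    by rewrite (le_trans (nrm_triangle _ (u i) _))//; lra.
  split=> //; have ui' := near _ IH1'.
  rewrite thS uS (@le_trans _ _ (((K2 + 1) * nrm (f (u i))) ^+ 2))//; last first.
    by rewrite lerXn2r ?nnegrE ?mulr_ge0// ltW.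
  rewrite exprMn expr2 -mulrA ler_wpM2l ?(ltW K210)//.
  rewrite (le_trans (step2 _ ui ui'))// ler_wpM2r ?sqr_ge0//.
  by rewrite lerDl.
have ust i : nrm (u i.+1 - u i) <= b i - b i.+1.
  have [IH1 IH2] := inv i.
  rewrite (le_trans _ (b_step i))// uS (le_trans (step1 _ (near i IH1)))// -mulrA ler_wpM2l//.
  by rewrite mulrC ler_pdivlMr// mulrC.
have [l hl] := mx_complete b0 ust; rewrite -/D in hl.
have le : nrm (l - xs) < e.
  rewrite (le_lt_trans (nrm_triangle _ x0 _))// nrmBC.
  have := hl 0; rewrite {1}/u/=; lra.
exists l; split.
- exact: lt_le_trans le eta_e.
- apply/nrm_eq0/eqP; rewrite eq_le nrm_ge0 andbT; apply/ler_addgt0Pr => eps eps0; rewrite add0r.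
  have cst0 := addr_ge0 (mulr_ge0 Kf0 (mulr_ge0 D0 c0)) (@ler01 R).
  have [i hi] := half_power_small cst0 eps0.
  rewrite (le_trans _ (ltW hi))//.
  have thi2 : th ^+ (2 ^ i)%N <= 2^-1 ^+ i.
    rewrite (@le_trans _ _ (2^-1 ^+ (2 ^ i)%N))//.
      by rewrite lerXn2r ?nnegrE// ltW.
    by rewrite ler_wiXn2l ?invf_le1 ?ler1n// ltnW// ltn_expl.
  rewrite (@le_trans _ _ ((Kf * (D * c) + 1) * th ^+ (2 ^ i)%N)) ?ler_wpM2l//.
  have [IH1 IH2] := inv i.
  rewrite -[f l](subrK (f (u i))) (le_trans (nrmD _ _))// mulrDl mul1r lerD//.
    rewrite (le_trans (fK _ _ (near i IH1) le))// -mulrA ler_wpM2l// nrmBC.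
    by rewrite (le_trans (hl i))// /b mulrA.
  by rewrite (le_trans _ IH2)// ler_peMl// lerDr.
- move=> i; have [IH1 _] := inv i; exact: lt_le_trans (near i IH1) eta_e.
(* As th = mu / 2, its powers split into powers of 1/2 and a factor at most mu, which absorbs D c;
   the prefactor 1 / (1 - h) equals 2. *)
- exists 2^-1; first by rewrite invr_gt0 invf_lt1 ?ltr1n// ltr0n.
  move=> i; rewrite (le_trans (norm2_le_nrm _))// (le_trans (hl i))//.
  have -> : 1 / (1 - 2^-1) = 2 :> R by field.
  have h1 : th ^+ (2 ^ i)%N <= mu * 2^-1 ^+ (2 ^ i)%N.
    rewrite /th exprMn ler_wpM2r ?exprn_ge0// -[leRHS]expr1 ler_wiXn2l ?(ltW mu0) ?expn_gt0//.
  have p0 : 0 <= (2^-1 : R) ^+ (2 ^ i)%N by rewrite exprn_ge0.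
  have Dc0 : 0 <= D * c by rewrite mulr_ge0.
  rewrite /b; have := ler_wpM2l Dc0 h1; have := ler_wpM2r p0 cmu.
  by rewrite !mulrA mul1r => h2 h3; rewrite (le_trans h3)// (le_trans h2)// ler_peMl// ler1n.
Qed.

End Newton.

Theorem theorem4p1 (R : realType) (k : field_kind) (m n : nat)
  (Omega : set 'cV[field_of R k]_m)
  (f : 'cV[field_of R k]_m -> 'cV[field_of R k]_n)
  (xs : 'cV[field_of R k]_m) (r : nat) :
  open Omega ->
  smooth Omega f ->
  semiregular_zero Omega f xs ->
  r = \rank (jacobian_mx f xs) ->
  forall Omega1 : set 'cV[field_of R k]_m, open_nbhs xs Omega1 ->
  exists2 Omega0 : set 'cV[field_of R k]_m, nbhs xs Omega0 &
    forall x0, Omega0 x0 ->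
    exists xhat : 'cV[field_of R k]_m,
      [/\ Omega1 xhat,
          semiregular_zero Omega f xhat,
          same_branch Omega f xs xhat,
          forall i, Omega (newton_iter f r x0 i) &
          converges_quadratically (newton_iter f r x0) xhat].
Proof.
move=> oO sm [[Oxs f0] [d xsd dr]] rE Omega1 [oO1 O1xs]; rewrite -rE in dr.
have [dl dl0 [C C0 [dlO tf]]] := smooth_taylor oO sm Oxs.
have [e1 e10 [K1 _ br]] := zero_branch C0 dl0 dlO tf (conj Oxs f0) xsd dr (esym rE).
have [N [M [P [L [LAM _ _ _ _]]]]] := split_coordinates dr (esym rE).
have [e2 e20 he2] := (openP_nrm Omega1).1 oO1 xs O1xs.
have hy x : nrm (x - xs) < e1 -> exists y, [/\ f y = 0, \rank (jacobian_mx f y) = r,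
    nrm (y - xs) < dl & nrm (x - y) <= K1 * nrm (f x)].
  by move=> /br[y [[[_ fy] _] _ ry ydl xy]]; exists y.
(* e1 gives the limit a foot on the branch, e2 puts it in [Omega1], and dl keeps the iterates in
   [Omega]. *)
have eta0 : 0 < Num.min (Num.min e1 e2) dl by rewrite !lt_min e10 e20.
have [rho rho0 hrho] := newton_convergence C0 dl0 tf f0 LAM e10 hy eta0.
exists [set x | nrm (x - xs) < rho]; first exact: nbhs_nrm.
move=> x0 /hrho[l [+ fl ul lq]]; rewrite !lt_min => /andP[/andP[le1 le2] _].
(* The limit is a zero, so its foot y on the branch, at distance at most K1 |f l| = 0, is the limit
   itself. *)
have [y [sy by_ _ _ ly]] := br l le1.
have ylE : y = l.
  apply/eqP; rewrite eq_sym -subr_eq0; apply/eqP/nrm_eq0/eqP.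
  by rewrite eq_le nrm_ge0 andbT (le_trans ly)// fl nrm0 mulr0.
rewrite ylE in sy by_; exists l; split=> //; first exact: he2.
by move=> i; apply: dlO; have := ul i; rewrite !lt_min => /andP[].
Qed.
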